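(* Let $\mathfrak g$ be a weakly root graded complex Banach--Lie algebra, $\mathfrak p\subseteq\mathfrak g$ a parabolic subalgebra, and $(\rho_E,E)$ a Banach representation of $\mathfrak p$ which decomposes into finitely many $\mathfrak h$-weight spaces. Endow $V_c:=\mathrm{Hom}_{\mathfrak p}(U(\mathfrak g),E)_c$ with its natural Fréchet structure. Then the subspace $V_f:=V_c^{[\mathfrak g_\Delta]}$ of $\mathfrak g_\Delta$-finite elements of $V_c$ is a closed $\mathfrak g$-invariant subspace which is a Banach space (i.e. the induced topology is defined by a complete norm), and the representation of $\mathfrak g$ on $V_f$ is continuous, i.e. the bilinear map $\mathfrak g\times V_f\to V_f$ is continuous.
   Context: Weakly root graded Lie algebras: Let $\Delta$ be a finite reduced root system and $\mathfrak g_\Delta$ the corresponding finite-dimensional complex semisimple Lie algebra. A complex Banach--Lie algebra $\mathfrak g$ is weakly $\Delta$-graded if $\mathfrak g_\Delta$ is a Lie subalgebra of $\mathfrak g$ and, for some (hence each) Cartan subalgebra $\mathfrak h$ of $\mathfrak g_\Delta$, $\mathfrak g=\mathfrak g_0\oplus\bigoplus_{\alpha\in\mathcal R}\mathfrak g_\alpha$ (a finite direct sum), where $\mathfrak g_\alpha=\{x\in\mathfrak g:[h,x]=\alpha(h)x\ \forall h\in\mathfrak h\}$ and $\mathcal R\subseteq\mathfrak h^*\setminus\{0\}$ is the finite set of nonzero weights occurring. It is weakly root graded if it is weakly $\Delta$-graded for some $\Delta$. Fix $\mathfrak h$. For $\alpha\in\Delta$ the coroot $\check\alpha$ is the unique element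 of $[\mathfrak g_{\Delta,\alpha},\mathfrak g_{\Delta,-\alpha}]$ with $\alpha(\check\alpha)=2$; $\mathfrak h_{\mathbb R}$ is the real span of the coroots, and all elements of $\mathcal R$ are real-valued on it. Parabolic subalgebras: A parabolic system is a set $\Sigma=\{\alpha\in\mathcal R:\alpha(x_\Sigma)\ge 0\}$ for some $x_\Sigma\in\mathfrak h_{\mathbb R}$; the corresponding parabolic subalgebra is $\mathfrak p=\mathfrak g_0+\sum_{\alpha\in\Sigma}\mathfrak g_\alpha$. Representations: A Banach representation of $\mathfrak p$ on a Banach space $E$ is a continuous Lie algebra homomorphism $\rho_E:\mathfrak p\to\mathfrak{gl}(E)$, the bounded operators on $E$. $\mathfrak h$-weight spaces are simultaneous $\mathfrak h$-eigenspaces. $U(\mathfrak g)$ is the algebraic enveloping algebra. A linear map $\beta:U(\mathfrak g)\to E$ is called continuous if for each $n\in\mathbb N_0$ the $n$-linear map $\beta_n:\mathfrak g^n\to E$, $\beta_n(x_1,\dots,x_n)=\beta(x_1\cdots x_n)$, is continuous ($\beta_0=\beta(1)$). $\mathrm{Hom}(U(\mathfrak g),E)_c$ is the space of these maps, with the topology defined by the seminorms $p_n(\beta)=\|\beta_n\|=\sup\{\|\beta_n(x_1,\dots,x_n)\|:\|x_i\|\le1\}$, $n\in\mathbb N_0$; it is a Fréchet space. $\mathrm{Hom}_{\mathfrak p}(U(\mathfrak g),E)_c$ is the closed subspace of those $\beta$ with $\beta(Dx)=-\rho_E(x)\beta(D)$ for $x\in\mathfrak p$, $D\in U(\mathfrak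 g)$; $\mathfrak g$ acts on it by $(x.\beta)(D)=-\beta(xD)$. For a $\mathfrak g$-module $W$, $W^{[\mathfrak g_\Delta]}=\{v\in W:\dim(U(\mathfrak g_\Delta)v)<\infty\}$. *)

(* Defs.v *)
From HB Require Import structures.
From mathcomp Require Import all_boot all_order all_algebra complex.
From mathcomp Require Import all_classical all_reals all_analysis.
Set Implicit Arguments.
Unset Strict Implicit.
Unset Printing Implicit Defensive.
Import Order.TTheory GRing.Theory Num.Theory.
Import numFieldNormedType.Exports.
Local Open Scope classical_set_scope.
Local Open Scope ring_scope.
Local Open Scope complex_scope.

Section LinearSpan.
Context {K : nzRingType} {V : lmodType K}.

Definition lspan (S : set V) : set V :=
  [set x | exists n (c : 'I_n -> K) (s : 'I_n -> V),
     (forall i, S (s i)) /\ x = \sum_(i < n) c i *: s i].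

Definition is_subspace (S : set V) : Prop :=
  S 0 /\ forall a u v, S u -> S v -> S (a *: u + v).

Definition finite_dim (S : set V) : Prop :=
  exists n (s : 'I_n -> V), S `<=` lspan (range s).

End LinearSpan.

Record lie_bracket {K : nzRingType} {L : lmodType K} (br : L -> L -> L) : Prop :=
  LieBracket {
    lie_linearl : forall y, linear (br^~ y);
    lie_linearr : forall x, linear (br x);
    lie_alt : forall x, br x x = 0;
    lie_jacobi : forall x y z,
      br x (br y z) + br y (br z x) + br z (br x y) = 0 }.

Section FiniteDimensionalLie.
Context {K : fieldType} {L : vectType K} (br : L -> L -> L).
Implicit Types U W I h : {vspace L}.

Definition lie_prod U W : {vspace L} :=
  (<<[seq br u w | u <- (vbasis U : seq L), w <- (vbasis W : seq L)]>>)%VS.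

Definition lie_subalgebra h : Prop := (lie_prod h h <= h)%VS.

Definition lie_ideal I : Prop := (lie_prod fullv I <= I)%VS.

Definition lie_solvable I : Prop :=
  exists n, iter n (fun U => lie_prod U U) I = 0%VS.

Definition lie_nilpotent h : Prop := exists n, iter n (lie_prod h) h = 0%VS.

Definition lie_semisimple : Prop :=
  forall I, lie_ideal I -> lie_solvable I -> I = 0%VS.

Definition cartan_subalgebra h : Prop :=
  [/\ lie_subalgebra h, lie_nilpotent h &
      forall x, (forall y, y \in h -> br x y \in h) -> x \in h].

End FiniteDimensionalLie.

(* [T] plays the role of the Cartan subalgebra, acting on [W] through [act]. *)

Section Weights.
Context {K : fieldType} {T : vectType K} {W : lmodType K} (act : T -> W -> W).

Definition dual_space := 'Hom(T, K^o).

Definition weight_space (lam : dual_space) : set W :=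
  [set x | forall t, act t x = lam t *: x].

Definition nonzero_weights : set dual_space :=
  [set lam | lam <> 0 /\ exists2 x, weight_space lam x & x <> 0].

Definition weight_sum (P : set dual_space) : set W :=
  [set x | exists2 f : dual_space -> W,
     forall lam, P lam -> weight_space lam (f lam) &
     x = \sum_(lam \in P) f lam].

(* [W] is the direct sum of the weight spaces indexed by the finite set [P];
   outside [P] the components are normalised to zero, so that [exists!] is
   uniqueness of the components. *)
Definition weight_decomposition (P : set dual_space) : Prop :=
  finite_set P /\
  forall x, exists! f : dual_space -> W,
    [/\ forall lam, P lam -> weight_space lam (f lam),
        forall lam, ~ P lam -> f lam = 0 &
        x = \sum_(lam \in P) f lam].

End Weights.

Section RootSystem.
Context {R : realType} {V : vectType R}.

Record reduced_root_system (Phi : seq V) : Prop := ReducedRootSystem {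
  roots_span : <<Phi>>%VS = fullv;
  roots_neq0 : 0 \notin Phi;
  roots_reflection : forall a, a \in Phi -> exists f : 'Hom(V, R^o),
    [/\ f a = 2,
        forall b, b \in Phi -> b - f b *: a \in Phi &
        forall b, b \in Phi -> (f b : R) \is a Num.int];
  roots_reduced : forall a (c : R),
    a \in Phi -> c *: a \in Phi -> c = 1 \/ c = -1 }.

End RootSystem.

Section SemisimpleRoots.
Context {R : realType} {L : vectType R[i]} (br : L -> L -> L) (h : {vspace L}).

Definition ad_cartan (t : subvs_of h) (x : L) : L := br (vsval t) x.

Definition lie_roots := nonzero_weights ad_cartan.

Definition is_coroot (alpha : dual_space (T := subvs_of h))
    (c : subvs_of h) : Prop :=
  lspan [set z | exists x y, [/\ weight_space ad_cartan alpha x,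
                                 weight_space ad_cartan (- alpha) y &
                                 z = br x y]] (vsval c)
  /\ alpha c = 2.

Definition real_cartan : set (subvs_of h) :=
  [set t | exists n (r : 'I_n -> R) (c : 'I_n -> subvs_of h),
     (forall i, exists2 alpha, lie_roots alpha & is_coroot alpha (c i)) /\
     t = \sum_(i < n) (r i)%:C *: c i].

(* The roots of [(L, h)] form a root system isomorphic to [Phi]: [j] identifies
   the real vector space [V] spanned by [Phi] with the real span of the roots
   inside the complex dual of [h]. *)
Definition has_root_system (V : vectType R) (Phi : seq V) : Prop :=
  exists j : V -> dual_space (T := subvs_of h),
    [/\ forall a b, j (a + b) = j a + j b,
        forall (r : R) a, j (r *: a) = r%:C *: j a,
        injective j &
        lie_roots = j @` [set` Phi]].

(* [L] is the Lie algebra $\mathfrak g_\Delta$ with $\Delta$ = [Phi], and [h]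
   is a Cartan subalgebra of it. *)
Record lie_algebra_of_root_system (V : vectType R) (Phi : seq V) : Prop :=
  LieAlgebraOfRootSystem {
    gDelta_lie : lie_bracket br;
    gDelta_semisimple : lie_semisimple br;
    gDelta_cartan : cartan_subalgebra br h;
    gDelta_roots : has_root_system Phi }.

End SemisimpleRoots.

Section BanachLie.
Context {R : realType} {g : completeNormedModType R[i]} (br : g -> g -> g).

Definition banach_lie_algebra : Prop :=
  lie_bracket br /\ continuous (fun z : g * g => br z.1 z.2).

Context {gD : vectType R[i]} (brD : gD -> gD -> gD) (h : {vspace gD})
        (iota : gD -> g).

(* [iota] realises $\mathfrak g_\Delta$ as a Lie subalgebra of [g]. *)
Definition lie_embedding : Prop :=
  [/\ linear iota, injective iota &
      forall x y, iota (brD x y) = br (iota x) (iota y)].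

Definition ad_graded (t : subvs_of h) (x : g) : g := br (iota (vsval t)) x.

Definition graded_weights := nonzero_weights ad_graded.

Record weakly_graded (V : vectType R) (Delta : seq V) : Prop := WeaklyGraded {
  wg_root_system : reduced_root_system Delta;
  wg_banach_lie : banach_lie_algebra;
  wg_gDelta : lie_algebra_of_root_system brD h Delta;
  wg_embedding : lie_embedding;
  wg_decomposition : weight_decomposition ad_graded (0 |` graded_weights) }.

(* In [R[i]], [0 <= z] means that [z] is real and nonnegative. *)
Definition parabolic_system (xS : subvs_of h)
  : set (dual_space (T := subvs_of h)) :=
  [set alpha | graded_weights alpha /\ (0 : R[i]) <= alpha xS].

Definition parabolic_subalgebra (p : set g) : Prop :=
  exists2 xS, real_cartan brD xS &
    p = weight_sum ad_graded (0 |` parabolic_system xS).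

End BanachLie.

Section BanachRepresentation.
Context {R : realType}.

(* The library norm on a space over [R[i]] takes values in [R[i]]. *)
Definition rnorm {V : normedModType R[i]} (v : V) : R := complex.Re `|v|.

Definition opnorm {E : normedModType R[i]} (T : E -> E) : R :=
  sup [set rnorm (T v) | v in [set v : E | rnorm v <= 1]].

Context {g E : completeNormedModType R[i]} (br : g -> g -> g) (p : set g).

(* Only the values of [rho] on [p] matter.  The last field is continuity of
   [rho] from [p] to the bounded operators with the operator norm. *)
Record banach_rep (rho : g -> E -> E) : Prop := BanachRep {
  rep_bounded : forall x, p x -> linear (rho x) /\ continuous (rho x);
  rep_linear : forall (a : R[i]) x y v, p x -> p y ->
    rho (a *: x + y) v = a *: rho x v + rho y v;
  rep_bracket : forall x y v, p x -> p y ->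
    rho (br x y) v = rho x (rho y v) - rho y (rho x v);
  rep_continuous : forall x, p x -> forall e : R, 0 < e ->
    exists2 d : R, 0 < d &
      forall y, p y -> rnorm (y - x) < d ->
        opnorm (fun v => rho y v - rho x v) < e }.

End BanachRepresentation.

(* [U] is not constructed: [(U, sigma)] is pinned down, up to a unique
   isomorphism, by its universal property among associative algebras. *)
Definition enveloping_algebra {K : fieldType} {L : lmodType K}
    (br : L -> L -> L) {U : algType K} (sigma : {linear L -> U}) : Prop :=
  (forall x y, sigma (br x y) = sigma x * sigma y - sigma y * sigma x) /\
  forall (A : algType K) (f : {linear L -> A}),
    (forall x y, f (br x y) = f x * f y - f y * f x) ->
    exists phi : {lrmorphism U -> A},
      (forall x, phi (sigma x) = f x) /\
      forall psi : {lrmorphism U -> A},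
        (forall x, psi (sigma x) = f x) -> psi =1 phi.

Lemma continuous_lincomb {K : numFieldType} {E : normedModType K}
    {T : topologicalType} (a : K) (f1 f2 : T -> E) :
  continuous f1 -> continuous f2 -> continuous (fun x => a *: f1 x + f2 x).
Proof. by move=> c1 c2 x; apply: cvgD; [apply: cvgZl_tmp; exact: c1|exact: c2]. Qed.

Lemma continuous_oppcomp {K : numFieldType} {E : normedModType K}
    {T S : topologicalType} (f : T -> S) (h : S -> E) :
  continuous f -> continuous h -> continuous (fun x => - h (f x)).
Proof.
move=> cf ch x; apply: (@cvgN _ _ _ _ _ (fun x => h (f x))).
exact: (continuous_comp (cf x) (ch (f x))).
Qed.

Lemma ptws_continuous {n : nat} {T X : topologicalType}
    (f : T -> {ptws 'I_n -> X}) :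
  (forall i, continuous (fun t => f t i)) -> continuous f.
Proof.
move=> fi t; apply/cvg_sup => i.
exact: (continuous_comp_initial (fi i) (x := t)).
Qed.

Lemma ptws_nbhs0 {n : nat} {K : numFieldType} {V : normedModType K}
    (A : set {ptws 'I_n -> V}) :
  nbhs ((fun=> 0) : {ptws 'I_n -> V}) A ->
  exists2 d : K, 0 < d & forall x, (forall i, `|x i| < d) -> A x.
Proof.
pose F : set_system {ptws 'I_n -> V} :=
  filter_from [set d : K | 0 < d] (fun d => [set x | forall i, `|x i| < d]).
have FF : Filter F.
  apply: filter_from_filter; first by exists 1; exact: ltr01.
  move=> d e d0 e0.
  have cde : d >=< e by apply: real_comparable; exact: gtr0_real.
  exists (Num.min d e); first by rewrite /= comparable_lt_min// d0.
  move=> x xde; split=> i; apply: (lt_le_trans (xde i)).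
    by rewrite comparable_ge_min// lexx.
  by rewrite comparable_ge_min// lexx orbT.
suff FA : F --> ((fun=> 0) : {ptws 'I_n -> V}).
  by move=> /FA[d d0 dA]; exists d => // x xd; exact: dA.
apply/cvg_sup => i B [C [[D oD <-] /= D0 DB]].
have /nbhs_ballP[e e0 eD] : nbhs (0 : V) D by exact: open_nbhs_nbhs.
exists e => // x xe; apply: DB; apply: eD.
by rewrite -ball_normE /= sub0r normrN; exact: xe.
Qed.

Section ContinuousHom.
Context {K : numFieldType} {g : normedModType K} {U : algType K}
        (sigma : {linear g -> U}) (E : normedModType K).

Definition word_map (beta : U -> E) (n : nat) (x : {ptws 'I_n -> g}) : E :=
  beta (\prod_(i < n) sigma (x i)).

Definition cont_hom_pred (beta : U -> E) : Prop :=
  linear beta /\ forall n, continuous (word_map beta (n := n)).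

Definition cont_hom : {pred U -> E} := [pred beta | `[< cont_hom_pred beta >]].

Lemma cont_hom_submod : submod_closed cont_hom.
Proof.
split.
  apply/asboolP; split=> [a x y|n]; first by rewrite /= scaler0 addr0.
  have -> : word_map (0 : U -> E) (n := n) = cst 0 by [].
  exact: cst_continuous.
move=> a u v /asboolP[lu cu] /asboolP[lv cv]; apply/asboolP; split.
  move=> b x y.
  have e z : (a *: u + v) z = a *: u z + v z by [].
  by rewrite !e lu lv !scalerDr !scalerA mulrC addrACA.
move=> n.
exact: (continuous_lincomb (a := a) (cu n) (cv n)).
Qed.

HB.instance Definition _ :=
  GRing.isSubmodClosed.Build K (U -> E) cont_hom cont_hom_submod.

Record homc := HomC { homc_fun :> U -> E; _ : homc_fun \in cont_hom }.

HB.instance Definition _ := [isSub for homc_fun].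
HB.instance Definition _ := [Choice of homc by <:].
HB.instance Definition _ := [SubChoice_isSubLmodule of homc by <:].


Lemma homc_linear (b : homc) : linear b.
Proof. by case: b => b /= /asboolP[]. Qed.

Lemma homc_continuous (b : homc) n : continuous (word_map b (n := n)).
Proof. by case: b => b /= /asboolP[]. Qed.

Lemma word_mapZ (b : homc) n (c : K) (x : 'I_n -> g) :
  word_map b (fun i => c *: x i) = c ^+ n *: word_map b x.
Proof.
have bZ (d : K) u : b (d *: u) = d *: b u.
  have := homc_linear b d u 0; rewrite !addr0 => ->.
  have := homc_linear b 1 0 0; rewrite !scale1r !addr0.
  by move=> /esym/eqP; rewrite -subr_eq0 addrK => /eqP ->; rewrite addr0.
rewrite /word_map -bZ; congr (homc_fun b _).
elim: n x => [|n IH] x; first by rewrite !big_ord0 scale1r.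
rewrite !big_ord_recl linearZ /= (IH (fun i => x (lift ord0 i))).
by rewrite -scalerAl -scalerAr scalerA exprS.
Qed.

Lemma word_map_bounded (b : homc) n :
  exists M : K, forall x : 'I_n -> g,
    (forall i, `|x i| <= 1) -> `|word_map b x| <= M.
Proof.
have := @homc_continuous b n (fun=> 0).
move=> /(_ _ (nbhsx_ballx _ 1 ltr01)) /ptws_nbhs0 [d d0 dP].
set w0 := word_map b (fun=> 0) in dP.
exists ((d / 2) ^- n * (1 + `|w0|)) => x x1.
have d2 : 0 < d / 2 by rewrite divr_gt0 // ltr0n.
have /dP : forall i, `|d / 2 *: x i| < d.
  move=> i; rewrite normrZ gtr0_norm //.
  apply: (@le_lt_trans _ _ (d / 2)); first by rewrite ler_piMr // ltW.
  by rewrite ltr_pdivrMr ?ltr0n // ltr_pMr // ltr1n.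
rewrite /= -ball_normE /= word_mapZ => wlt.
rewrite ler_pdivlMl ?exprn_gt0 //.
rewrite -[X in X * _](@gtr0_norm _ (_ ^+ n)) ?exprn_gt0 // -normrZ.
rewrite -[X in `|X|](subrK w0) (le_trans (ler_normD _ _)) // lerD2r.
by rewrite distrC ltW.
Qed.

Lemma homc_act_subproof (x : g) (b : homc) :
  (fun D => - b (sigma x * D)) \in cont_hom.
Proof.
apply/asboolP; split=> [a u v|n].
  by rewrite mulrDr -scalerAr homc_linear opprD scalerN.
pose cns (y : {ptws 'I_n -> g}) : {ptws 'I_n.+1 -> g} :=
  fun i => if unlift ord0 i is Some j then y j else x.
have ccns : continuous cns.
  apply: ptws_continuous => i; rewrite /cns; case: (unlift ord0 i) => [j|].
    exact: (@proj_continuous _ (fun=> g) j).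
  exact: cst_continuous.
have -> : word_map (fun D => - b (sigma x * D)) (n := n) =
          (fun y => - word_map b (cns y)).
  apply/funext => y; rewrite /word_map big_ord_recl /cns unlift_none.
  by congr (- b (_ * _)); apply: eq_bigr => i _; rewrite liftK.
exact: (continuous_oppcomp ccns (homc_continuous (b := b) (n := n.+1))).
Qed.

Definition homc_act (x : g) (b : homc) : homc := HomC (homc_act_subproof x b).

End ContinuousHom.

Section Seminorms.
Context {R : realType} {g : normedModType R[i]} {U : algType R[i]}
        (sigma : {linear g -> U}) (E : normedModType R[i]).
Local Notation homc := (homc sigma E).

Definition seminorm (n : nat) (b : homc) : R :=
  sup [set rnorm (word_map sigma b x) | x in
         [set x : 'I_n -> g | forall i, rnorm (x i) <= 1]].

Lemma rnormE (V : normedModType R[i]) (v : V) : (rnorm v)%:C = `|v|.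
Proof.
have : 0 <= `|v| by exact: normr_ge0.
rewrite /rnorm; case: `|v| => a b; rewrite lecE /= => /andP[/eqP -> _].
by [].
Qed.

Lemma rnorm_ge0 (V : normedModType R[i]) (v : V) : 0 <= rnorm v.
Proof. by rewrite -lecR rnormE normr_ge0. Qed.

Lemma ler_rnormD (V : normedModType R[i]) (u v : V) :
  rnorm (u + v) <= rnorm u + rnorm v.
Proof. by rewrite -lecR rmorphD /= !rnormE ler_normD. Qed.

Lemma seminorm_has_sup n (b : homc) :
  has_sup [set rnorm (word_map sigma b x) | x in
             [set x : 'I_n -> g | forall i, rnorm (x i) <= 1]].
Proof.
split.
  exists (rnorm (word_map sigma b (fun _ : 'I_n => 0))); exists (fun=> 0) => // i.
  by rewrite -lecR rnormE normr0 ler01.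
have [M HM] := word_map_bounded b n.
exists (complex.Re M) => _ [x x1 <-].
have /HM : forall i, `|x i| <= 1 by move=> i; rewrite -rnormE -[1]/(1%:C) lecR.
by rewrite -rnormE lecE => /andP[].
Qed.

Lemma seminorm_ub n (b : homc) (x : 'I_n -> g) :
  (forall i, rnorm (x i) <= 1) -> rnorm (word_map sigma b x) <= seminorm n b.
Proof.
by move=> x1; apply: ub_le_sup; [have [] := seminorm_has_sup n b|exists x].
Qed.

Lemma seminorm0 n : seminorm n 0 = 0.
Proof.
have w0 (x : 'I_n -> g) : rnorm (word_map sigma (0 : homc) x) = 0.
  by apply: complexI; rewrite rnormE normr0.
rewrite /seminorm (_ : image _ _ = [set 0]) ?sup1 //.
apply/seteqP; split=> [_ [x _ <-]|_ ->]; first exact: w0.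
exists (fun=> 0); last exact: w0.
by move=> i; rewrite -lecR rnormE normr0 ler01.
Qed.

Lemma seminormB n (a b c : homc) :
  seminorm n (b - a) <= seminorm n (b - c) + seminorm n (c - a).
Proof.
apply: ge_sup; first by have [] := seminorm_has_sup n (b - a).
move=> _ [x x1 <-].
apply: (le_trans _ (lerD (seminorm_ub _ x1) (seminorm_ub _ x1))).
have -> : word_map sigma (b - a) x = word_map sigma (b - c) x + word_map sigma (c - a) x.
  have homcB (u v : homc) D : (u - v) D = u D - v D by [].
  by rewrite /word_map !homcB addrA subrK.
exact: ler_rnormD.
Qed.

Definition homc_nbhs (b : homc) : set_system homc :=
  [set A : set homc | exists n (e : R), 0 < e /\
     forall c : homc,
       (forall k, (k <= n)%N -> seminorm k (c - b) < e) -> A c].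

HB.instance Definition _ := hasNbhs.Build homc homc_nbhs.

Lemma homc_nbhs_filter (b : homc) : ProperFilter (nbhs b).
Proof.
split.
  by move=> [n [e [e0 /(_ b)]]]; apply=> k _; rewrite subrr seminorm0.
split.
- by exists 0%N, 1; split => //; exact: ltr01.
- move=> A B [n [e [e0 eA]]] [m [d [d0 dB]]].
  exists (maxn n m), (Num.min e d); split; first by rewrite lt_min e0.
  move=> c Hc; split; [apply: eA|apply: dB] => k kn.
    have /Hc : (k <= maxn n m)%N by rewrite leq_max kn.
    by rewrite lt_min => /andP[].
  have /Hc : (k <= maxn n m)%N by rewrite leq_max kn orbT.
  by rewrite lt_min => /andP[].
- by move=> A B AB [n [e [e0 eA]]]; exists n, e; split => // c /eA /AB.
Qed.

Lemma homc_nbhs_singleton (b : homc) (A : set homc) : nbhs b A -> A b.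
Proof. by move=> [n [e [e0]]]; apply=> k _; rewrite subrr seminorm0. Qed.

Lemma homc_nbhs_nbhs (b : homc) (A : set homc) :
  nbhs b A -> nbhs b (nbhs^~ A).
Proof.
move=> [n [e [e0 eA]]]; exists n, (e / 2); split; first by rewrite divr_gt0.
move=> c Hc; exists n, (e / 2); split; first by rewrite divr_gt0.
move=> d Hd; apply: eA => k kn; apply: (le_lt_trans (seminormB _ _ _ c)).
by rewrite [ltRHS](splitr e) ltrD ?Hc ?Hd.
Qed.

HB.instance Definition _ := Nbhs_isNbhsTopological.Build homc
  homc_nbhs_filter homc_nbhs_singleton homc_nbhs_nbhs.

End Seminorms.

Section EquivariantHom.
Context {R : realType} {g : completeNormedModType R[i]} (br : g -> g -> g)
        (p : set g) {E : completeNormedModType R[i]} (rho : g -> E -> E)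
        {U : algType R[i]} (sigma : {linear g -> U}).

Definition hom_p : set (homc sigma E) :=
  [set b | forall x D, p x -> b (D * sigma x) = - rho x (b D)].

Context {gD : vectType R[i]} (iota : gD -> g).

(* $U(\mathfrak g_\Delta)v$: the enveloping algebra is spanned by words. *)
Definition gDelta_submodule (v : homc sigma E) : set (homc sigma E) :=
  lspan [set foldr (fun y b => homc_act (iota y) b) v ys | ys in @setT (seq gD)].

Definition hom_p_finite : set (homc sigma E) :=
  [set b | hom_p b /\ finite_dim (gDelta_submodule b)].

End EquivariantHom.

Arguments hom_p {R g} p {E} rho {U} sigma.
Arguments hom_p_finite {R g} p {E} rho {U} sigma {gD} iota.

Section BanachSubspace.
Context {R : realType} {W : lmodType R[i]}.

Record norm_on (F : set W) (N : W -> R) : Prop := NormOn {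
  norm_on_ge0 : forall v, F v -> 0 <= N v;
  norm_on_eq0 : forall v, F v -> N v = 0 -> v = 0;
  norm_onD : forall u v, F u -> F v -> N (u + v) <= N u + N v;
  norm_onZ : forall (a : R[i]) v, F v -> (N (a *: v))%:C = `|a| * (N v)%:C }.

Definition complete_norm_on (F : set W) (N : W -> R) : Prop :=
  forall u : nat -> W, (forall n, F (u n)) ->
    (forall e : R, 0 < e -> exists n0, forall m n,
       (n0 <= m)%N -> (n0 <= n)%N -> N (u m - u n) < e) ->
    exists2 v, F v & (fun n => N (u n - v)) @ \oo --> (0 : R).

End BanachSubspace.

Section InducedTopology.
Context {R : realType} {g : normedModType R[i]} {U : algType R[i]}
        {sigma : {linear g -> U}} {E : normedModType R[i]}.

Definition norm_defines_topology (F : set (homc sigma E))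
    (N : homc sigma E -> R) : Prop :=
  forall b, F b -> forall A : set (homc sigma E),
    within F (nbhs b) A <->
    exists2 e : R, 0 < e & forall c, F c -> N (c - b) < e -> A c.

Definition is_banach_subspace (F : set (homc sigma E)) : Prop :=
  exists N, [/\ norm_on F N, complete_norm_on F N & norm_defines_topology F N].

End InducedTopology.

(* Main.v *)
Require Import Defs.
From HB Require Import structures.
From mathcomp Require Import all_boot all_order all_algebra complex.
From mathcomp Require Import all_classical all_reals all_analysis.
From mathcomp Require Import ring lra zify.
Set Implicit Arguments.
Unset Strict Implicit.
Unset Printing Implicit Defensive.
Import Order.TTheory GRing.Theory Num.Theory.
Import numFieldNormedType.Exports.
Local Open Scope classical_set_scope.
Local Open Scope ring_scope.
Local Open Scope complex_scope.

(** Write $\mathfrak p=\mathfrak g_0+\sum_{\alpha(x_\Sigma)\ge 0}\mathfrak g_\alpha$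
    and let $\mathfrak n$ be the sum of the remaining weight spaces, those with
    $\alpha(x_\Sigma)<0$.  Moving letters of $\mathfrak p$ to the right end of a
    word, where equivariance absorbs them, shows that an element $\beta$ of $V_c$
    is determined by its values on words in root vectors of $\mathfrak n$, and
    quantitatively ([seminorm_step]): if $\beta$ kills all such words of length
    $n+1$, then $p_{n+1}(\beta)\le C_n p_n(\beta)$.

    The heart of the matter is a length $N$ such that every $\beta\in V_f$ kills
    all words in $\mathfrak n$ of length greater than $N$ ([finite_vanishing]).
    The module $F=U(\mathfrak g_\Delta)\beta$ is finite-dimensional, and
    $\mathfrak h$ acts on it diagonalizably because it does so on $E$
    ([finite_dim_weights]).  If $\beta$ has weight $\lambda$ and does not vanish
    on a word of weight $\gamma$, then $\lambda+\gamma$ is one of the finitely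
    many weights of $E$.  Since $\gamma(x_\Sigma)\le 0$, the numbers
    $\mathrm{Re}\,\lambda(x_\Sigma)$ are bounded below by a constant depending on
    $E$ only.  By $\mathfrak{sl}_2$-theory the weights of $F$ are stable under the
    reflections ([reflected_weight]), so $\mathrm{Re}\,\lambda(y)$ obeys the same
    bound for every $y$ in the orbit of $x_\Sigma$; this orbit is finite and sums to
    zero ([weyl_orbit_sum0]), hence $\mathrm{Re}\,\lambda(x_\Sigma)$ is bounded
    above as well ([weight_height_upper]).  A word of length $m$ has
    $\gamma(x_\Sigma)\le -m\delta$ for a fixed $\delta>0$, which bounds the length
    of the words on which $\beta$ does not vanish.

    Conversely let $M$ consist of the $\beta\in V_c$ such that all elements of
    $U(\mathfrak g_\Delta)\beta$ kill the words in $\mathfrak n$ longer than $N$; these are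
    closed conditions.  On $M$ each element of $\mathfrak h$ has finitely many
    eigenvalues, so root vectors are nilpotent, and a module on which a spanning
    family of a finite-dimensional Lie algebra acts algebraically is locally
    finite ([algebraic_finite_dim]).  Thus $V_f=M$ ([finiteE]) is closed, and by
    [seminorm_step] all seminorms are dominated on it by $p_0+\dots+p_N$, which
    is therefore a complete norm ([finite_banach]).

    Invariance holds because $U(\mathfrak g_\Delta)(x.\beta)$ lies in the span of
    $(U(\mathfrak g_\Delta)x).(U(\mathfrak g_\Delta)\beta)$, and continuity of the
    action follows from $p_n(x.\beta)\le\|x\|\,p_{n+1}(\beta)$. *)

(** * Spans, finite dimension and diagonalizable operators *)

(** Rewriting rules for a function whose linearity is a hypothesis. *)
Section LinearFunctions.
Context {K : fieldType} {V W : lmodType K} (f : V -> W).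
Hypothesis lf : linear f.

Let F : {linear V -> W} := HB.pack f (GRing.isLinear.Build K V W *:%R f lf).

Lemma lin0 : f 0 = 0. Proof. exact: (linear0 F). Qed.
Lemma linZ a u : f (a *: u) = a *: f u. Proof. exact: (linearZ_LR F). Qed.
Lemma linD u v : f (u + v) = f u + f v. Proof. exact: (linearD F). Qed.
Lemma linB u v : f (u - v) = f u - f v. Proof. exact: (linearB F). Qed.
Lemma linN u : f (- u) = - f u. Proof. exact: (linearN F). Qed.
Lemma lin_sum I (r : seq I) (P : pred I) (s : I -> V) :
  f (\sum_(i <- r | P i) s i) = \sum_(i <- r | P i) f (s i).
Proof. exact: (linear_sum F). Qed.
End LinearFunctions.

Section Span.
Context {K : fieldType} {V : lmodType K}.
Implicit Types (S W : set V).

Lemma subspD W u v : is_subspace W -> W u -> W v -> W (u + v).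
Proof. by move=> [_ cl] Wu Wv; rewrite -[u]scale1r; exact: cl. Qed.

Lemma subspZ W a u : is_subspace W -> W u -> W (a *: u).
Proof. by move=> [W0 cl] Wu; rewrite -[_ *: _]addr0; exact: cl. Qed.

Lemma subspN W u : is_subspace W -> W u -> W (- u).
Proof. by move=> sW Wu; rewrite -scaleN1r; exact: subspZ. Qed.

Lemma subspB W u v : is_subspace W -> W u -> W v -> W (u - v).
Proof. by move=> sW Wu Wv; apply: subspD => //; exact: subspN. Qed.

Lemma subsp_sum W I (r : seq I) (P : pred I) (f : I -> V) : is_subspace W ->
  (forall i, P i -> W (f i)) -> W (\sum_(i <- r | P i) f i).
Proof.
move=> sW Wf; elim/big_ind : _ => //; first by case: sW.
by move=> u v; exact: subspD.
Qed.

Lemma lspan_subspace S : is_subspace (lspan S).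
Proof.
split; first by exists 0%N, (fun=> 0), (fun=> 0); split; [case|rewrite big_ord0].
move=> a _ _ [n [c [s [Ss ->]]]] [m [d [t [St ->]]]].
exists (n + m)%N.
exists (fun k => match fintype.split k with inl i => a * c i | inr j => d j end).
exists (fun k => match fintype.split k with inl i => s i | inr j => t j end).
split; first by move=> k; case: (fintype.split k).
rewrite big_split_ord /= scaler_sumr; congr (_ + _); apply: eq_bigr => i _.
  by rewrite -/(unsplit (inl i)) unsplitK scalerA.
by rewrite -/(unsplit (inr i)) unsplitK.
Qed.

Lemma lspan_gen S x : S x -> lspan S x.
Proof.
move=> Sx; exists 1%N, (fun=> 1), (fun=> x); split=> //.
by rewrite big_ord1 scale1r.
Qed.

Lemma lspan_min S W : is_subspace W -> S `<=` W -> lspan S `<=` W.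
Proof.
move=> sW SW _ [n [c [s [Ss ->]]]]; apply: subsp_sum => // i _.
by apply: subspZ => //; exact: SW.
Qed.

Lemma lspanS S T : S `<=` T -> lspan S `<=` lspan T.
Proof.
move=> ST; apply: lspan_min; first exact: lspan_subspace.
by move=> x /ST; exact: lspan_gen.
Qed.

Lemma subspace_setI S T : is_subspace S -> is_subspace T -> is_subspace (S `&` T).
Proof.
move=> [S0 Scl] [T0 Tcl]; split=> // a u v [Su Tu] [Sv Tv].
by split; [exact: Scl|exact: Tcl].
Qed.

Lemma lspan_rangeP n (s : 'I_n -> V) x :
  lspan (range s) x -> exists a : 'I_n -> K, x = \sum_i a i *: s i.
Proof.
apply: (lspan_min (W := [set x | exists a : 'I_n -> K, x = \sum_i a i *: s i])).
  split=> [|b _ _ [c ->] [d ->]].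
    by exists (fun=> 0); rewrite big1 // => i _; rewrite scale0r.
  exists (fun i => b * c i + d i); rewrite scaler_sumr -big_split /=.
  by apply: eq_bigr => i _; rewrite scalerDl scalerA.
move=> _ [j _ <-]; exists (fun i => (i == j)%:R).
rewrite (bigD1 j) //= eqxx scale1r big1 ?addr0 // => i /negPf ->.
by rewrite scale0r.
Qed.

Lemma linear_dependence S n (s : 'I_n -> V) (w : 'I_n.+1 -> V) :
  S `<=` lspan (range s) -> (forall i, S (w i)) ->
  exists2 u : 'I_n.+1 -> K, exists i, u i != 0 & \sum_i u i *: w i = 0.
Proof.
move=> Ss Sw; have /boolp.choice[a aE] i : exists a : 'I_n -> K, w i = \sum_j a j *: s j.
  exact: (lspan_rangeP (Ss _ (Sw i))).
pose A := (\matrix_(i, j) a i j : 'M[K]_(n.+1, n)).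
have rA : (\rank A <= n)%N by rewrite rank_leq_col.
have : kermx A != 0.
  rewrite -mxrank_eq0 mxrank_ker -lt0n subn_gt0.
  by rewrite ltnS.
case/rowV0Pn => u /sub_kermxP uA u0.
have /rV0Pn[i0 ui0] := u0.
exists (fun i => u 0 i); first by exists i0.
under eq_bigr do rewrite aE scaler_sumr.
rewrite exchange_big /= big1 // => j _.
under eq_bigr do rewrite scalerA.
rewrite -scaler_suml.
move/matrixP/(_ 0 j): uA; rewrite !mxE => uA.
suff -> : \sum_i u 0 i * a i j = 0 by rewrite scale0r.
by rewrite -[RHS]uA; apply: eq_bigr => i _; rewrite mxE.
Qed.

Lemma finite_dimP S : finite_dim S <-> exists l : seq V, S `<=` lspan [set` l].
Proof.
split=> [[n [s Ss]]|[l Sl]].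
  exists (codom s); apply: (subset_trans Ss); apply: lspanS => _ [i _ <-].
  exact: codom_f.
exists (size l), (tnth (in_tuple l)); apply: (subset_trans Sl).
by apply: lspanS => x /= /(tnthP (in_tuple l))[i ->]; exists i.
Qed.

Lemma finite_dimS S T : S `<=` T -> finite_dim T -> finite_dim S.
Proof.
move=> ST [n [s Ts]]; exists n, s; exact: (subset_trans ST).
Qed.

Lemma finite_dim_span S : finite_dim S -> finite_dim (lspan S).
Proof.
move=> [n [s Ss]]; exists n, s; apply: lspan_min => //; exact: lspan_subspace.
Qed.

Lemma finite_dimU S T : finite_dim S -> finite_dim T -> finite_dim (S `|` T).
Proof.
move=> /finite_dimP[l Sl] /finite_dimP[k Tk]; apply/finite_dimP; exists (l ++ k).
move=> x [/Sl|/Tk]; apply: lspanS => y /=; rewrite mem_cat => ->//.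
by rewrite orbT.
Qed.

End Span.

(** Finiteness passes in this way from a subspace of $\mathfrak g$ and a subspace
    of a module to the span of their products. *)
Lemma finite_dim_bilinear {K : fieldType} {V1 V2 W : lmodType K}
    (f : V1 -> V2 -> W) (S1 : set V1) (S2 : set V2) :
  (forall y, linear (f^~ y)) -> (forall x, linear (f x)) ->
  finite_dim S1 -> finite_dim S2 ->
  finite_dim [set z | exists x y, [/\ S1 x, S2 y & z = f x y]].
Proof.
move=> fl fr /finite_dimP[l Sl] /finite_dimP[k Sk]; apply/finite_dimP.
exists [seq f x y | x <- l, y <- k] => _ [x [y [/Sl lx /Sk ky ->]]].
set L := lspan _; have sL : is_subspace L by exact: lspan_subspace.
apply: (lspan_min (W := [set x | L (f x y)]) _ _ lx).
  split=> [|a u v] /=; first by rewrite (lin0 (fl y)); case: sL.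
  by rewrite (linD (fl y)) (linZ (fl y)); case: sL => _; apply.
move=> x' lx'.
apply: (lspan_min (W := [set y | L (f x' y)]) _ _ ky).
  split=> [|a u v] /=; first by rewrite (lin0 (fr x')); case: sL.
  by rewrite (linD (fr x')) (linZ (fr x')); case: sL => _; apply.
by move=> y' ky'; apply: lspan_gen => /=; apply: allpairs_f.
Qed.

Section ProductOperator.
Context {K : fieldType} {W : lmodType K} (T : W -> W).
Hypothesis lT : linear T.

(** The operator $\prod_{a\in as}(T-a)$. *)
Definition prod_shift (as_ : seq K) (v : W) : W :=
  foldr (fun a w => T w - a *: w) v as_.

Lemma prod_shift_linear as_ : linear (prod_shift as_).
Proof.
move=> b u v; elim: as_ => //= a s ->.
by rewrite (linD lT) (linZ lT) scalerDr !scalerBr opprD addrACA !scalerA mulrC.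
Qed.

Lemma prod_shift_stable (S : set W) as_ v : is_subspace S ->
  (forall w, S w -> S (T w)) -> S v -> S (prod_shift as_ v).
Proof.
move=> sS ST Sv; elim: as_ => //= a s IH; apply: subspB => //; first exact: ST.
exact: subspZ.
Qed.

Lemma prod_shift_eigen as_ b v : T v = b *: v ->
  prod_shift as_ v = (\prod_(a <- as_) (b - a)) *: v.
Proof.
move=> Tv; elim: as_ => [|a s /= ->]; first by rewrite big_nil scale1r.
by rewrite big_cons (linZ lT) Tv !scalerA -scalerBl mulrC -mulrBl.
Qed.

Lemma prod_shift_eigen0 as_ b v : T v = b *: v -> prod_shift as_ v = 0 ->
  v <> 0 -> b \in as_.
Proof.
move=> Tv; rewrite (prod_shift_eigen _ Tv) => /eqP; rewrite scaler_eq0.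
move=> /orP[|/eqP//] p0 _; move: p0; elim: as_ => [|a s IH].
  by rewrite big_nil oner_eq0.
rewrite big_cons mulf_eq0 subr_eq0 inE => /orP[-> //|/IH ->].
by rewrite orbT.
Qed.

(** The product is monic in [T], so a vector killed by it satisfies a
    recurrence expressing a power of [T] through lower ones. *)
Lemma prod_shift_lower as_ v :
  lspan [set iter k T v | k in [set k | (k < size as_)%N]]
    (iter (size as_) T v - prod_shift as_ v).
Proof.
elim: as_ => [|a s] /=; first by rewrite subrr; exact: (proj1 (lspan_subspace _)).
set L := lspan _; set L' := lspan _ => IH.
have sL' : is_subspace L' by exact: lspan_subspace.
have LL' : L `<=` L'.
  by apply: lspanS => _ [k /= ks <-]; exists k => //=; exact: ltnW.
have TL : forall w, L w -> L' (T w).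
  move=> w; apply: (lspan_min (W := [set w | L' (T w)])).
    split=> [|b u u'] /=; first by rewrite (lin0 lT); case: sL'.
    by rewrite (linD lT) (linZ lT); case: sL' => _; apply.
  by move=> _ [k /= ks <-]; apply: lspan_gen; exists k.+1.
set w := iter _ T v in IH *; set u := prod_shift s v in IH *.
have -> : T w - (T u - a *: u) = T (w - u) - a *: (w - u) + a *: w.
  by rewrite (linB lT) scalerBr !opprB !addrA subrK addrAC.
apply: subspD => //; last first.
  apply: (subspZ _ sL'). apply: lspan_gen. by exists (size s) => /=.
apply: subspB => //; first exact: TL.
by apply: subspZ => //; exact: LL'.
Qed.

(** Peel off one factor at a time: the product of the remaining factors sends
    [v] to an eigenvector [w] of the first one, and subtracting the right multiple of
    [w] from [v] leaves a vector killed by the remaining factors. *)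
Lemma prod_shift_decomp (S : set W) as_ v : is_subspace S ->
  (forall w, S w -> S (T w)) -> uniq as_ -> S v -> prod_shift as_ v = 0 ->
  exists2 f : K -> W, v = \sum_(a <- as_) f a &
    forall a, S (f a) /\ T (f a) = a *: f a.
Proof.
move=> sS ST; elim: as_ v => [|a s IH] v /=.
  move=> _ Sv v0; exists (fun=> 0); first by rewrite big_nil.
  by move=> a; split; [case: sS|rewrite (lin0 lT) scaler0].
move=> /andP[as_ us] Sv; set w := prod_shift s v => /eqP.
rewrite subr_eq0 => /eqP Tw.
pose P := \prod_(b <- s) (a - b).
have P0 : P != 0.
  rewrite /P; elim: s as_ {IH us w Tw} @P => [|b s IHs]; first by rewrite big_nil oner_eq0.
  rewrite inE negb_or => /andP[ab as_] /=; rewrite big_cons mulf_neq0 ?subr_eq0 //.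
  exact: IHs.
have Sw : S w by exact: prod_shift_stable.
have [||f vE fP] := IH (v - P^-1 *: w) us.
- by apply: subspB => //; exact: subspZ.
- rewrite (linB (prod_shift_linear s)) (linZ (prod_shift_linear s)).
  by rewrite (prod_shift_eigen _ Tw) scalerA mulVf // scale1r subrr.
exists (fun b => if b == a then P^-1 *: w else f b).
  rewrite big_cons eqxx -[LHS](subrK (P^-1 *: w)) vE addrC; congr (_ + _).
  rewrite !big_seq; apply: eq_bigr => b bs.
  by case: eqP => // ba; move: as_; rewrite -ba bs.
move=> b; case: eqP => [->|_]; last exact: fP.
split; first exact: subspZ.
by rewrite (linZ lT) Tw !scalerA mulrC.
Qed.

End ProductOperator.

(** By induction on the list of operators: commutation makes the part of [S] in
    an eigenspace of the first operator stable under the others, so that part can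
    replace [S]. *)
Lemma simultaneous_decomp {K : fieldType} {W : lmodType K} {I : eqType}
    (T : I -> W -> W) (ts : seq I) (S : set W) v :
  (forall i, linear (T i)) -> (forall i j w, T i (T j w) = T j (T i w)) ->
  is_subspace S -> (forall i w, S w -> S (T i w)) ->
  (forall i w, S w -> exists2 as_, uniq as_ & prod_shift (T i) as_ w = 0) ->
  S v ->
  lspan [set w | S w /\ forall i, i \in ts -> exists a, T i w = a *: w] v.
Proof.
move=> lT cT; elim: ts S v => [|i ts IH] S v sS ST Sann Sv.
  by apply: lspan_gen; split.
have [as_ us vann] := Sann i v Sv.
have [f -> fP] := prod_shift_decomp (lT i) sS (ST i) us Sv vann.
apply: subsp_sum => [|a _]; first exact: lspan_subspace.
have [Sfa Tfa] := fP a.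
pose S' := S `&` [set w | T i w = a *: w].
have sS' : is_subspace S'.
  apply: subspace_setI => //; split=> [|b u u'] /=.
    by rewrite (lin0 (lT i)) scaler0.
  by move=> Tu Tu'; rewrite (linD (lT i)) (linZ (lT i)) Tu Tu' scalerDr !scalerA mulrC.
apply: (lspanS _ (IH S' (f a) sS' _ _ _)) => //.
- move=> w [[Sw Tw] ew]; split=> // j; rewrite inE => /orP[/eqP ->|]; last exact: ew.
  by exists a.
- move=> j w [Sw Tw]; split; first exact: ST.
  by rewrite /= cT Tw (linZ (lT j)).
- by move=> j w [Sw _]; exact: Sann.
Qed.

(** * Modules spanned by words *)

Record lie_action {K : fieldType} {L W : lmodType K} (br : L -> L -> L)
    (act : L -> W -> W) : Prop := LieAction {
  act_linl : forall w, linear (act^~ w);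
  act_linr : forall y, linear (act y);
  act_br : forall x y w, act (br x y) w = act x (act y w) - act y (act x w) }.

Section Words.
Context {K : fieldType} {L W : lmodType K} {br : L -> L -> L}
  {act : L -> W -> W}.
Hypothesis actP : lie_action br act.

Local Notation word v zs := (foldr act v zs).

Definition submodule_of (v : W) : set W :=
  lspan [set word v zs | zs in @setT (seq L)].

Definition short_words (n : nat) (v : W) : set W :=
  lspan [set word v zs | zs in [set zs | (size zs < n)%N]].

Lemma word_linear zs : linear (fun v => word v zs).
Proof.
move=> a u v; elim: zs => //= z zs ->.
by rewrite (linD (act_linr actP z)) (linZ (act_linr actP z)).
Qed.

Lemma submodule_of_stable v y w : submodule_of v w -> submodule_of v (act y w).
Proof.
set S := submodule_of v; have sS : is_subspace S by exact: lspan_subspace.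
apply: (lspan_min (W := [set w | S (act y w)])).
  split=> [|a u u'] /=; first by rewrite (lin0 (act_linr actP y)); case: sS.
  by rewrite (linD (act_linr actP y)) (linZ (act_linr actP y)); case: sS => _; apply.
by move=> _ [zs _ <-]; apply: lspan_gen; exists (y :: zs).
Qed.

Lemma submodule_of_id v : submodule_of v v.
Proof. by apply: lspan_gen; exists [::]. Qed.

Lemma submodule_of_min v (S : set W) : is_subspace S -> S v ->
  (forall y w, S w -> S (act y w)) -> submodule_of v `<=` S.
Proof.
move=> sS Sv Sact; apply: lspan_min => // _ [zs _ <-].
by elim: zs => //= z zs; exact: Sact.
Qed.

Lemma short_words_act n y v : short_words n (act y v) `<=` short_words n.+1 v.
Proof.
apply: lspanS => _ [zs /= sz <-]; exists (rcons zs y); last by rewrite foldr_rcons.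
by rewrite /= size_rcons ltnS.
Qed.

(** Exchanging two neighbouring letters produces their bracket as a single
    letter, hence a shorter word. *)
Lemma word_move s1 x s2 v :
  short_words (size s1 + size s2).+1 v
    (word v (s1 ++ x :: s2) - word v (s1 ++ rcons s2 x)).
Proof.
elim: s2 s1 => [|z s2 IH] s1.
  by rewrite subrr; exact: (proj1 (lspan_subspace _)).
have -> : word v (s1 ++ x :: z :: s2) =
    word v (s1 ++ br x z :: s2) + word v ((rcons s1 z) ++ x :: s2).
  rewrite cat_rcons !foldr_cat /= (act_br actP) -(linD (word_linear s1)).
  by rewrite subrK.
rewrite -addrA; apply: subspD; first exact: lspan_subspace.
  apply: lspan_gen; exists (s1 ++ br x z :: s2) => //=.
  by rewrite size_cat /= ltnS.
have := IH (rcons s1 z); rewrite !cat_rcons size_rcons /=.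
by rewrite addSnnS.
Qed.

(** Modulo shorter words, any [m] occurrences of a letter can be collected at the
    place where they are applied first. *)
Lemma word_collect y m v s : (m <= count_mem y s)%N ->
  exists2 s', (size s' + m = size s)%N &
    short_words (size s) v (word v s - word (iter m (act y) v) s').
Proof.
elim: m v s => [|m IH] v s.
  move=> _; exists s; first by rewrite addn0.
  rewrite /= subrr; exact: (proj1 (lspan_subspace _)).
move=> cs; have ys : y \in s by rewrite -has_pred1 has_count; exact: leq_trans cs.
move: cs; case/splitPr: ys => s1 s2; rewrite count_cat /= eqxx addnCA ltnS.
rewrite -count_cat => /(IH (act y v))[s' ss' Hs'].
exists s'; first by rewrite addnS ss' !size_cat /= addnS.
have -> : size (s1 ++ y :: s2) = (size (s1 ++ s2)).+1 by rewrite !size_cat addnS.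
rewrite -[X in short_words _ _ (X - _)](subrK (word v (s1 ++ rcons s2 y))) -addrA.
apply: subspD; first exact: lspan_subspace.
  by rewrite size_cat; exact: word_move.
rewrite -rcons_cat foldr_rcons -iterS iterSr.
exact: short_words_act Hs'.
Qed.

Definition algebraic_at (y : L) (v : W) (m : nat) : Prop :=
  lspan [set iter k (act y) v | k in [set k | (k < m)%N]] (iter m (act y) v).

Lemma word_reduce y m v s : algebraic_at y v m -> (m <= count_mem y s)%N ->
  short_words (size s) v (word v s).
Proof.
move=> alg /(word_collect v)[s' ss' Hs].
rewrite -[word v s](subrK (word (iter m (act y) v) s')).
have sS : is_subspace (short_words (size s) v) by exact: lspan_subspace.
apply: subspD => //.
apply: (lspan_min (W := [set w | short_words (size s) v (word w s')]) _ _ alg).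
  split=> [|a u u'] /=; first by rewrite (lin0 (word_linear s')); case: sS.
  by rewrite (linD (word_linear s')) (linZ (word_linear s')); case: sS => _; apply.
move=> _ [k /= km <-]; apply: lspan_gen; exists (s' ++ nseq k y).
  by rewrite /= size_cat size_nseq -ss' ltn_add2l.
rewrite foldr_cat; congr (foldr _ _ s').
by elim: k {km} => //= k ->.
Qed.

Lemma size_le_counts (ys s : seq L) : {subset s <= ys} ->
  (size s <= \sum_(y <- ys) count_mem y s)%N.
Proof.
elim: s => // z s IH zs /=; rewrite big_split /= -add1n leq_add //; last first.
  by apply: IH => x xs; apply: zs; rewrite inE xs orbT.
have : z \in ys by apply: zs; rewrite inE eqxx.
by case/splitPr => p1 p2; rewrite big_cat big_cons /= eqxx addnCA.
Qed.

Lemma word_expand (ys : seq L) v zs : (forall y, lspan [set` ys] y) ->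
  lspan [set word v s | s in [set s : seq L | {subset s <= ys} /\ size s = size zs]]
    (word v zs).
Proof.
move=> ysT; elim: zs => [|z zs IH] /=; first by apply: lspan_gen; exists [::].
set X := lspan _; have sX : is_subspace X by exact: lspan_subspace.
have lr := act_linr actP; have ll := act_linl actP.
apply: (lspan_min (W := [set w | X (act z w)]) _ _ IH).
  split=> [|a u u'] /=; first by rewrite (lin0 (lr z)); case: sX.
  by rewrite (linD (lr z)) (linZ (lr z)); case: sX => _; apply.
move=> _ [s [sy ss] <-].
apply: (lspan_min (W := [set z | X (act z (word v s))]) _ _ (ysT z)).
  split=> [|a u u'] /=; first by rewrite (lin0 (ll _)); case: sX.
  by rewrite (linD (ll _)) (linZ (ll _)); case: sX => _; apply.
move=> y yy /=; apply: lspan_gen; exists (y :: s) => //; split; last by rewrite /= ss.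
by move=> x; rewrite inE => /orP[/eqP ->|/sy].
Qed.

Lemma short_words_finite_dim (ys : seq L) n v : (forall y, lspan [set` ys] y) ->
  finite_dim (short_words n v).
Proof.
move=> ysT; elim: n => [|n IH].
  by apply: finite_dim_span; apply/finite_dimP; exists [::] => w [zs].
have fL : finite_dim [set: L] by apply/finite_dimP; exists ys => y _; exact: ysT.
have f1 := finite_dim_bilinear (act_linl actP) (act_linr actP) fL IH.
have f2 : finite_dim [set v].
  by apply/finite_dimP; exists [:: v] => _ ->; apply: lspan_gen => /=; exact: mem_head.
apply: (finite_dimS _ (finite_dim_span (finite_dimU f2 f1))).
apply: lspanS => _ [[|z zs] /= sz <-]; first by left.
right; exists z, (word v zs); split=> //.
by apply: lspan_gen; exists zs.
Qed.

(** Letters of a word may be permuted at the cost of shorter words, so a long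
    word contains, after permutation, a high power of one letter applied
    first; such a power is a combination of lower ones. *)
Lemma algebraic_finite_dim (ys : seq L) v : (forall y, lspan [set` ys] y) ->
  (forall y, y \in ys -> exists m, algebraic_at y v m) ->
  finite_dim (submodule_of v).
Proof.
move=> ysT yalg.
have /boolp.choice[m mP] y : exists m, y \in ys -> algebraic_at y v m.
  by case: (boolP (y \in ys)) => [/yalg[m]|_]; [exists m|exists 0%N].
pose N := (\sum_(y <- ys) m y)%N.
apply: (finite_dimS _ (short_words_finite_dim N.+1 v ysT)).
have step n : (N < n)%N -> short_words n.+1 v `<=` short_words n v.
  move=> Nn; apply: lspan_min; first exact: lspan_subspace.
  move=> _ [zs /= + <-]; rewrite ltnS leq_eqVlt => /orP[/eqP sz|sz]; last first.
    by apply: lspan_gen; exists zs.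
  apply: (lspan_min _ _ (word_expand v zs ysT)); first exact: lspan_subspace.
  move=> _ [s [sy ss] <-]; rewrite -sz -ss.
  have [y yy my] : exists2 y, y \in ys & (m y <= count_mem y s)%N.
    apply: contrapT => no; suff : (size s <= N)%N by rewrite leqNgt ss sz Nn.
    apply: (leq_trans (size_le_counts sy)); rewrite /N !big_seq.
    apply: leq_sum => y yy; rewrite leqNgt; apply/negP => ?; apply: no.
    by exists y => //; exact: ltnW.
  exact: (word_reduce (mP y yy) my).
apply: lspan_min; first exact: lspan_subspace.
move=> _ [zs _ <-].
have : short_words (size zs + N.+1).+1 v (word v zs).
  by apply: lspan_gen; exists zs => //=; rewrite ltnS leq_addr.
elim: (size zs) (word v zs) => [|k IH] w /step; first by apply; rewrite add0n.
move=> H; apply: IH; apply: H.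
exact: leq_addl.
Qed.

End Words.

(** * Weights and strings of weights *)

Section LieBracket.
Context {K : fieldType} {L : lmodType K} {brD : L -> L -> L}.
Hypothesis brP : lie_bracket brD.

Lemma lie_antisym x y : brD y x = - brD x y.
Proof.
have [ll lr alt _] := brP; apply/eqP; rewrite -addr_eq0 addrC; apply/eqP.
have := alt (x + y); rewrite (linD (ll _)) !(linD (lr _)) !alt.
by rewrite add0r addr0.
Qed.

Lemma lie_ad_action : lie_action brD brD.
Proof.
have [ll lr alt jac] := brP; split=> // x y w.
have := jac x y w.
rewrite (lie_antisym x w) (linN (lr y)) (lie_antisym (brD x y) w).
by move/eqP; rewrite subr_eq0 => /eqP <-.
Qed.

End LieBracket.

Lemma raise_lowered_coeff (F : numFieldType) (m a : F) j :
  m - a * j.+1%:R + j.+1%:R * (m - a * j%:R / 2) =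
  j.+2%:R * (m - a * j.+1%:R / 2).
Proof. by rewrite -[j.+2]addn2 -[j.+1]addn1 !natrD; field. Qed.

Section WeightsOfActions.
Context {R : realType}.
Local Notation K := (R[i]).
Context {gD : vectType K} {brD : gD -> gD -> gD}
  {h : {vspace gD}} {W : lmodType K} {act : gD -> W -> W}.
Hypothesis brP : lie_bracket brD.
Hypothesis actP : lie_action brD act.

Local Notation dual := (dual_space (T := subvs_of h)).
Local Notation wt := (weight_space (fun t : subvs_of h => act (vsval t))).
Local Notation root_space := (weight_space (ad_cartan brD (h := h))).

Lemma dual_mulrn (al : dual) n c : (al *+ n) c = al c * n%:R.
Proof.
elim: n => [|n IH]; first by rewrite mulr0n lfunE mulr0.
by rewrite mulrSr add_lfunE IH [n.+1%:R]mulrSr mulrDr mulr1.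
Qed.

Lemma dual_neq0 (al : dual) : al != 0 -> exists t, al t != 0.
Proof.
move=> al0; apply: contrapT => no; move/eqP: al0; apply; apply/lfunP => t.
rewrite lfunE /=; apply/eqP/negP => /negP at0; apply: no; by exists t.
Qed.

Lemma weight_space_subspace (lam : dual) : is_subspace (wt lam).
Proof.
split=> [|a u v Hu Hv] t /=; first by rewrite (lin0 (act_linr actP _)) scaler0.
rewrite (linD (act_linr actP _)) (linZ (act_linr actP _)) Hu Hv.
by rewrite scalerDr !scalerA mulrC.
Qed.

Lemma eigen_shift t e (k a : K) w : brD t e = k *: e ->
  act t w = a *: w -> act t (act e w) = (a + k) *: act e w.
Proof.
move=> te tw; have := act_br actP t e w.
rewrite te (linZ (act_linl actP _)) tw (linZ (act_linr actP _)).
by move/eqP; rewrite eq_sym subr_eq => /eqP ->; rewrite scalerDl addrC.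
Qed.

Lemma eigen_shift_iter t e (k a : K) w n : brD t e = k *: e ->
  act t w = a *: w ->
  act t (iter n (act e) w) = (a + k *+ n) *: iter n (act e) w.
Proof.
move=> te tw; elim: n => [|n IH]; first by rewrite mulr0n addr0.
by rewrite /= (eigen_shift te IH) mulrSr addrA.
Qed.

Lemma weight_shift (al lam : dual) e w :
  root_space al e -> wt lam w -> wt (lam + al) (act e w).
Proof.
by move=> He Hw t; rewrite (eigen_shift (He t) (Hw t)) add_lfunE.
Qed.

Lemma weight_shift_iter (al lam : dual) e w n :
  root_space al e -> wt lam w -> wt (lam + al *+ n) (iter n (act e) w).
Proof.
move=> He Hw; elim: n => [|n IH]; first by rewrite mulr0n addr0.
by rewrite mulrSr addrA; exact: weight_shift.
Qed.

Lemma iter_act_linear y k : linear (iter k (act y)).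
Proof.
by move=> a u v; elim: k => //= k ->; rewrite (linD (act_linr actP _)) (linZ (act_linr actP _)).
Qed.

Lemma iter_act0 y k : iter k (act y) 0 = 0.
Proof. exact: (lin0 (iter_act_linear y k)). Qed.

(** The $\mathfrak{sl}_2$ computation.  The value [al c] is kept arbitrary so
    that the Heisenberg case [al c = 0] is covered as well. *)
Lemma raise_lowered (al mu : dual) e f (c : subvs_of h) w j :
  root_space al e -> root_space (- al) f -> brD e f = vsval c ->
  wt mu w -> act e w = 0 ->
  act e (iter j.+1 (act f) w) =
    (j.+1%:R * (mu c - al c * j%:R / 2)) *: iter j (act f) w.
Proof.
move=> He Hf efc Hw ew.
have efE u : act e (act f u) = act (vsval c) u + act f (act e u).
  by rewrite -efc (act_br actP) subrK.
elim: j => [|j IH].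
  rewrite /= efE ew (lin0 (act_linr actP _)) addr0 Hw.
  by rewrite mulr0 mul0r subr0 mul1r.
rewrite iterS efE IH (linZ (act_linr actP _)) -iterS.
rewrite (weight_shift_iter j.+1 Hf Hw c) -scalerDl; congr (_ *: _).
by rewrite add_lfunE dual_mulrn opp_lfunE mulNr; exact: raise_lowered_coeff.
Qed.

(** Raise [w] by [e] as long as the result is nonzero, then lower by [f] as long as
    the result is nonzero.  At the end of the string the coefficient of
    [raise_lowered] has to vanish, which is the asserted equation. *)
Lemma weight_string (S : set W) (al lam : dual) e f (c : subvs_of h) w :
  root_space al e -> root_space (- al) f -> brD e f = vsval c ->
  (forall y u, S u -> S (act y u)) ->
  (forall mu u, S u -> wt mu u -> exists k, iter k (act e) u = 0) ->
  (forall mu u, S u -> wt mu u -> exists k, iter k (act f) u = 0) ->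
  S w -> wt lam w -> w <> 0 ->
  exists k j, lam c + al c * k%:R = al c * j%:R / 2 /\
    forall i, (i <= j)%N -> iter i (act f) (iter k (act e) w) <> 0.
Proof.
move=> He Hf efc Sact nile nilf Sw Hw w0.
have Siter y n u : S u -> S (iter n (act y) u).
  by move=> Su; elim: n => //= n; exact: Sact.
have minimal (T : W -> W) u : u <> 0 -> (exists n, iter n T u = 0) ->
    exists n, iter n T u <> 0 /\ iter n.+1 T u = 0.
  move=> u0 [n]; elim: n => //= n IH Tn.
  by have [/IH|Tn0] := pselect (iter n T u = 0); last by exists n.
have [k [kne kz]] := minimal _ _ w0 (nile _ _ Sw Hw).
set u := iter k (act e) w in kne.
have Su : S u by exact: Siter.
have Hu : wt (lam + al *+ k) u by exact: weight_shift_iter.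
have [j [jne jz]] := minimal _ _ kne (nilf _ _ Su Hu).
exists k, j; split; last first.
  move=> i ij iz; apply: jne; rewrite -(subnK ij) iterD iz.
  exact: iter_act0.
have := raise_lowered j He Hf efc Hu kz.
rewrite jz (lin0 (act_linr actP _)) => /esym/eqP; rewrite scaler_eq0.
rewrite mulf_eq0 pnatr_eq0 /= subr_eq0 => /orP[/eqP|/eqP//].
by rewrite add_lfunE dual_mulrn.
Qed.

Definition weights_in (S : set W) : set dual :=
  [set lam | exists v, [/\ S v, wt lam v & v <> 0]].

Definition sl2_coroot (al : dual) (c : subvs_of h) : Prop :=
  exists e f, [/\ root_space al e, root_space (- al) f, brD e f = vsval c &
    al c = 2].

(** The two conditions on [S] under which $\mathfrak{sl}_2$-theory applies to
    it; both an $\mathrm{ad}$-module with finitely many weights and a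
    finite-dimensional module satisfy them. *)
Definition sl2_admissible (S : set W) : Prop :=
  (forall y u, S u -> S (act y u)) /\
  forall (al : dual) e, al != 0 -> root_space al e ->
    forall mu u, S u -> wt mu u -> exists k, iter k (act e) u = 0.

(** With [lam c = j - 2 k], the weight [lam - lam c *: al] is reached from [lam] by
    [k] raisings and [j - k] lowerings. *)
Lemma reflected_weight (S : set W) (al lam : dual) (c : subvs_of h) :
  sl2_admissible S -> sl2_coroot al c -> weights_in S lam ->
  (exists m : int, lam c = m%:~R) /\ weights_in S (lam - lam c *: al).
Proof.
move=> [Sact nil] [e [f [He Hf efc alc]]] [w [Sw Hw w0]].
have two : (2 : K) != 0 by rewrite pnatr_eq0.
have al0 : al != 0.
  by apply: contra_neq two => al0; rewrite -alc al0 lfunE.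
have al0' : - al != 0 by rewrite oppr_eq0.
have Siter y n u : S u -> S (iter n (act y) u).
  by move=> Su; elim: n => //= n; exact: Sact.
have natZ (n : nat) (mu : dual) : mu *+ n = (n%:R : K) *: mu by rewrite scaler_nat.
have [k [j [E ne]]] := weight_string He Hf efc Sact (nil _ _ al0 He)
  (nil _ _ al0' Hf) Sw Hw w0.
have {}E : lam c = j%:R - 2 * k%:R.
  by apply/eqP; rewrite eq_sym subr_eq -alc E alc mulrAC divff ?mul1r.
split; first by exists (j%:Z - 2 * k%:Z); rewrite rmorphB rmorphM.
have [kj|jk] := leqP k j.
  exists (iter (j - k) (act f) (iter k (act e) w)); split; last 1 first.
  - by apply: ne; exact: leq_subr.
  - exact: (Siter _ _ _ (Siter _ _ _ Sw)).
  have := weight_shift_iter (j - k) Hf (weight_shift_iter k He Hw).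
  rewrite -addrA !natZ scalerN -scalerBl natrB // E.
  rewrite (_ : k%:R - _ = - (j%:R - 2 * k%:R)) ?scaleNr //.
  by ring.
(* For [j < k] the number [lam c] is negative and the opposite triple works. *)
have efc' : brD f e = vsval (- c) by rewrite (lie_antisym brP e f) efc linearN.
have He' : root_space (- - al) e by rewrite opprK.
have [k' [j' [E' ne']]] := weight_string Hf He' efc' Sact (nil _ _ al0' Hf)
  (nil _ _ al0 He) Sw Hw w0.
have E2 : lam c = 2 * k'%:R - j'%:R.
  have e2 : (- al) (- c) = 2 by rewrite opp_lfunE linearN opprK.
  move: E'; rewrite e2 linearN mulrAC divff // mul1r.
  by move/eqP; rewrite addrC subr_eq addrC -subr_eq eq_sym => /eqP.
have kj' : (k' <= j')%N.
  have : (2 * k'%:R - j'%:R : K) = j%:R - 2 * k%:R by rewrite -E2 -E.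
  move/eqP; rewrite subr_eq addrAC eq_sym subr_eq -!natrM -!natrD eqr_nat.
  by move/eqP => ?; lia.
exists (iter (j' - k') (act e) (iter k' (act f) w)); split; last 1 first.
- by apply: ne'; exact: leq_subr.
- exact: (Siter _ _ _ (Siter _ _ _ Sw)).
have := weight_shift_iter (j' - k') He (weight_shift_iter k' Hf Hw).
rewrite -addrA !natZ scalerN -scaleNr -scalerDl natrB // E2.
rewrite (_ : - k'%:R + _ = - (2 * k'%:R - j'%:R)) ?scaleNr //.
by ring.
Qed.

(** A root vector moves the eigenvalues of some [t] by a nonzero step, so on a
    subspace where [t] has finitely many eigenvalues it is nilpotent. *)
Lemma root_vector_nilpotent (S : set W) (as_ : seq K) (t : gD) (k : K) e v :
  is_subspace S -> (forall y u, S u -> S (act y u)) -> uniq as_ ->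
  (forall u, S u -> prod_shift (act t) as_ u = 0) ->
  brD t e = k *: e -> k != 0 -> S v -> exists n, iter n (act e) v = 0.
Proof.
move=> sS Sact us ann te k0 Sv.
have [f vE fP] := prod_shift_decomp (act_linr actP t) sS (Sact t) us Sv (ann v Sv).
have /boolp.choice[n nP] a : exists n, iter n (act e) (f a) = 0.
  apply: contrapT => no.
  have Siter m u : S u -> S (iter m (act e) u).
    by move=> Su; elim: m => //= m; exact: Sact.
  have mem m : a + k *+ m \in as_.
    have [Sfa tfa] := fP a.
    apply: (prod_shift_eigen0 (act_linr actP t) (eigen_shift_iter m te tfa)).
      by apply: ann; exact: Siter.
    by move=> z; apply: no; exists m.
  have uq : uniq [seq a + k *+ m | m <- iota 0 (size as_).+1].
    rewrite map_inj_uniq ?iota_uniq // => m m' /addrI /eqP.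
    by rewrite -mulr_natr -[k *+ m']mulr_natr (inj_eq (mulfI k0)) eqr_nat => /eqP.
  have : {subset [seq a + k *+ m | m <- iota 0 (size as_).+1] <= as_}.
    by move=> _ /mapP[m _ ->].
  by move=> /(uniq_leq_size uq); rewrite size_map size_iota ltnn.
exists (\sum_(a <- as_) n a)%N; rewrite vE (lin_sum (iter_act_linear e _)).
rewrite big_seq big1 // => a aas.
rewrite (big_rem a aas) /= addnC iterD nP; exact: iter_act0.
Qed.

(** Eigenvectors for distinct eigenvalues are independent: in a linear relation
    between them, apply the product of all factors but one. *)
Lemma finite_dim_eigenvectors (F : set W) (T : W -> W) (w : nat -> W) (a : nat -> K) :
  finite_dim F -> linear T -> (forall k, F (w k)) ->
  (forall k, T (w k) = a k *: w k) -> injective a -> exists k, w k = 0.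
Proof.
move=> [n [s Fs]] lT Fw Tw ia.
have [u [i ui0] uw] := linear_dependence Fs (fun i : 'I_n.+1 => Fw i).
exists i; apply/eqP.
pose bs := [seq a (val j) | j <- enum 'I_n.+1 & j != i].
have := congr1 (prod_shift T bs) uw.
rewrite (lin0 (prod_shift_linear lT bs)) (lin_sum (prod_shift_linear lT bs)).
rewrite (bigD1 i) //= big1 ?addr0; last first.
  move=> j ji; rewrite (linZ (prod_shift_linear lT bs)) (prod_shift_eigen lT _ (Tw j)).
  rewrite (_ : \prod_(_ <- _) _ = 0) ?scale0r ?scaler0 //.
  apply/eqP; rewrite prodf_seq_eq0; apply/hasP; exists (a j); last by rewrite /= subrr.
  by apply/mapP; exists j => //; rewrite mem_filter ji mem_enum.
rewrite (linZ (prod_shift_linear lT bs)) (prod_shift_eigen lT _ (Tw i)).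
move/eqP; rewrite !scaler_eq0 (negPf ui0) /= => /orP[|//].
rewrite prodf_seq_eq0 => /hasP[b /mapP[j]]; rewrite mem_filter => /andP[ji _] -> /=.
by rewrite subr_eq0 => /eqP/ia/val_inj/esym/eqP; rewrite (negPf ji).
Qed.

Lemma finite_dim_admissible (F : set W) : finite_dim F ->
  (forall y u, F u -> F (act y u)) -> sl2_admissible F.
Proof.
move=> fF Fact; split=> // al e /dual_neq0[t at0] He mu u Fu Hu.
apply: (finite_dim_eigenvectors (T := act (vsval t)) (a := fun k => mu t + al t *+ k) fF).
- exact: (act_linr actP).
- by elim=> //= k; exact: Fact.
- by move=> k; exact: (eigen_shift_iter k (He t) (Hu t)).
- move=> m m' /addrI /eqP.
  by rewrite -mulr_natr -[_ *+ m']mulr_natr (inj_eq (mulfI at0)) eqr_nat => /eqP.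
Qed.

End WeightsOfActions.

(** * Weight decompositions *)

Section WeightBasis.
Context {K : fieldType} {T : vectType K} {W : lmodType K} {act : T -> W -> W}.
Local Notation dual := (dual_space (T := T)).
Local Notation wt := (weight_space act).

(** Components are indexed by a list, which turns uniqueness of the decomposition
    into independence of the weight spaces. *)
Record weight_basis (ws : seq dual) : Prop := WeightBasis {
  wb_uniq : uniq ws;
  wb_decomp : forall x, exists2 f : dual -> W,
    forall lam, lam \in ws -> wt lam (f lam) & x = \sum_(lam <- ws) f lam;
  wb_indep : forall f : dual -> W,
    (forall lam, lam \in ws -> wt lam (f lam)) ->
    \sum_(lam <- ws) f lam = 0 -> forall lam, lam \in ws -> f lam = 0 }.

Hypothesis lact : forall t, linear (act t).

Lemma weight_basis_of (P : set dual) : weight_decomposition act P ->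
  exists2 ws, P = [set` ws] & weight_basis ws.
Proof.
move=> [/finite_seqP[s0 PE] dec]; exists (undup s0).
  by rewrite PE; apply/seteqP; split=> x /=; rewrite mem_undup.
have {}PE : P = [set` undup s0] by rewrite PE; apply/seteqP; split=> x /=; rewrite mem_undup.
have us := undup_uniq s0; move: (undup s0) us PE => s us ->{P} in dec *.
split=> // [x|f fw f0 lam ls].
  have [f [[fw _ ->] _]] := dec x; exists f; first exact: fw.
  by rewrite -fsbig_seq.
have [f0' [_ uni]] := dec 0.
pose ft := fun mu => if mu \in s then f mu else 0.
have e1 : f0' = ft.
  apply: uni; split.
  - by move=> mu ms; rewrite /ft ms; exact: fw.
  - by move=> mu /negP/negPf; rewrite /ft /= => ->.
  - rewrite -fsbig_seq // -[LHS]f0 big_seq [RHS]big_seq; apply: eq_bigr => mu ms.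
    by rewrite /ft ms.
have e2 : f0' = fun=> 0.
  apply: uni; split => //.
  - by move=> mu _ t; rewrite (lin0 (lact t)) scaler0.
  - by rewrite -fsbig_seq // big1.
have : ft lam = 0 by rewrite -e1 e2.
by rewrite /ft ls.
Qed.

(** For every [t], apply independence to the components of [act t v - lam t *: v]. *)
Lemma wb_mem ws lam v : weight_basis ws -> wt lam v -> v <> 0 -> lam \in ws.
Proof.
move=> [us dec ind] Hv v0; have [f fw vE] := dec v.
apply: contrapT => /negP lws; apply: v0; rewrite vE big_seq big1 // => mu ms.
have : mu != lam by apply: contraNneq lws => <-.
rewrite -subr_eq0 => ml.
have [t mlt] : exists t, mu t - lam t != 0.
  apply: contrapT => no; move/eqP: ml; apply; apply/lfunP => t.
  rewrite add_lfunE opp_lfunE zero_lfunE; apply/eqP/negP => /negP ?; apply: no.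
  by exists t.
have := ind (fun nu => (nu t - lam t) *: f nu) _ _ mu ms.
move=> H; have /eqP : (mu t - lam t) *: f mu = 0.
  apply: H => [nu ns s|].
    by rewrite (linZ (lact s)) (fw _ ns) !scalerA mulrC.
  under eq_bigr do rewrite scalerBl.
  rewrite sumrB -scaler_sumr -vE -(Hv t) {1}vE (lin_sum (lact t)).
  by apply/eqP; rewrite subr_eq0; apply/eqP; rewrite !big_seq; apply: eq_bigr => nu ns; rewrite (fw _ ns).
by rewrite scaler_eq0 (negPf mlt) => /eqP.
Qed.

(** A triple $(c,a,t)$ stands for the operator $c(t-a)$, one factor of an
    interpolation polynomial. *)
Definition shift_step (w : W) (p : K * K * T) : W :=
  p.1.1 *: (act p.2 w - p.1.2 *: w).

(** Weight components are Lagrange interpolation polynomials in the operators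
    of the action, hence preserve every stable subspace and inherit bounds. *)
Lemma weight_projection ws lam : uniq ws -> lam \in ws ->
  exists l : seq (K * K * T), forall f : dual -> W,
    (forall mu, mu \in ws -> wt mu (f mu)) ->
    f lam = foldl shift_step (\sum_(mu <- ws) f mu) l.
Proof.
move=> us lws.
have /boolp.choice[t tP] mu : exists t, mu != lam -> lam t != mu t.
  have [->|ml] := eqVneq mu lam; first by exists 0.
  apply: contrapT => no; move/eqP: ml; apply; apply/lfunP => t.
  by apply/eqP; apply: contrapT => /negP ne; apply: no; exists t => _; rewrite eq_sym.
pose step mu := ((lam (t mu) - mu (t mu))^-1, (mu (t mu) : K), t mu).
exists [seq step mu | mu <- ws & mu != lam] => f fw.
set l := [seq step mu | mu <- _ & _].
have foldl_lin (s : seq (K * K * T)) : linear (fun w => foldl shift_step w s).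
  elim: s => //= p s IH a u v; rewrite -IH; congr foldl; rewrite /shift_step.
  rewrite (linD (lact _)) (linZ (lact _)) (scalerDr p.1.2).
  rewrite (_ : _ - _ = a *: (act p.2 u - p.1.2 *: u) + (act p.2 v - p.1.2 *: v)).
    by rewrite (scalerDr p.1.1) !scalerA (mulrC p.1.1).
  by rewrite scalerBr opprD addrACA !scalerA mulrC.
have fold_wt (s : seq dual) mu w : wt mu w ->
    foldl shift_step w [seq step nu | nu <- s] =
    (\prod_(nu <- s) ((lam (t nu) - nu (t nu))^-1 * (mu (t nu) - nu (t nu)))) *: w.
  elim: s w => [|nu s IH] w Hw; first by rewrite big_nil scale1r.
  rewrite big_cons /= /shift_step /= Hw -scalerBl scalerA (linZ (foldl_lin _)) IH //.
  by rewrite scalerA.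
rewrite (lin_sum (foldl_lin l)) (bigD1_seq lam) //= big_seq_cond big1 ?addr0.
  rewrite /l (fold_wt _ _ _ (fw _ lws)) big_seq big1 ?scale1r // => nu.
  by rewrite mem_filter => /andP[nl _]; rewrite mulVf // subr_eq0; exact: tP.
move=> mu /andP[ms ml]; rewrite /l (fold_wt _ _ _ (fw _ ms)).
rewrite (_ : \prod_(_ <- _) _ = 0) ?scale0r //.
apply/eqP; rewrite prodf_seq_eq0; apply/hasP; exists mu.
  by rewrite mem_filter ml.
by rewrite /= subrr mulr0.
Qed.

Lemma weight_component_stable ws lam (S : set W) : uniq ws -> lam \in ws ->
  is_subspace S -> (forall t w, S w -> S (act t w)) ->
  forall f : dual -> W, (forall mu, mu \in ws -> wt mu (f mu)) ->
  S (\sum_(mu <- ws) f mu) -> S (f lam).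
Proof.
move=> us ls sS Sact f fw; have [l /(_ f fw) ->] := weight_projection us ls.
elim: l (\sum_(mu <- ws) f mu) => //= p l IH w Sw; apply: IH.
apply: subspZ => //; apply: subspB => //; first exact: Sact.
exact: subspZ.
Qed.

Lemma prod_shift_weights (ws : seq dual) (t : T) (as_ : seq K) x : weight_basis ws ->
  {subset [seq (lam t : K) | lam : dual <- ws] <= as_} -> prod_shift (act t) as_ x = 0.
Proof.
move=> wb sub; have [f fw ->] := wb_decomp wb x.
rewrite (lin_sum (prod_shift_linear (lact t) _)) big_seq big1 // => lam ls.
rewrite (prod_shift_eigen (lact t) _ (fw _ ls t)).
rewrite (_ : \prod_(_ <- _) _ = 0) ?scale0r //.
apply/eqP; rewrite prodf_seq_eq0; apply/hasP; exists (lam t : K); last by rewrite /= subrr.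
by apply: sub; apply/mapP; exists lam.
Qed.

Lemma eigenvector_weight v : (forall w, linear (act^~ w)) -> v <> 0 ->
  (forall t, exists a, act t v = a *: v) -> exists lam : dual, wt lam v.
Proof.
move=> lt v0 /boolp.choice[a aE].
have la : linear (a : T -> K^o).
  move=> b t s; apply/eqP; rewrite -subr_eq0; apply/eqP.
  have /eqP : (a (b *: t + s) - (b *: (a t : K^o) + a s)) *: v = 0.
    rewrite -[b *: (a t : K^o)]/(b * a t) scalerBl scalerDl -scalerA -!aE.
    by rewrite (linD (lt v)) (linZ (lt v)) subrr.
  by rewrite scaler_eq0 => /orP[/eqP//|/eqP].
pose A : {linear T -> K^o} := HB.pack a (GRing.isLinear.Build K T K^o *:%R a la).
by exists (linfun A) => t; rewrite lfunE /= aE.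
Qed.

End WeightBasis.

(** * Structure of a weakly graded Lie algebra *)

Section LieProduct.
Context {K : fieldType} {L : vectType K} {br : L -> L -> L}.
Hypothesis brP : lie_bracket br.

Lemma memv_lie_prod (U V : {vspace L}) u v :
  u \in U -> v \in V -> br u v \in lie_prod br U V.
Proof.
have [ll lr _ _] := brP => uU vV.
rewrite (coord_vbasis uU) (lin_sum (ll v)); apply: memv_suml => i _.
rewrite (linZ (ll v)) memvZ // (coord_vbasis vV) (lin_sum (lr _)).
apply: memv_suml => j _; rewrite (linZ (lr _)) memvZ //.
by apply: memv_span; apply: allpairs_f; rewrite mem_nth // size_tuple.
Qed.

Lemma iter_lie_prod (U : {vspace L}) n t u :
  t \in U -> u \in U -> iter n (br t) u \in iter n (lie_prod br U) U.
Proof. by move=> tU uU; elim: n => //= n; exact: memv_lie_prod. Qed.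

Lemma semisimple_centre z : lie_semisimple br -> (forall y, br z y = 0) -> z = 0.
Proof.
have [ll lr _ _] := brP => ss z0.
have spz (U : {vspace L}) : (lie_prod br U <[z]> <= 0)%VS.
  apply/span_subvP => _ /allpairsP[[u w] /= [_ wz ->]].
  have /vlineP[k ->] := vbasis_mem wz.
  by rewrite (linZ (lr u)) (lie_antisym brP z) z0 oppr0 scaler0 mem0v.
have z1 : <[z]>%VS = 0%VS.
  apply: ss; first by apply: (subv_trans (spz _)); exact: sub0v.
  by exists 1%N; apply/eqP; rewrite -subv0 /=; exact: spz.
by apply/eqP; rewrite -memv0 -z1 memv_line.
Qed.

End LieProduct.

Lemma compose_reflections (F : fieldType) (M : lmodType F) (m v : M) (a b : F) :
  m - b *: v - (a - b * 2) *: v = m - (a - b) *: v.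
Proof.
by rewrite -addrA -opprD -scalerDl; congr (_ - _ *: _); ring.
Qed.

Section GradedStructure.
Context {R : realType} {V : vectType R} {Delta : seq V}.
Local Notation K := (R[i]).
Context {gD : vectType K} {brD : gD -> gD -> gD} {h : {vspace gD}}.
Context {g : completeNormedModType K} {br : g -> g -> g} {iota : gD -> g}.
Hypothesis Hg : weakly_graded br brD h iota Delta.

Local Notation T := (subvs_of h).
Local Notation dual := (dual_space (T := T)).
Local Notation adg := (fun (y : gD) (x : g) => br (iota y) x).
Local Notation wt := (weight_space (ad_graded br iota (h := h))).
Local Notation root_space := (weight_space (ad_cartan brD (h := h))).

Let brP : lie_bracket br. Proof. by case: Hg => _ []. Qed.
Let brDP : lie_bracket brD. Proof. by case: Hg => _ _ []. Qed.
Let liota : linear iota. Proof. by case: Hg => _ _ _ []. Qed.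
Let iota_inj : injective iota. Proof. by case: Hg => _ _ _ []. Qed.
Let iota_br x y : iota (brD x y) = br (iota x) (iota y).
Proof. by case: Hg => _ _ _ []. Qed.

Lemma graded_action : lie_action brD adg.
Proof.
have [ll lr _ _] := brP; split=> [w a x y|y|x y w]; last 2 first.
- exact: lr.
- have := lie_jacobi brP (iota x) (iota y) w; rewrite iota_br.
  rewrite (lie_antisym brP (iota x) w) (linN (lr _)).
  rewrite (lie_antisym brP (br (iota x) (iota y)) w).
  by move/eqP; rewrite subr_eq0 => /eqP <-.
by rewrite liota (linD (ll w)) (linZ (ll w)).
Qed.

Lemma ad_graded_linear (t : T) : linear (ad_graded br iota t).
Proof. exact: (act_linr graded_action). Qed.

Lemma graded_weight_basis : exists2 ws : seq dual,
  0 |` graded_weights br iota = [set` ws] & weight_basis (act := ad_graded br iota) ws.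
Proof. exact: (weight_basis_of ad_graded_linear (wg_decomposition Hg)). Qed.

Lemma graded_centre z : (forall x, br (iota z) x = 0) -> z = 0.
Proof.
move=> z0; apply: (semisimple_centre brDP (gDelta_semisimple (wg_gDelta Hg))) => y.
by apply: iota_inj; rewrite iota_br z0 (lin0 liota).
Qed.

(** For [t] in the Cartan subalgebra, [ad t] is nilpotent on the Cartan subalgebra
    and diagonalizable by the weight decomposition, hence zero there. *)
Lemma cartan_abelian (t s : T) : brD (vsval t) (vsval s) = 0.
Proof.
have [ws _ wb] := graded_weight_basis.
have [_ [n nil] _] := gDelta_cartan (wg_gDelta Hg).
have [f fw sE] := wb_decomp wb (iota (vsval s)).
have lt := ad_graded_linear t.
have iterE k u : iota (iter k (brD (vsval t)) u) = iter k (ad_graded br iota t) (iota u).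
  by elim: k => //= k IH; rewrite iota_br IH.
have itn : iter n (brD (vsval t)) (vsval s) = 0.
  apply/eqP; rewrite -memv0 -nil; apply: iter_lie_prod => //; exact: subvsP.
have litk k : linear (iter k (ad_graded br iota t)) by exact: (iter_act_linear graded_action).
have itw k lam : lam \in ws ->
    iter k (ad_graded br iota t) (f lam) = (lam t) ^+ k *: f lam.
  move=> ls; elim: k => [|k IH]; first by rewrite expr0 scale1r.
  by rewrite iterS IH (linZ lt) (fw _ ls) scalerA exprSr.
have zero lam : lam \in ws -> (lam t) ^+ n *: f lam = 0.
  apply: (wb_indep wb (f := fun lam => (lam t) ^+ n *: f lam)).
    by move=> mu ms u; rewrite (linZ (ad_graded_linear u)) (fw _ ms) !scalerA mulrC.
  transitivity (iter n (ad_graded br iota t) (iota (vsval s))); last first.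
    by rewrite -iterE itn (lin0 liota).
  by rewrite sE (lin_sum (litk n)) !big_seq; apply: eq_bigr => mu ms; rewrite itw.
apply: iota_inj; rewrite iota_br (lin0 liota) -/(ad_graded br iota t _) sE.
rewrite (lin_sum lt) big_seq big1 // => lam ls; rewrite (fw _ ls).
have := zero lam ls; move/eqP; rewrite scaler_eq0 expf_eq0.
by move=> /orP[/andP[_ /eqP ->]|/eqP ->]; rewrite ?scale0r ?scaler0.
Qed.

Lemma cartan_weight0 (t : T) : wt 0 (iota (vsval t)).
Proof.
by move=> s; rewrite /ad_graded -iota_br cartan_abelian (lin0 liota) lfunE scale0r.
Qed.

Lemma root_space0 x : root_space 0 x -> x \in h.
Proof.
move=> x0; have [_ _] := gDelta_cartan (wg_gDelta Hg); apply=> y yh.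
have := x0 (vsproj h y); rewrite /ad_cartan vsprojK // lfunE scale0r => yx.
by rewrite (lie_antisym brDP y) yx oppr0 mem0v.
Qed.

Lemma graded_nilpotent al e x : al != 0 -> root_space al e ->
  exists n, iter n (adg e) x = 0.
Proof.
have [ws _ wb] := graded_weight_basis.
move=> /dual_neq0[t at0] He.
apply: (root_vector_nilpotent graded_action (S := setT)
  (as_ := undup [seq (lam t : K) | lam : dual <- ws]) (t := vsval t) (k := al t)) => //.
- exact: undup_uniq.
- move=> v _; apply: (prod_shift_weights ad_graded_linear v wb) => a.
  by rewrite mem_undup.
- exact: He.
Qed.

Lemma graded_admissible : sl2_admissible (brD := brD) (h := h) (act := adg) setT.
Proof. by split=> // al e al0 He mu u _ _; exact: (graded_nilpotent u al0 He). Qed.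

(** The weight decomposition of the big algebra restricts to the subalgebra,
    because weight components stay in every stable subspace. *)
Lemma root_vectors_span (y : gD) : lspan [set z | exists al, root_space al z] y.
Proof.
have [ws _ wb] := graded_weight_basis.
have [f fw yE] := wb_decomp wb (iota y).
have sub : is_subspace (range iota).
  split; first by exists 0 => //; rewrite (lin0 liota).
  by move=> a _ _ [u _ <-] [v _ <-]; exists (a *: u + v) => //; rewrite liota.
have stab t w : range iota w -> range iota (ad_graded br iota t w).
  by move=> [u _ <-]; exists (brD (vsval t) u) => //; rewrite iota_br.
have /boolp.choice[z zE] lam : exists z, lam \in ws -> iota z = f lam.
  have [ls|_] := boolP (lam \in ws); last by exists 0.
  have [||z _ zE] := weight_component_stable ad_graded_linear (wb_uniq wb) ls sub _ fw.
  - by move=> t w; exact: stab.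
  - by rewrite -yE; exists y.
  - by exists z.
have -> : y = \sum_(lam <- ws) z lam.
  apply: iota_inj; rewrite yE (lin_sum liota) !big_seq.
  by apply: eq_bigr => lam /zE.
rewrite big_seq; apply: subsp_sum; first exact: lspan_subspace.
move=> lam ls; apply: lspan_gen; exists lam => t.
apply: iota_inj; rewrite /ad_cartan iota_br (linZ liota) (zE _ ls).
exact: (fw _ ls t).
Qed.

Lemma root_vectors_spanning_seq : exists2 ys : seq gD,
  (forall y, lspan [set` ys] y) & forall y, y \in ys -> exists al, root_space al y.
Proof.
have /boolp.choice[l lP] (y : gD) : exists l : seq gD,
    (forall z, z \in l -> exists al, root_space al z) /\ lspan [set` l] y.
  have [n [c [s [sP ->]]]] := root_vectors_span y.
  exists (codom s); split=> [z /codomP[i ->]|]; first exact: sP.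
  apply: subsp_sum => [|i _]; first exact: lspan_subspace.
  apply: (subspZ _ (lspan_subspace _)).
  by apply: lspan_gen => /=; exact: codom_f.
exists (flatten [seq l y | y <- vbasis (fullv : {vspace gD})]); last first.
  by move=> y /flatten_mapP[x _ /(proj1 (lP x))].
move=> y; rewrite (coord_vbasis (memvf y)); apply: subsp_sum => [|i _]; first exact: lspan_subspace.
apply: (subspZ _ (lspan_subspace _)).
apply: (lspanS _ (proj2 (lP _))) => z /= zl; apply/flatten_mapP.
by exists (vbasis fullv)`_i => //; rewrite mem_nth // size_tuple.
Qed.

Definition weight_set : set dual :=
  weights_in (h := h) (act := adg) setT.

Lemma weight_seq : exists2 ws : seq dual, uniq ws &
  forall lam, (lam \in ws) <-> weight_set lam.
Proof.
have [ws _ wb] := graded_weight_basis.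
exists [seq lam <- ws | `[< weight_set lam >]].
  by rewrite filter_uniq // (wb_uniq wb).
move=> lam; rewrite mem_filter; split=> [/andP[/asboolP//]|Hl].
apply/andP; split; first exact/asboolP.
have [v [_ Hv v0]] := Hl.
exact: (wb_mem ad_graded_linear wb Hv).
Qed.

(** An element on which all weights vanish acts by zero on $\mathfrak g$, hence lies
    in the centre of the semisimple algebra. *)
Lemma weights_separate (t : T) : (forall lam, weight_set lam -> lam t = 0) -> t = 0.
Proof.
have [ws _ wb] := graded_weight_basis => t0.
apply: val_inj; rewrite [RHS]linear0; apply: graded_centre => x.
have [f fw xE] := wb_decomp wb x.
rewrite -[LHS]/(ad_graded br iota t x) xE (lin_sum (ad_graded_linear t)).
rewrite big_seq big1 // => lam ls.
have [->|f0] := pselect (f lam = 0); first exact: (lin0 (ad_graded_linear t)).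
rewrite (fw _ ls) t0 ?scale0r //.
by exists (f lam); split=> //; exact: fw.
Qed.

Lemma weight_reflection al c lam : sl2_coroot (brD := brD) al c ->
  weight_set lam -> weight_set (lam - lam c *: al).
Proof.
by move=> Hc Hl; have [] := reflected_weight brDP graded_action graded_admissible Hc Hl.
Qed.

Lemma weight_coroot_int al c lam : sl2_coroot (brD := brD) al c ->
  weight_set lam -> exists m : int, lam c = m%:~R.
Proof.
by move=> Hc Hl; have [] := reflected_weight brDP graded_action graded_admissible Hc Hl.
Qed.

(** A bracket $t=[x,y]$ of opposite root vectors with $\alpha(t)=0$ spans with
    $x$ and $y$ a Heisenberg algebra, so it acts by zero on each weight space. *)
Lemma heisenberg_zero al x y (t : T) : al != 0 -> root_space al x ->
  root_space (- al) y -> brD x y = vsval t -> al t = 0 -> t = 0.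
Proof.
move=> al0 Hx Hy xyt at0; apply: weights_separate => lam [w [Sw Hw w0]].
have [Sact nil] := graded_admissible.
have al0' : - al != 0 by rewrite oppr_eq0.
have [k [j [+ _]]] := weight_string graded_action Hx Hy xyt Sact
   (nil _ _ al0 Hx) (nil _ _ al0' Hy) Sw Hw w0.
by rewrite at0 !mul0r addr0.
Qed.

(** The product of the two reflections is a translation along [al], and a finite
    nonempty set of weights is not stable under a nonzero translation. *)
Lemma sl2_coroot_uniq (al : dual) c c' :
  sl2_coroot (brD := brD) al c -> sl2_coroot (brD := brD) al c' -> c = c'.
Proof.
move=> Hc Hc'; apply/eqP; rewrite -subr_eq0; apply/eqP; apply: weights_separate.
move=> lam Hl; rewrite linearB /=; apply/eqP; apply: contrapT => /negP d0.
set d := _ - _ in d0.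
have alc : al c = 2 by case: Hc => e [f []].
have alc' : al c' = 2 by case: Hc' => e [f []].
have step mu : weight_set mu -> weight_set (mu - (mu c - mu c') *: al).
  move=> Hm; have := weight_reflection Hc (weight_reflection Hc' Hm).
  have -> : (mu - mu c' *: al) c = mu c - mu c' * 2.
    by rewrite add_lfunE opp_lfunE scale_lfunE alc.
  by rewrite compose_reflections.
have it n : weight_set (lam - (d * n%:R) *: al).
  elim: n => [|n IH]; first by rewrite mulr0 scale0r subr0.
  have := step _ IH.
  have E t : (lam - (d * n%:R) *: al) t = lam t - d * n%:R * al t.
    by rewrite add_lfunE opp_lfunE scale_lfunE.
  rewrite !E alc alc' opprB addrA subrK -/d.
  by rewrite -addrA -opprD -scalerDl -natr1 mulrDr mulr1.
have [ws us wsE] := weight_seq.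
have al0 : al != 0.
  apply: contraTneq isT => a0; have : (2 : K) != 0 by rewrite pnatr_eq0.
  by rewrite -alc a0 lfunE eqxx.
have : {subset [seq lam - (d * n%:R) *: al | n <- seq.iota 0 (size ws).+1] <= ws}.
  by move=> _ /mapP[n _ ->]; apply/wsE.
have inj : injective (fun n : nat => lam - (d * n%:R) *: al).
  move=> n m /addrI/oppr_inj e.
  have /eqP : (d * n%:R - d * m%:R) *: al = 0 by rewrite scalerBl e subrr.
  rewrite scaler_eq0 (negPf al0) orbF subr_eq0 => /eqP/(mulfI d0)/eqP.
  by rewrite eqr_nat => /eqP.
have uq : uniq [seq lam - (d * n%:R) *: al | n <- seq.iota 0 (size ws).+1].
  by rewrite (map_inj_uniq inj) iota_uniq.
by move=> /(uniq_leq_size uq); rewrite size_map size_iota ltnn.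
Qed.

(** A coroot is a linear combination of brackets $t_i=[x_i,y_i]$ of opposite root
    vectors.  Those with $\alpha(t_i)=0$ vanish, the others are multiples of one and
    the same element, and this makes a single bracket out of the combination. *)
Lemma coroot_sl2 (al : dual) c : lie_roots brD al -> is_coroot brD al c ->
  sl2_coroot (brD := brD) al c.
Proof.
move=> [/eqP al0 _] [[n [a [s [sP cE]]]] alc].
have [ll lr _ _] := brDP.
have /boolp.choice[t tP] i : exists t : T, exists x y,
    [/\ root_space al x, root_space (- al) y, brD x y = vsval t & s i = vsval t].
  have [x [y [Hx Hy ->]]] := sP i.
  have xyh : brD x y \in h.
    apply: root_space0; rewrite -(addNr al).
    exact: (weight_shift (lie_ad_action brDP) Hx Hy).
  by exists (vsproj h (brD x y)), x, y; rewrite vsprojK.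
have cE' : c = \sum_i a i *: t i.
  apply: val_inj; rewrite [LHS]cE linear_sum; apply: eq_bigr => i _.
  by have [x [y [_ _ _ ->]]] := tP i; rewrite linearZ.
have [i ati] : exists i, al (t i) != 0.
  apply: contrapT => no; have : (2 : K) != 0 by rewrite pnatr_eq0.
  rewrite -alc cE' linear_sum big1 ?eqxx // => i _.
  apply/eqP; rewrite linearZ; apply: contrapT => /negP; rewrite scaler_eq0.
  by rewrite negb_or => /andP[_ ?]; apply: no; exists i.
have sl2 j : al (t j) != 0 ->
    sl2_coroot (brD := brD) al ((2 / al (t j)) *: t j).
  move=> atj; have [x [y [Hx Hy xy _]]] := tP j.
  exists x, ((2 / al (t j)) *: y); split=> //.
  - exact: (subspZ _ (weight_space_subspace (lie_ad_action brDP) _) Hy).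
  - by rewrite (linZ (lr x)) xy linearZ.
  - by rewrite linearZ /= -[_ *: _]/(_ * _) divfK.
have tj j : t j = (al (t j) / 2) *: ((2 / al (t i)) *: t i).
  have [atj|atj] := eqVneq (al (t j)) 0.
    have [x [y [Hx Hy xy _]]] := tP j.
    by rewrite (heisenberg_zero al0 Hx Hy xy atj) linear0 mul0r scale0r.
  rewrite (sl2_coroot_uniq (sl2 i ati) (sl2 j atj)) scalerA mulrA divfK ?pnatr_eq0 //.
  by rewrite divff // scale1r.
suff -> : c = (2 / al (t i)) *: t i by exact: sl2.
rewrite {1}cE'; under eq_bigr do rewrite tj scalerA.
rewrite -scaler_suml (_ : \sum_j _ = 1) ?scale1r //.
under eq_bigr do rewrite mulrA.
rewrite -mulr_suml (_ : \sum_j _ = 2) ?divff ?pnatr_eq0 //.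
by rewrite -alc cE' linear_sum; apply: eq_bigr => j _; rewrite linearZ.
Qed.

End GradedStructure.

(** * The orbit of a point under the reflections *)

Section WeylOrbit.
Context {R : realType} {V : vectType R} {Delta : seq V}.
Local Notation K := (R[i]).
Context {gD : vectType K} {brD : gD -> gD -> gD} {h : {vspace gD}}.
Context {g : completeNormedModType K} {br : g -> g -> g} {iota : gD -> g}.
Hypothesis Hg : weakly_graded br brD h iota Delta.

Local Notation T := (subvs_of h).
Local Notation dual := (dual_space (T := T)).
Local Notation sl2_coroot := (sl2_coroot (brD := brD) (h := h)).
Local Notation weight_set := (weight_set (h := h) (br := br) (iota := iota)).

Let weights_stable (al : dual) c mu : sl2_coroot al c -> weight_set mu ->
  weight_set (mu - (mu c : K) *: al).
Proof. exact: (weight_reflection Hg). Qed.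

Definition reflection (al : dual) (c y : T) : T := y - (al y : K) *: c.

Inductive weyl_orbit (x : T) : T -> Prop :=
| weyl_orbit_id : weyl_orbit x x
| weyl_orbit_step al c y : sl2_coroot al c -> weyl_orbit x y ->
    weyl_orbit x (reflection al c y).

Lemma dualZ (lam : dual) (a : K) y : lam (a *: y) = a * (lam y : K).
Proof. by rewrite linearZ. Qed.

Lemma dualB (lam : dual) y z : lam (y - z) = (lam y : K) - lam z.
Proof. by rewrite linearB. Qed.

Lemma dual_sum (lam : dual) I (r : seq I) (P : pred I) (f : I -> T) :
  lam (\sum_(i <- r | P i) f i) = \sum_(i <- r | P i) (lam (f i) : K).
Proof. by rewrite linear_sum. Qed.

Lemma dual_subZ (lam al : dual) (a : K) y :
  (lam - a *: al) y = (lam y : K) - a * (al y : K).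
Proof. by rewrite add_lfunE opp_lfunE scale_lfunE. Qed.

Lemma reflectionE (al lam : dual) c y :
  lam (reflection al c y) = (lam - (lam c : K) *: al) y.
Proof. by rewrite /reflection dualB dualZ dual_subZ mulrC. Qed.

Lemma weyl_orbit_weight (L : set dual) x y lam :
  (forall al c mu, sl2_coroot al c -> L mu -> L (mu - (mu c : K) *: al)) ->
  weyl_orbit x y -> L lam -> exists2 mu, L mu & lam y = mu x.
Proof.
move=> Lr oxy; elim: oxy lam => [|al c z Hc _ IH] lam Ll; first by exists lam.
by rewrite reflectionE; apply: IH; exact: Lr.
Qed.

Lemma reflection_linear al c : linear (reflection al c).
Proof.
move=> a y z; rewrite /reflection linearP /= scalerDl -scalerA scalerBr opprD.
by rewrite addrACA.
Qed.

Lemma reflectionK (al : dual) c : al c = 2 -> involutive (reflection al c).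
Proof.
move=> alc y; rewrite {1}/reflection reflectionE dual_subZ alc mulrC -{1}[al y]mulr1.
rewrite -mulrBr (_ : 1 - 2 = -1) ?mulrN1; last by rewrite mulr2n opprD addrA subrr sub0r.
by rewrite scaleNr opprK subrK.
Qed.

Lemma dual_reflectionK (al : dual) c : al c = 2 ->
  involutive (fun lam : dual => lam - (lam c : K) *: al).
Proof. by move=> alc lam; apply/lfunP => y; rewrite -!reflectionE reflectionK. Qed.

(** A point is determined by the values of the weights on it, and on the orbit
    these values all occur among the values at [x]. *)
Lemma weyl_orbit_finite x : finite_set (weyl_orbit x).
Proof.
have [ws us wsE] := weight_seq Hg.
pose vals : seq K := [seq lam x : K | lam : dual <- ws].
pose code (y : T) : {ffun 'I_(size ws) -> 'I_(size vals).+1} :=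
  [ffun i => inord (index (tnth (in_tuple ws) i y : K) vals)].
have val_mem y lam : weyl_orbit x y -> lam \in ws -> (lam y : K) \in vals.
  move=> oxy /wsE Hl.
  have [mu Hm ->] := weyl_orbit_weight weights_stable oxy Hl.
  by apply/mapP; exists mu => //; apply/wsE.
have code_inj y z : weyl_orbit x y -> weyl_orbit x z -> code y = code z -> y = z.
  move=> oy oz /ffunP e; apply/eqP; rewrite -subr_eq0; apply/eqP.
  apply: (weights_separate Hg) => lam /wsE ls; apply/eqP.
  rewrite dualB subr_eq0; apply/eqP.
  have [i lamE] := (tnthP (in_tuple ws) lam) ls.
  have vy := val_mem _ _ oy ls; have vz := val_mem _ _ oz ls.
  have idx v : v \in vals ->
      nat_of_ord (inord (index v vals) : 'I_(size vals).+1) = index v vals.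
    by move=> vv; rewrite inordK // ltnS ltnW // index_mem.
  have := e i; rewrite !ffunE -lamE => /(congr1 (@nat_of_ord _)).
  rewrite (idx _ vy) (idx _ vz) => ei.
  by rewrite -(nth_index 0 vy) ei (nth_index 0 vz).
have /boolp.choice[dec decP] c : exists y, (exists2 z, weyl_orbit x z & code z = c) -> weyl_orbit x y /\ code y = c.
  have [[z oz zc]|no] := pselect (exists2 z, weyl_orbit x z & code z = c).
    by exists z.
  by exists 0 => /no.
apply: (sub_finite_set _ (finite_image dec (@finite_finset _ setT))) => y oy.
exists (code y) => //.
have [|oz zc] := decP (code y); first by exists y.
exact: code_inj.
Qed.

(** Weights take integral values on coroots. *)
Lemma real_cartan_weight_real x (lam : dual) : real_cartan brD x -> weight_set lam ->
  (lam x : K) \is Num.real.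
Proof.
move=> [n [r [c [cP ->]]]] Hl; rewrite dual_sum; apply: rpred_sum => i _.
have [al Ha Hc] := cP i.
have [m me] := weight_coroot_int Hg (coroot_sl2 Hg Ha Hc) Hl.
by rewrite dualZ me rpredM ?realz // complex_real.
Qed.

(** The invariant form $\sum_\beta\beta(y)\beta(z)$ is positive definite on the
    real span of the coroots.  The sum over the orbit is fixed by every
    reflection, hence orthogonal to every coroot, hence zero. *)
Lemma weyl_orbit_sum0 x : real_cartan brD x -> exists O : seq T,
  [/\ x \in O, forall y, y \in O -> weyl_orbit x y & \sum_(y <- O) y = 0].
Proof.
move=> xR; have /finite_seqP[s0 sE] := weyl_orbit_finite x.
pose O := undup s0; exists O.
have OE y : (y \in O) <-> weyl_orbit x y.
  by rewrite mem_undup; have -> : weyl_orbit x = [set` s0] by [].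
split; [by apply/OE; constructor|by move=> y /OE|].
have [ws us wsE] := weight_seq Hg.
pose B (y z : T) : K := \sum_(lam <- ws) (lam y : K) * lam z.
have Blin z : linear (B^~ z : T -> K^o).
  move=> a u v; rewrite /B scaler_sumr -big_split /=; apply: eq_bigr => lam _.
  by rewrite linearP mulrDl -mulrA.
set Y := \sum_(y <- O) y.
have sl2c al c : sl2_coroot al c -> al c = 2 by case=> e [f []].
have fixY al c : sl2_coroot al c -> reflection al c Y = Y.
  move=> Hc; rewrite /Y (lin_sum (reflection_linear al c)).
  rewrite -(big_map (reflection al c) xpredT id) /=.
  have rK := reflectionK (sl2c _ _ Hc).
  have sub y : y \in O -> reflection al c y \in O.
    by move=> /OE oy; apply/OE; constructor.
  have uO : uniq O by exact: undup_uniq.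
  have uO' : uniq (map (reflection al c) O) by rewrite (map_inj_uniq (inv_inj rK)).
  apply: perm_big; apply: (uniq_perm uO' uO) => y; apply/mapP/idP => [[z zO ->]|yO]; first exact: sub.
  by exists (reflection al c y); [exact: sub|rewrite rK].
have Binv al c y z : sl2_coroot al c -> B (reflection al c y) (reflection al c z) = B y z.
  move=> Hc; rewrite /B; under eq_bigr do rewrite !reflectionE.
  pose s (lam : dual) : dual := lam - (lam c : K) *: al.
  rewrite -(big_map s xpredT (fun lam => (lam y : K) * lam z)) /=.
  have sK : involutive s := dual_reflectionK (sl2c _ _ Hc).
  have sub lam : lam \in ws -> s lam \in ws.
    by move=> /wsE Hl; apply/wsE; exact: weights_stable Hc Hl.
  have us' : uniq (map s ws) by rewrite (map_inj_uniq (inv_inj sK)).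
  apply: perm_big; apply: (uniq_perm us' us) => lam; apply/mapP/idP => [[mu ms ->]|ls]; first exact: sub.
  by exists (s lam); [exact: sub|rewrite sK].
have BcY al c : sl2_coroot al c -> B c Y = 0.
  move=> Hc; have := Binv _ _ c Y Hc; rewrite (fixY _ _ Hc).
  have -> : reflection al c c = - c.
    by rewrite /reflection (sl2c _ _ Hc) scaler_nat mulr2n opprD addrA subrr add0r.
  rewrite (linN (Blin Y)) => /eqP; rewrite eq_sym -addr_eq0 -mulr2n mulrn_eq0 /=.
  by move/eqP.
have BxY : B x Y = 0.
  case: xR => n [r [c [cP ->]]]; rewrite (lin_sum (Blin Y)) big1 // => i _.
  have [al Ha Hc] := cP i.
  by rewrite (linZ (Blin Y)) (BcY _ _ (coroot_sl2 Hg Ha Hc)) scaler0.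
have ByY y : weyl_orbit x y -> B y Y = 0.
  elim=> // al c z Hc _ IH.
  by rewrite /reflection (linB (Blin Y)) IH (linZ (Blin Y)) (BcY _ _ Hc) scaler0 subr0.
have BYY : B Y Y = 0.
  rewrite {1}/Y (lin_sum (Blin Y)) big_seq big1 // => y /OE; exact: ByY.
have Yreal lam : lam \in ws -> (lam Y : K) \is Num.real.
  move=> /wsE Hl; rewrite /Y dual_sum big_seq; apply: rpred_sum => y /OE oy.
  have [mu Hm ->] := weyl_orbit_weight weights_stable oy Hl.
  exact: real_cartan_weight_real.
apply: (weights_separate Hg) => lam /wsE ls.
have sq mu : mu \in ws -> 0 <= (mu Y : K) * mu Y.
  by move=> /Yreal; rewrite realEsqr expr2.
have /eqP := BYY; rewrite /B big_seq psumr_eq0 // => /allP/(_ _ ls).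
by rewrite ls /= mulf_eq0 orbb => /eqP.
Qed.

End WeylOrbit.

(** * Norms, words and seminorms *)

Section RealNorm.
Context {R : realType}.
Local Notation K := (R[i]).

Definition cabs (a : K) : R := complex.Re `|a|.

Lemma cabsE a : (cabs a)%:C = `|a|.
Proof. by rewrite /cabs RRe_real // normr_real. Qed.

Lemma cabs_real (a : R) : 0 <= a -> cabs a%:C = a.
Proof. by move=> a0; rewrite /cabs ger0_norm // lecR. Qed.

Lemma cabs_ge0 a : 0 <= cabs a.
Proof. by rewrite -lecR cabsE normr_ge0. Qed.

Context {V : normedModType K}.
Implicit Types u v : V.

Lemma rnorm0 : rnorm (0 : V) = 0.
Proof. by apply: complexI; rewrite rnormE normr0. Qed.

Lemma rnorm0_eq0 v : rnorm v = 0 -> v = 0.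
Proof. by move=> v0; apply/eqP; rewrite -normr_eq0 -rnormE v0. Qed.

Lemma rnorm_gt0 v : v != 0 -> 0 < rnorm v.
Proof.
by move=> v0; rewrite lt_neqAle rnorm_ge0 andbT eq_sym; apply: contraNneq v0 => /rnorm0_eq0 ->.
Qed.

Lemma rnormZ a v : rnorm (a *: v) = cabs a * rnorm v.
Proof. by apply: complexI; rewrite rmorphM /= cabsE !rnormE normrZ. Qed.

Lemma rnormN v : rnorm (- v) = rnorm v.
Proof. by apply: complexI; rewrite !rnormE normrN. Qed.

Lemma rnorm_sum I (r : seq I) (f : I -> V) :
  rnorm (\sum_(i <- r) f i) <= \sum_(i <- r) rnorm (f i).
Proof.
elim/big_rec2 : _ => [|i a u _ le]; first by rewrite rnorm0.
by apply: (le_trans (ler_rnormD _ _)); rewrite lerD2l.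
Qed.

Lemma rnorm_ltE v (e : R) : (rnorm v < e) = (`|v| < e%:C).
Proof. by rewrite -rnormE ltcR. Qed.

Lemma near0_rnorm (A : set V) : nbhs (0 : V) A ->
  exists2 d : R, 0 < d & forall v, rnorm v < d -> A v.
Proof.
move=> /nbhs_ballP[e /= e0 eA]; exists (complex.Re e).
  by move: e0; rewrite ltcE => /andP[].
move=> v vd; apply: eA; rewrite -ball_normE /= sub0r normrN -rnormE.
have /RRe_real <- : e \is Num.real by exact: gtr0_real.
by rewrite ltcR.
Qed.

(** Boundedness near zero gives a linear bound after rescaling.  The set [P] is
    the whole space for operators and $\mathfrak p$ for the representation. *)
Lemma homogeneous_bound (P : set V) (N : V -> R) (d C : R) : 0 < d -> N 0 = 0 ->
  (forall a v, P v -> 0 < a -> P (a%:C *: v) /\ N (a%:C *: v) = a * N v) ->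
  (forall v, P v -> rnorm v < d -> N v <= C) ->
  forall v, P v -> N v <= 2 * C / d * rnorm v.
Proof.
move=> d0 N0 PN NC v Pv; have [->|v0] := eqVneq v 0; first by rewrite N0 rnorm0 mulr0.
have rv := rnorm_gt0 v0.
pose a := d / 2 / rnorm v.
have a0 : 0 < a by rewrite !divr_gt0.
have [Pa Na] := PN a v Pv a0.
have /(NC _ Pa) : rnorm (a%:C *: v) < d.
  by rewrite rnormZ cabs_real ?ltW // divfK ?gt_eqF // ltr_pdivrMr // ltr_pMr // ltr1n.
rewrite Na mulrC -ler_pdivlMr // => /le_trans; apply.
rewrite le_eqVlt; apply/orP; left; apply/eqP; rewrite /a.
by field; rewrite !gt_eqF.
Qed.

End RealNorm.

Section BoundedOperators.
Context {R : realType}.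
Local Notation K := (R[i]).

Lemma continuous_linear_bound {V W : normedModType K} (f : V -> W) :
  linear f -> continuous f ->
  exists2 M : R, 0 <= M & forall v, rnorm (f v) <= M * rnorm v.
Proof.
move=> lf cf.
have /near0_rnorm[d d0 dP] : nbhs (0 : V) (f @^-1` (ball (0 : W) 1)).
  by apply: cf; rewrite (lin0 lf); exact: nbhsx_ballx.
exists (2 * 1 / d); first by rewrite divr_ge0 // ?ltW // mulr_ge0.
move=> v; apply: (homogeneous_bound (P := setT) (N := fun v => rnorm (f v))) => //.
- by rewrite (lin0 lf) rnorm0.
- by move=> a u _ a0; rewrite (linZ lf) rnormZ cabs_real // ltW.
- move=> u _ /dP; rewrite /= -ball_normE /= sub0r normrN -rnormE => /ltW.
  by rewrite -[1]/(1%:C) lecR.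
Qed.

Lemma continuous_bilinear_bound {V W X : normedModType K} (f : V -> W -> X) :
  (forall y, linear (f^~ y)) -> (forall x, linear (f x)) ->
  continuous (fun z : V * W => f z.1 z.2) ->
  exists2 M : R, 0 <= M & forall x y, rnorm (f x y) <= M * rnorm x * rnorm y.
Proof.
move=> fl fr cf.
have : nbhs ((0, 0) : V * W) ((fun z : V * W => f z.1 z.2) @^-1` (ball (0 : X) 1)).
  by apply: cf; rewrite /= (lin0 (fr 0)); exact: nbhsx_ballx.
move=> [[A B] /= [/near0_rnorm[d d0 dA] /near0_rnorm[e e0 eB]] AB].
have le1 x y : rnorm x < d -> rnorm y < e -> rnorm (f x y) <= 1.
  move=> /dA Ax /eB By; have /= := AB (x, y) (conj Ax By).
  by rewrite -ball_normE /= sub0r normrN -rnormE -[1]/(1%:C) ltcR => /ltW.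
have bnd1 x y : rnorm x < d -> rnorm (f x y) <= 2 * 1 / e * rnorm y.
  move=> xd; apply: (homogeneous_bound (P := setT) (N := fun v => rnorm (f x v))) => //.
  - by rewrite (lin0 (fr x)) rnorm0.
  - by move=> a u _ a0; rewrite (linZ (fr x)) rnormZ cabs_real // ltW.
  - by move=> v _; exact: le1.
exists (2 * (2 * 1 / e) / d); first by rewrite !(divr_ge0, mulr_ge0) // ?ltW.
move=> x y.
have := homogeneous_bound (P := setT) (N := fun v => rnorm (f v y)) (d := d)
  (C := 2 * 1 / e * rnorm y) d0.
move=> /(_ _ _ _ x I) H; apply: (le_trans (H _ _ _)).
- by rewrite (lin0 (fl y)) rnorm0.
- by move=> a u _ a0; rewrite (linZ (fl y)) rnormZ cabs_real // ltW.
- by move=> v _ vd; exact: bnd1.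
by rewrite le_eqVlt; apply/orP; left; apply/eqP; field; rewrite !gt_eqF.
Qed.

End BoundedOperators.

Section EnvelopingWords.
Context {K : fieldType} {L : lmodType K} {U : algType K} (sigma : {linear L -> U}).

Definition word (xs : seq L) : U := \prod_(x <- xs) sigma x.

Lemma word_nil : word [::] = 1.
Proof. by rewrite /word big_nil. Qed.

Lemma word_cat xs ys : word (xs ++ ys) = word xs * word ys.
Proof. by rewrite /word big_cat. Qed.

Lemma word_cons x xs : word (x :: xs) = sigma x * word xs.
Proof. by rewrite /word big_cons. Qed.

Lemma word_rcons x xs : word (rcons xs x) = word xs * sigma x.
Proof. by rewrite -cats1 word_cat /word big_seq1. Qed.

Lemma word_ord n (x : 'I_n -> L) :
  \prod_(i < n) sigma (x i) = word [seq x i | i <- enum 'I_n].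
Proof. by rewrite /word big_map enumT. Qed.

Lemma word_scale (a : L -> K) xs :
  word [seq a x *: x | x <- xs] = (\prod_(x <- xs) a x) *: word xs.
Proof.
elim: xs => [|x xs IH]; first by rewrite /word !big_nil scale1r.
rewrite /= !word_cons IH linearZ /= -scalerAl -scalerAr scalerA big_cons.
by [].
Qed.

Definition word_span : {pred U} := fun u => `[< lspan (range word) u >].

Lemma word_span_subalg : GRing.subalg_closed word_span.
Proof.
have sW : is_subspace (lspan (range word)) by exact: lspan_subspace.
split.
- by apply/asboolP; apply: lspan_gen; exists [::] => //; rewrite /word big_nil.
- by move=> a u v /asboolP Hu /asboolP Hv; apply/asboolP; apply: (proj2 sW).
- move=> u v /asboolP Hu /asboolP Hv; apply/asboolP.
  apply: (lspan_min (W := [set u | lspan (range word) (u * v)]) _ _ Hu).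
    split=> [|a x y] /=; first by rewrite mul0r; case: sW.
    by rewrite mulrDl -scalerAl; exact: (proj2 sW).
  move=> _ [xs _ <-].
  apply: (lspan_min (W := [set v | lspan (range word) (word xs * v)]) _ _ Hv).
    split=> [|a x y] /=; first by rewrite mulr0; case: sW.
    by rewrite mulrDr -scalerAr; exact: (proj2 sW).
  by move=> _ [ys _ <-] /=; rewrite -word_cat; apply: lspan_gen; exists (xs ++ ys).
Qed.

HB.instance Definition _ :=
  GRing.isSubalgClosed.Build K U word_span word_span_subalg.

Record word_subalgebra := WordSubalgebra {
  word_subalgebra_val :> U; _ : word_subalgebra_val \in word_span }.

HB.instance Definition _ := [isSub for word_subalgebra_val].
HB.instance Definition _ := [Choice of word_subalgebra by <:].
HB.instance Definition _ := [SubChoice_isSubAlgebra of word_subalgebra by <:].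

(** The words span a subalgebra that factors the universal map, and the
    resulting endomorphism of [U] must be the identity. *)
Lemma enveloping_spanned (br : L -> L -> L) (u : U) :
  enveloping_algebra br sigma -> lspan (range word) u.
Proof.
move=> [sbr univ].
have sS x : sigma x \in word_span.
  apply/asboolP; apply: lspan_gen; exists [:: x] => //.
  by rewrite /word big_seq1.
pose s x : word_subalgebra := WordSubalgebra (sS x).
have ls : linear s.
  by move=> a x y; apply: val_inj; rewrite /= linearP.
pose S : {linear L -> word_subalgebra} :=
  HB.pack s (GRing.isLinear.Build K L word_subalgebra *:%R s ls).
have [|phi [phiS _]] := univ word_subalgebra S.
  by move=> x y; apply: val_inj; rewrite /= sbr.
have [theta [_ uni]] := univ U sigma sbr.
pose f (w : U) : U := word_subalgebra_val (phi w).
have lf : linear f by move=> a x y; rewrite /f linearP.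
have mf : GRing.monoid_morphism f.
  by split; [rewrite /f rmorph1|move=> x y; rewrite /f rmorphM].
pose psi : {lrmorphism U -> U} := HB.pack f
  (GRing.isLinear.Build K U U *:%R f lf) (GRing.isMonoidMorphism.Build U U f mf).
pose idU : {lrmorphism U -> U} := idfun.
have psiS x : psi (sigma x) = sigma x.
  by rewrite -[LHS]/(word_subalgebra_val (phi (sigma x))) phiS.
have : idU u = psi u by rewrite (uni idU) // (uni psi psiS).
rewrite -[idU u]/u -[psi u]/(word_subalgebra_val (phi u)) => ->.
by case: (phi u) => w /= /asboolP.
Qed.

End EnvelopingWords.

Section WordBounds.
Context {R : realType} {g : normedModType R[i]} {U : algType R[i]}
        (sigma : {linear g -> U}) {E : normedModType R[i]}.
Local Notation K := (R[i]).
Local Notation homc := (homc sigma E).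
Implicit Types (b c : homc) (xs : seq g).

Local Notation word := (word sigma).

Lemma homcD b c D : (b + c) D = b D + c D. Proof. by []. Qed.
Lemma homcB b c D : (b - c) D = b D - c D. Proof. by []. Qed.
Lemma homcZ a b D : (a *: b) D = a *: b D. Proof. by []. Qed.
Lemma homc0 D : (0 : homc) D = 0. Proof. by []. Qed.
Lemma homc_sum I (r : seq I) (P : pred I) (f : I -> homc) D :
  (\sum_(i <- r | P i) f i) D = \sum_(i <- r | P i) f i D.
Proof. by elim/big_rec2 : _ => [|i u v _ <-]; rewrite ?homc0. Qed.

Lemma homc_ext b c : (forall D, b D = c D) -> b = c.
Proof. by move=> bc; apply: val_inj; apply/funext. Qed.

Lemma homc_act_linear x : linear (@homc_act _ _ _ sigma E x).
Proof.
by move=> a b c; apply: homc_ext => D; rewrite /= opprD scalerN.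
Qed.

Lemma homc_act_linearl b : linear (fun x => homc_act x b).
Proof.
move=> a x y; apply: homc_ext => D /=.
rewrite linearP mulrDl -scalerAl homc_linear opprD.
by rewrite -scalerN.
Qed.

Lemma seminorm_word1 b xs : (forall x, x \in xs -> rnorm x <= 1) ->
  rnorm (b (word xs)) <= seminorm (size xs) b.
Proof.
move=> x1; rewrite /word big_tnth.
apply: (seminorm_ub b (x := tnth (in_tuple xs))) => i.
by apply: x1; exact: mem_tnth.
Qed.

Lemma seminorm_ge0 n b : 0 <= seminorm n b.
Proof.
apply: le_trans (seminorm_ub b (x := fun _ : 'I_n => 0) _); first exact: rnorm_ge0.
by move=> i; rewrite rnorm0.
Qed.

Lemma cabsM (a a' : K) : cabs (a * a') = cabs a * cabs a'.
Proof. by apply: complexI; rewrite rmorphM /= !cabsE normrM. Qed.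

Lemma cabs_prod (f : g -> K) xs :
  cabs (\prod_(x <- xs) f x) = \prod_(x <- xs) cabs (f x).
Proof.
elim: xs => [|x xs IH]; first by rewrite !big_nil (cabs_real (a := 1)).
by rewrite !big_cons cabsM IH.
Qed.

(** The defining bound of the seminorm, on vectors of norm at most one, extended
    by homogeneity in each letter. *)
Lemma seminorm_word b xs :
  rnorm (b (word xs)) <= seminorm (size xs) b * \prod_(x <- xs) rnorm x.
Proof.
have [x0|x0] := boolP (0 \in xs).
  rewrite (_ : word xs = 0); last first.
    case/splitPr: x0 => s1 s2; rewrite word_cat word_cons linear0 mul0r mulr0.
    by [].
  rewrite (lin0 (homc_linear b)) rnorm0 mulr_ge0 ?seminorm_ge0 //.
  by apply: prodr_ge0 => x _; exact: rnorm_ge0.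
pose a (x : g) : K := ((rnorm x)^-1)%:C.
have xpos x : x \in xs -> 0 < rnorm x.
  by move=> xx; apply: rnorm_gt0; apply: contraNneq x0 => <-.
have : rnorm (b (word [seq a x *: x | x <- xs])) <= seminorm (size xs) b.
  rewrite -(size_map (fun x => a x *: x) xs); apply: seminorm_word1 => _ /mapP[x xx ->].
  by rewrite rnormZ cabs_real ?invr_ge0 ?rnorm_ge0 // mulVf // gt_eqF // xpos.
rewrite word_scale (linZ (homc_linear b)) rnormZ cabs_prod.
under eq_bigr do rewrite cabs_real ?invr_ge0 ?rnorm_ge0 //.
rewrite prodfV mulrC ler_pdivrMr //.
by rewrite big_seq; apply: prodr_gt0.
Qed.

Lemma seminorm_le n b (C : R) :
  (forall xs, size xs = n -> (forall x, x \in xs -> rnorm x <= 1) ->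
     rnorm (b (word xs)) <= C) -> seminorm n b <= C.
Proof.
move=> bC; apply: ge_sup; first by have [] := seminorm_has_sup n b.
move=> _ [x x1 <-]; rewrite /word_map.
rewrite word_ord.
apply: bC; first by rewrite size_map size_enum_ord.
by move=> _ /mapP[i _ ->]; exact: x1.
Qed.

Lemma prod_rnorm_le1 xs : (forall x, x \in xs -> rnorm x <= 1) ->
  \prod_(x <- xs) rnorm x <= 1.
Proof.
elim: xs => [|x xs IH] x1; first by rewrite big_nil.
rewrite big_cons mulr_ile1 ?rnorm_ge0 ?x1 ?mem_head //.
  by apply: prodr_ge0 => y _; exact: rnorm_ge0.
by apply: IH => y yx; apply: x1; rewrite inE yx orbT.
Qed.

Lemma prod_rnorm_ge0 xs : 0 <= \prod_(x <- xs) rnorm x.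
Proof. by apply: prodr_ge0 => x _; exact: rnorm_ge0. Qed.

Lemma seminormD n b c : seminorm n (b + c) <= seminorm n b + seminorm n c.
Proof.
by have := seminormB n (- c) b 0; rewrite !opprK !subr0 add0r.
Qed.

Lemma seminorm_scale_le n a b : seminorm n (a *: b) <= cabs a * seminorm n b.
Proof.
apply: seminorm_le => xs sx x1; rewrite homcZ rnormZ ler_wpM2l ?cabs_ge0 //.
by rewrite -sx; exact: seminorm_word1.
Qed.

Lemma seminormZ n a b : seminorm n (a *: b) = cabs a * seminorm n b.
Proof.
apply/eqP; rewrite eq_le seminorm_scale_le /=.
have [->|a0] := eqVneq a 0.
  by rewrite /cabs normr0 mul0r seminorm_ge0.
have ca : 0 < cabs a by rewrite -ltcR cabsE normr_gt0.
rewrite -[X in cabs a * seminorm n X](scale1r b) -(mulVf a0) -scalerA.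
apply: (le_trans (ler_wpM2l (ltW ca) (seminorm_scale_le n a^-1 (a *: b)))).
by rewrite mulrA -cabsM divff // cabs_real ?mul1r.
Qed.

(** The letter [x] is put in front of the word, which raises the degree by one. *)
Lemma seminorm_act n x b : seminorm n (homc_act x b) <= rnorm x * seminorm n.+1 b.
Proof.
apply: seminorm_le => xs sx x1 /=; rewrite rnormN -word_cons.
apply: (le_trans (seminorm_word b (x :: xs))); rewrite /= sx big_cons mulrC.
rewrite -mulrA ler_wpM2l ?rnorm_ge0 // ler_piMl ?seminorm_ge0 //.
exact: prod_rnorm_le1.
Qed.

End WordBounds.

(** * The space of continuous homomorphisms *)

Lemma lie_action_comp {K : fieldType} {L L' W : lmodType K} (br : L -> L -> L)
    (br' : L' -> L' -> L') (f : L' -> L) (act : L -> W -> W) :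
  linear f -> (forall x y, f (br' x y) = br (f x) (f y)) ->
  lie_action br act -> lie_action br' (fun y w => act (f y) w).
Proof.
move=> lf fbr actP; split=> [w a x y|y|x y w].
- by rewrite lf (act_linl actP).
- exact: (act_linr actP).
- by rewrite fbr (act_br actP).
Qed.

Section HomTopology.
Context {R : realType} {g : normedModType R[i]} {U : algType R[i]}
        {sigma : {linear g -> U}} {E : completeNormedModType R[i]}.
Local Notation K := (R[i]).
Local Notation homc := (homc sigma E).
Local Notation word := (word sigma).

Lemma homc_lie_action (br : g -> g -> g) :
  (forall x y, sigma (br x y) = sigma x * sigma y - sigma y * sigma x) ->
  lie_action br (fun x (b : homc) => homc_act x b).
Proof.
move=> sbr; split=> [b|x|x y b].
- exact: homc_act_linearl.
- exact: homc_act_linear.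
- apply: homc_ext => D; rewrite homcB /= sbr !opprK !mulrA mulrBl.
  by rewrite (linB (homc_linear b)) opprB.
Qed.

Lemma rnorm_nbhs {V : normedModType K} (x : V) (d : R) : 0 < d ->
  nbhs x [set y | rnorm (y - x) < d].
Proof.
move=> d0; apply/nbhs_ballP; exists d%:C; first by rewrite /= ltcR.
by move=> y; rewrite -ball_normE /= rnorm_ltE distrC.
Qed.

Lemma nbhs_rnorm {V : normedModType K} (x : V) (A : set V) : nbhs x A ->
  exists2 d : R, 0 < d & forall y, rnorm (y - x) < d -> A y.
Proof.
move=> /nbhs_ballP[e /= e0 eA]; exists (complex.Re e).
  by move: e0; rewrite ltcE => /andP[].
move=> y yd; apply: eA; rewrite -ball_normE /= distrC -rnormE.
have /RRe_real <- : e \is Num.real by exact: gtr0_real.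
by rewrite ltcR.
Qed.

Lemma homc_act_continuous : continuous (fun z : g * homc => homc_act z.1 z.2).
Proof.
move=> [x b] A /= [n [e [e0 eA]]].
pose M := \sum_(k < n.+2) seminorm k b + 1.
have M0 : 0 < M by rewrite ltr_pwDr // sumr_ge0 // => i _; exact: seminorm_ge0.
have bM k : (k <= n.+1)%N -> seminorm k b + 1 <= M.
  move=> kn; rewrite lerD2r.
  have kn2 : (k < n.+2)%N by [].
  by rewrite (bigD1 (Ordinal kn2)) //= lerDl sumr_ge0 // => i _; exact: seminorm_ge0.
have x0 : 0 < rnorm x + 1 by rewrite ltr_pwDr // rnorm_ge0.
pose eta := Num.min 1 (e / 2 / (rnorm x + 1)).
have eta0 : 0 < eta by rewrite lt_min ltr01 !divr_gt0.
exists ([set y | rnorm (y - x) < e / 2 / M],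
  [set c | forall k, (k <= n.+1)%N -> seminorm k (c - b) < eta]).
  split; first by apply: rnorm_nbhs; rewrite !divr_gt0.
  by exists n.+1, eta.
move=> [y c] /= [yx cb]; apply: eA => k kn.
have -> : homc_act y c - homc_act x b = homc_act (y - x) c + homc_act x (c - b).
  rewrite (linB (homc_act_linearl c)) (linB (homc_act_linear x)).
  by rewrite addrA subrK.
apply: (le_lt_trans (seminormD _ _ _)); rewrite (splitr e); apply: ltr_leD.
  apply: (le_lt_trans (seminorm_act _ _ _)).
  have cM : seminorm k.+1 c <= M.
    have -> : c = b + (c - b) by rewrite addrC subrK.
    apply: (le_trans (seminormD _ _ _)); apply: (le_trans _ (bM k.+1 kn)).
    rewrite lerD2l; apply: ltW; apply: (lt_le_trans (cb _ _)) => //.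
    by rewrite ge_min lexx.
  apply: (le_lt_trans (ler_wpM2l (rnorm_ge0 _) cM)).
  by rewrite -ltr_pdivlMr.
apply: (le_trans (seminorm_act _ _ _)).
have cb' : seminorm k.+1 (c - b) <= e / 2 / (rnorm x + 1).
  apply: ltW; apply: (lt_le_trans (cb _ _)) => //.
  by rewrite ge_min lexx orbT.
apply: (le_trans (ler_wpM2l (rnorm_ge0 _) cb')).
rewrite mulrA ler_pdivrMr // mulrC ler_wpM2l ?lerDl //.
by rewrite ltW // divr_gt0.
Qed.

Definition rnorm_cvg {V : normedModType K} (s : nat -> V) (l : V) : Prop :=
  forall e : R, 0 < e -> exists n0, forall n, (n0 <= n)%N -> rnorm (s n - l) < e.

Lemma rnorm_cvg_unique {V : normedModType K} (s : nat -> V) l l' :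
  rnorm_cvg s l -> rnorm_cvg s l' -> l = l'.
Proof.
move=> sl sl'; apply/eqP; rewrite -subr_eq0; apply: contraT => /rnorm_gt0 d0.
have d2 : 0 < rnorm (l - l') / 2 by rewrite divr_gt0.
have [n1 H1] := sl _ d2; have [n2 H2] := sl' _ d2.
have := H1 (maxn n1 n2) (leq_maxl _ _); have := H2 (maxn n1 n2) (leq_maxr _ _).
move: (s _) => z zl' zl.
suff : rnorm (l - l') < rnorm (l - l') by rewrite ltxx.
rewrite [ltRHS](splitr (rnorm (l - l'))).
have -> : l - l' = - (z - l) + (z - l') by rewrite opprB addrA subrK.
by apply: (le_lt_trans (ler_rnormD _ _)); rewrite rnormN ltrD // opprB addrA subrK.
Qed.

Lemma rnorm_cvg_lincomb {V : normedModType K} (s t : nat -> V) l m (a : K) :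
  rnorm_cvg s l -> rnorm_cvg t m -> rnorm_cvg (fun n => a *: s n + t n) (a *: l + m).
Proof.
move=> sl tm e e0.
have ca : 0 < cabs a + 1 by rewrite ltr_pwDr // cabs_ge0.
have [n1 H1] := sl (e / 2 / (cabs a + 1)) ltac:(by rewrite !divr_gt0).
have [n2 H2] := tm (e / 2) ltac:(by rewrite !divr_gt0).
exists (maxn n1 n2) => n; rewrite geq_max => /andP[/H1 h1 /H2 h2].
rewrite opprD addrACA -scalerBr; apply: (le_lt_trans (ler_rnormD _ _)).
rewrite (splitr e); apply: ler_ltD => //; rewrite rnormZ.
apply: (le_trans (ler_wpM2l (cabs_ge0 _) (ltW h1))).
rewrite mulrA ler_pdivrMr // mulrC ler_wpM2l ?lerDl //.
by rewrite ltW // divr_gt0.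
Qed.

Lemma rnorm_cauchy_cvg {V : completeNormedModType K} (s : nat -> V) :
  (forall e : R, 0 < e -> exists n0, forall m n, (n0 <= m)%N -> (n0 <= n)%N ->
     rnorm (s m - s n) < e) -> exists l, rnorm_cvg s l.
Proof.
move=> sC.
have : cvg (s @ \oo).
  apply/cauchy_cvgP; apply: cauchy_exP => e e0.
  have re : 0 < complex.Re e by move: e0; rewrite ltcE => /andP[].
  have [n0 H] := sC _ re; exists (s n0); exists n0 => // n /= n0n.
  rewrite -ball_normE /= -rnormE.
  have /RRe_real <- : e \is Num.real by exact: gtr0_real.
  by rewrite ltcR; apply: H.
move=> /cvgrPdist_lt sl; exists (lim (s @ \oo)) => e e0.
have [|n0 _ H] := sl e%:C; first by rewrite ltcR.
by exists n0 => n /H; rewrite /= distrC -rnormE ltcR.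
Qed.

(** Evaluation at a word of length [k] is Cauchy as soon as [seminorm k] is, so
    a Cauchy sequence converges pointwise; the limit is continuous because the
    convergence on words of length [k] is uniform on bounded sets. *)
Lemma homc_complete (u : nat -> homc) : (forall D, lspan (range word) D) ->
  (forall k (e : R), 0 < e -> exists n0, forall m n, (n0 <= m)%N -> (n0 <= n)%N ->
     seminorm k (u m - u n) < e) ->
  exists b : homc, forall k (e : R), 0 < e -> exists n0, forall n, (n0 <= n)%N ->
     seminorm k (u n - b) <= e.
Proof.
move=> Usp uC.
have /boolp.choice[b bP] D : exists l, rnorm_cvg (fun n => u n D) l.
  apply: (lspan_min (W := [set D | exists l, rnorm_cvg (fun n => u n D) l]) _ _ (Usp D)).
    split.
      exists 0 => e e0; exists 0%N => n _; rewrite (lin0 (homc_linear (u n))) subrr.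
      by rewrite rnorm0.
    move=> a v w [l Hl] [m Hm]; exists (a *: l + m) => e e0.
    have [n0 H] := rnorm_cvg_lincomb a Hl Hm e0; exists n0 => n /H.
    by rewrite homc_linear.
  move=> _ [xs _ <-]; apply: rnorm_cauchy_cvg => e e0.
  pose P := \prod_(x <- xs) rnorm x + 1.
  have P0 : 0 < P by rewrite ltr_pwDr // prod_rnorm_ge0.
  have [n0 H] := uC (size xs) (e / P) ltac:(by rewrite divr_gt0).
  exists n0 => m n mn nn; rewrite -homcB.
  apply: (le_lt_trans (seminorm_word _ _)).
  apply: (@le_lt_trans _ _ (seminorm (size xs) (u m - u n) * P)).
    by rewrite ler_wpM2l ?seminorm_ge0 // lerDl.
  by rewrite -ltr_pdivlMr //; exact: H.
have bl : linear b.
  move=> a v w; apply: (rnorm_cvg_unique (bP _)) => e e0.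
  have [n0 H] := rnorm_cvg_lincomb a (bP v) (bP w) e0; exists n0 => n /H.
  by rewrite homc_linear.
have unif k (e : R) : 0 < e -> exists n0, forall n, (n0 <= n)%N ->
    forall xs, size xs = k ->
    rnorm (u n (word xs) - b (word xs)) <= e * \prod_(x <- xs) rnorm x.
  move=> e0; have [n0 H] := uC k e e0; exists n0 => n nn xs sx.
  apply/ler_addgt0Pr => d d0.
  have [n1 H1] := bP (word xs) d d0.
  set m := maxn n0 n1.
  have -> : u n (word xs) - b (word xs) =
      (u n - u m) (word xs) + (u m (word xs) - b (word xs)).
    by rewrite homcB addrA subrK.
  apply: (le_trans (ler_rnormD _ _)); apply: lerD.
    apply: (le_trans (seminorm_word _ _)); rewrite sx ler_wpM2r ?prod_rnorm_ge0 //.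
    by apply: ltW; apply: H => //; exact: leq_maxl.
  by apply: ltW; apply: H1; exact: leq_maxr.
have bc : b \in cont_hom sigma (E := E).
  apply/asboolP; split=> // k x A /nbhs_rnorm[e e0 eA].
  pose M := \prod_(i < k) (rnorm (x i) + 1) + 1.
  have M1 : 0 <= \prod_(i < k) (rnorm (x i) + 1).
    by apply: prodr_ge0 => i _; rewrite addr_ge0 ?rnorm_ge0.
  have M0 : 0 < M by rewrite ltr_pwDr.
  have [n0 /(_ n0 (leqnn _)) H] := unif k (e / 4 / M) ltac:(by rewrite !divr_gt0).
  have {}H (y : 'I_k -> g) : (forall i, rnorm (y i) <= rnorm (x i) + 1) ->
      rnorm (word_map sigma (u n0) y - word_map sigma b y) <= e / 4.
    move=> yx; rewrite /word_map word_ord.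
    apply: (le_trans (H _ _)); first by rewrite size_map size_enum_ord.
    rewrite mulrAC ler_pdivrMr // ler_wpM2l ?divr_ge0 ?(ltW e0) //.
    rewrite big_map enumT /M.
    have le : \prod_(i < k) rnorm (y i) <= \prod_(i < k) (rnorm (x i) + 1).
      by apply: ler_prod => i _; rewrite rnorm_ge0 yx.
    by apply: (le_trans le); rewrite lerDl.
  have N1 : \forall y \near x, forall i, rnorm (y i - x i) < 1.
    apply: (@filter_forall _ _ (fun i (y : {ptws 'I_k -> g}) => rnorm (y i - x i) < 1)
      (nbhs x) _) => i.
    exact: (@proj_continuous _ (fun=> g) i x _ (rnorm_nbhs (x i) ltr01)).
  have N2 : \forall y \near x, rnorm (word_map sigma (u n0) y - word_map sigma (u n0) x) < e / 4.
    have e4 : 0 < e / 4 by rewrite divr_gt0.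
    exact: (@homc_continuous _ _ _ sigma E (u n0) k x _
              (rnorm_nbhs (word_map sigma (u n0) x) e4)).
  suff sub : [set y : {ptws 'I_k -> g} | forall i, rnorm (y i - x i) < 1] `&`
      [set y | rnorm (word_map sigma (u n0) y - word_map sigma (u n0) x) < e / 4]
      `<=` word_map sigma b (n := k) @^-1` A.
    exact: (@filterS _ (nbhs x) _ _ _ sub (@filterI _ (nbhs x) _ _ _ N1 N2)).
  move=> y [y1 y2]; apply: eA.
  set bx := word_map sigma b x; set ux := word_map sigma (u n0) x in y2.
  have hx : rnorm (ux - bx) <= e / 4 by apply: H => i; rewrite lerDl.
  have hy : rnorm (word_map sigma (u n0) y - word_map sigma b y) <= e / 4.
    apply: H => i; rewrite -[y i](subrK (x i)) addrC.
    by apply: (le_trans (ler_rnormD _ _)); rewrite lerD2l ltW.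
  set uy := word_map sigma (u n0) y in y2 hy.
  change (rnorm (word_map sigma b y - bx) < e).
  set by_ := word_map sigma b y in hy *.
  have -> : by_ - bx = - (uy - by_) + ((uy - ux) + (ux - bx)).
    by rewrite opprB [uy - ux + _]addrA subrK addrA subrK.
  apply: (le_lt_trans (ler_rnormD _ _)); rewrite rnormN.
  have h3 := ler_rnormD (uy - ux) (ux - bx).
  have {}y2 : rnorm (uy - ux) < e / 4 by exact: y2.
  apply: (le_lt_trans (lerD hy h3)).
  move: (rnorm (uy - ux)) (rnorm (ux - bx)) y2 hx => r1 r2 y2 hx.
  lra.
exists (HomC bc) => k e e0; have [n0 H] := unif k e e0; exists n0 => n nn.
apply: seminorm_le => xs sx x1; rewrite homcB /=.
apply: (le_trans (H n nn xs sx)); apply: ler_piMr; first exact: ltW.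
exact: prod_rnorm_le1.
Qed.

End HomTopology.

(** * Straightening words along a parabolic subalgebra *)

Section ParabolicRepresentation.
Context {R : realType} {V : vectType R} {Delta : seq V}.
Local Notation K := (R[i]).
Context {gD : vectType K} {brD : gD -> gD -> gD} {h : {vspace gD}}.
Context {g : completeNormedModType K} {br : g -> g -> g} {iota : gD -> g}.
Hypothesis Hg : weakly_graded br brD h iota Delta.
Local Notation T := (subvs_of h).
Local Notation dual := (dual_space (T := T)).
Local Notation wt := (weight_space (ad_graded br iota (h := h))).

Context {xS : T}.
Hypothesis xSR : real_cartan brD xS.
Local Notation p := (weight_sum (ad_graded br iota (h := h))
  (0 |` parabolic_system br iota xS)).

Context {E : completeNormedModType K} {rho : g -> E -> E}.
Hypothesis Hrho : banach_rep br p rho.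

Context {U : algType K} {sigma : {linear g -> U}}.
Hypothesis HU : enveloping_algebra br sigma.
Local Notation homc := (homc sigma E).
Local Notation word := (word sigma).
Local Notation Vc := (hom_p p rho sigma : set homc).

Let brP : lie_bracket br. Proof. by case: Hg => _ []. Qed.

(** As weights take real values at $x_\Sigma$, these are the weights outside the
    parabolic system. *)
Definition negative (lam : dual) : Prop :=
  graded_weights br iota lam /\ (lam xS : K) < 0.

Lemma weight_dichotomy lam : (0 |` graded_weights br iota) lam ->
  (0 |` parabolic_system br iota xS) lam \/ negative lam.
Proof.
move=> [->|Hl]; first by left; left.
have [pos|npos] := boolP (0 <= (lam xS : K)); first by left; right.
right; split=> //; move: npos; rewrite -real_ltNge ?real0 //.
apply: (real_cartan_weight_real Hg xSR).
by case: Hl => _ [x Hx x0]; exists x.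
Qed.

Lemma parabolic_subset :
  0 |` parabolic_system br iota xS `<=` 0 |` graded_weights br iota (h := h).
Proof. by move=> lam [->|[Hl _]]; [left|right]. Qed.

Lemma parabolic_seq : exists2 s : seq dual, uniq s &
  0 |` parabolic_system br iota xS = [set` s].
Proof.
have [ws wsE wb] := graded_weight_basis Hg.
exists [seq lam <- ws | `[< (0 |` parabolic_system br iota xS) lam >]].
  by rewrite filter_uniq // (wb_uniq wb).
apply/seteqP; split=> lam /=; rewrite mem_filter.
  move=> Hl; apply/andP; split; first exact/asboolP.
  by have := parabolic_subset Hl; rewrite wsE.
by move=> /andP[/asboolP].
Qed.

Let lad t : linear (ad_graded br iota (h := h) t).
Proof. exact: (ad_graded_linear Hg). Qed.

Lemma weight_spaceS lam : is_subspace (wt lam).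
Proof. exact: (weight_space_subspace (graded_action Hg)). Qed.

Lemma parabolic_subspace : is_subspace p.
Proof.
have [s us sE] := parabolic_seq.
rewrite /weight_sum sE; split.
  exists (fun=> 0); first by move=> lam _; exact: (proj1 (weight_spaceS lam)).
  by rewrite -fsbig_seq // big1.
move=> a _ _ [f fw ->] [f' fw' ->]; exists (fun lam => a *: f lam + f' lam).
  by move=> lam ls; apply: (proj2 (weight_spaceS lam)); [exact: fw|exact: fw'].
by rewrite -!fsbig_seq // scaler_sumr -big_split.
Qed.

Lemma parabolic_weight lam x : (0 |` parabolic_system br iota xS) lam ->
  wt lam x -> p x.
Proof.
have [s us sE] := parabolic_seq.
rewrite /weight_sum sE => ls Hx.
exists (fun mu => if mu == lam then x else 0).
  move=> mu _; case: eqP => [->//|_]; exact: (proj1 (weight_spaceS mu)).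
rewrite -fsbig_seq // (bigD1_seq lam) //= eqxx big1 ?addr0 //.
by move=> mu /negPf ->.
Qed.

Lemma cartan_parabolic (t : T) : p (iota (vsval t)).
Proof. by apply: parabolic_weight (cartan_weight0 Hg t); left. Qed.

Lemma bracket_bound : exists2 M : R, 0 <= M &
  forall x y, rnorm (br x y) <= M * rnorm x * rnorm y.
Proof.
have [ll lr _ _] := brP; apply: continuous_bilinear_bound => //.
by case: Hg => _ [].
Qed.

Lemma rep_bound : exists2 M : R, 0 <= M &
  forall x v, p x -> rnorm (rho x v) <= M * rnorm x * rnorm v.
Proof.
have [bd rl _ cont] := Hrho; have [p0 pcl] := parabolic_subspace.
have rho0 v : rho 0 v = 0.
  by have := rl 1 0 0 v p0 p0; rewrite !scale1r addr0 => /eqP; rewrite eq_sym -subr_eq0 addrK => /eqP.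
have rhoZ (a : K) x v : p x -> rho (a *: x) v = a *: rho x v.
  by move=> px; rewrite -[a *: x]addr0 rl // rho0 addr0.
have [d d0 dP] := cont 0 p0 1 ltr01.
have le1 x v : p x -> rnorm x < d -> rnorm v < 1 -> rnorm (rho x v) <= 1.
  move=> px xd v1; have := dP x px; rewrite subr0 => /(_ xd) /ltW; apply: le_trans.
  rewrite /opnorm -[rho x v]subr0 -(rho0 v); apply: ub_le_sup; last by exists v => //=; exact: ltW.
  have [lf cf] := bd x px; have [M M0 MP] := continuous_linear_bound lf cf.
  exists M => _ [w /= w1 <-]; rewrite rho0 subr0.
  by apply: (le_trans (MP w)); rewrite ler_piMr.
have le2 x v : p x -> rnorm x < d -> rnorm (rho x v) <= 2 * 1 / 1 * rnorm v.
  move=> px xd; have [lf cf] := bd x px.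
  apply: (homogeneous_bound (P := setT) (N := fun v => rnorm (rho x v))) => //.
  - by rewrite (lin0 lf) rnorm0.
  - by move=> a u _ a0; rewrite (linZ lf) rnormZ cabs_real // ltW.
  - by move=> u _; exact: le1.
exists (2 * (2 * 1 / 1) / d); first by rewrite !(divr_ge0, mulr_ge0) // ltW.
move=> x v px.
have -> : 2 * (2 * 1 / 1) / d * rnorm x * rnorm v = 2 * (2 * 1 / 1 * rnorm v) / d * rnorm x.
  by move: (rnorm x) (rnorm v) => r s; field; rewrite gt_eqF.
apply: (homogeneous_bound (P := p) (N := fun x => rnorm (rho x v))) => //.
- by rewrite rho0 rnorm0.
- move=> a u pu a0; rewrite rhoZ // rnormZ cabs_real ?ltW //; split=> //.
  exact: (subspZ _ parabolic_subspace).
- by move=> u pu ud; exact: le2.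
Qed.

Lemma weight_component_bound (ws : seq dual) lam : uniq ws -> lam \in ws ->
  exists2 C : R, 0 <= C & forall f : dual -> g,
    (forall mu, mu \in ws -> wt mu (f mu)) ->
    rnorm (f lam) <= C * rnorm (\sum_(mu <- ws) f mu).
Proof.
move=> us ls; have [l lP] := weight_projection lad us ls.
suff [C C0 CP] : exists2 C : R, 0 <= C & forall x,
    rnorm (foldl (shift_step (act := ad_graded br iota (h := h))) x l) <= C * rnorm x.
  by exists C => // f fw; rewrite (lP f fw).
elim: l {lP} => [|q l [C C0 IH]] /=; first by exists 1 => // x; rewrite mul1r.
have [M M0 MP] := bracket_bound.
pose D := cabs q.1.1 * (M * rnorm (iota (vsval q.2)) + cabs q.1.2).
have D0 : 0 <= D by rewrite mulr_ge0 ?cabs_ge0 // addr_ge0 ?cabs_ge0 // mulr_ge0 ?rnorm_ge0.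
exists (C * D); first exact: mulr_ge0.
move=> x; apply: (le_trans (IH _)); rewrite -mulrA ler_wpM2l //.
rewrite /shift_step rnormZ /D -mulrA ler_wpM2l ?cabs_ge0 //.
apply: (le_trans (ler_rnormD _ _)); rewrite rnormN rnormZ mulrDl lerD2r.
exact: MP.
Qed.

Definition neg_word (A : seq g) : Prop :=
  forall a, a \in A -> exists2 lam, negative lam & wt lam a.

Definition vanishes_at (m : nat) (b : homc) : Prop :=
  forall A, neg_word A -> size A = m -> b (word A) = 0.

Lemma sigma_br x y : sigma x * sigma y = sigma (br x y) + sigma y * sigma x.
Proof. by rewrite (proj1 HU) subrK. Qed.

(** Moving a letter of $\mathfrak p$ to the end of the word costs commutators,
    which are shorter words; at the end it is absorbed by equivariance. *)
Lemma parabolic_letter_bound n : exists2 C : R, 0 <= C &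
  forall b : homc, Vc b -> forall X y A, p y -> (size X + size A)%N = n ->
    rnorm (b (word (X ++ y :: A))) <=
      C * seminorm n b * (rnorm y * (\prod_(x <- X) rnorm x * \prod_(a <- A) rnorm a)).
Proof.
have [M M0 MP] := bracket_bound; have [L L0 LP] := rep_bound.
exists (L + n%:R * M); first by rewrite addr_ge0 // mulr_ge0.
move=> b Hb X y A py sXA.
suff : rnorm (b (word (X ++ y :: A))) <= (L + (size A)%:R * M) * seminorm n b *
    (rnorm y * (\prod_(x <- X) rnorm x * \prod_(a <- A) rnorm a)).
  move=> /le_trans; apply.
  rewrite ler_wpM2r ?mulr_ge0 ?rnorm_ge0 ?prod_rnorm_ge0 //.
  rewrite ler_wpM2r ?seminorm_ge0 // lerD2l ler_wpM2r // ler_nat -sXA.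
  exact: leq_addl.
elim: A X sXA => [|a A IH] X sXA.
  rewrite cats1 word_rcons (Hb _ _ py) rnormN big_nil mulr1 mul0r addr0.
  apply: (le_trans (LP _ _ py)); rewrite -!mulrA ler_wpM2l // mulrCA.
  rewrite ler_wpM2l ?rnorm_ge0 //; move: sXA; rewrite addn0 => <-.
  exact: seminorm_word.
have -> : word (X ++ y :: a :: A) =
    word (X ++ br y a :: A) + word (rcons X a ++ y :: A).
  rewrite cat_rcons !word_cat !word_cons -mulrDr; congr (_ * _).
  by rewrite mulrA sigma_br mulrDl -mulrA.
rewrite (linD (homc_linear b)); apply: (le_trans (ler_rnormD _ _)).
have sX' : (size (rcons X a) + size A)%N = n by rewrite size_rcons -sXA /= addSnnS.
have := IH _ sX'; rewrite -cats1 big_cat big_seq1 big_cons /= => H2.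
have H1 := seminorm_word b (X ++ br y a :: A).
rewrite size_cat /= in H1.
have sX : (size X + (size A).+1)%N = n by rewrite -sXA.
rewrite sX big_cat big_cons /= in H1.
apply: (le_trans (lerD H1 H2)).
set PX := \prod_(x <- X) _; set PA := \prod_(x <- A) _.
have PX0 : 0 <= PX by exact: prod_rnorm_ge0.
have PA0 : 0 <= PA by exact: prod_rnorm_ge0.
have s0 := seminorm_ge0 n b.
have : seminorm n b * (PX * (rnorm (br y a) * PA)) <=
    seminorm n b * (PX * (M * rnorm y * rnorm a * PA)).
  by rewrite !(ler_wpM2l, ler_wpM2r).
move=> H3; apply: (le_trans (lerD H3 (lexx _))).
rewrite le_eqVlt; apply/orP; left; apply/eqP.
rewrite -natr1; ring.
Qed.

(** The letters of [X] are treated from the right.  Negative weight components of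
    the last letter join the tail [A]; the other components lie in $\mathfrak p$ and
    are moved to the end. *)
Lemma straightening_bound n j : exists2 C : R, 0 <= C &
  forall b : homc, Vc b -> vanishes_at n.+1 b -> forall X A,
    size X = j -> (size X + size A)%N = n.+1 -> neg_word A ->
    rnorm (b (word (X ++ A))) <=
      C * seminorm n b * (\prod_(x <- X) rnorm x * \prod_(a <- A) rnorm a).
Proof.
have [ws wsE wb] := graded_weight_basis Hg.
have [Cp Cp0 CpP] := parabolic_letter_bound n.
have /boolp.choice[Cw CwP] lam : exists C : R, 0 <= C /\ (lam \in ws ->
    forall f : dual -> g, (forall mu, mu \in ws -> wt mu (f mu)) ->
    rnorm (f lam) <= C * rnorm (\sum_(mu <- ws) f mu)).
  have [ls|_] := boolP (lam \in ws); last by exists 0.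
  by have [C C0 CP] := weight_component_bound (wb_uniq wb) ls; exists C.
elim: j => [|j [C C0 IH]].
  exists 0 => // b _ van [|//] A _ /= sA nA.
  by rewrite van // rnorm0 mul0r mul0r.
exists ((C + Cp) * \sum_(lam <- ws) Cw lam).
  by rewrite mulr_ge0 ?addr_ge0 // sumr_ge0 // => lam _; case: (CwP lam).
move=> b Hb van X A; case/lastP: X => [//|X x]; rewrite size_rcons => -[sX] sXA nA.
have [f fw xE] := wb_decomp wb x.
have -> : word (rcons X x ++ A) = \sum_(lam <- ws) word (X ++ f lam :: A).
  rewrite cat_rcons word_cat word_cons {1}xE linear_sum mulr_suml mulr_sumr.
  by apply: eq_bigr => lam _; rewrite word_cat word_cons.
rewrite (lin_sum (homc_linear b)); apply: (le_trans (rnorm_sum _ _)).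
rewrite big_rcons /=.
set PX := \prod_(y <- X) _; set PA := \prod_(a <- A) _.
have PX0 : 0 <= PX by exact: prod_rnorm_ge0.
have PA0 : 0 <= PA by exact: prod_rnorm_ge0.
have s0 := seminorm_ge0 n b.
have -> : (C + Cp) * (\sum_(lam <- ws) Cw lam) * seminorm n b * (PX * rnorm x * PA) =
    \sum_(lam <- ws) (C + Cp) * seminorm n b * (PX * (Cw lam * rnorm x) * PA).
  rewrite -mulr_sumr -mulr_suml -mulr_sumr -mulr_suml; ring.
rewrite !big_seq; apply: ler_sum => lam ls.
have [Cl0 Cl] := CwP lam.
have fl : rnorm (f lam) <= Cw lam * rnorm x by rewrite xE; exact: Cl.
have step : rnorm (b (word (X ++ f lam :: A))) <=
    (C + Cp) * seminorm n b * (PX * rnorm (f lam) * PA).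
  have [Hl|Hl] : (0 |` parabolic_system br iota xS) lam \/ negative lam.
    by apply: weight_dichotomy; rewrite wsE.
    have pf := parabolic_weight Hl (fw _ ls).
    have sn : (size X + size A)%N = n by move: sXA; rewrite addSn => -[].
    apply: (le_trans (CpP b Hb X _ A pf sn)).
    have -> : rnorm (f lam) * (PX * PA) = PX * rnorm (f lam) * PA by ring.
    rewrite ler_wpM2r ?mulr_ge0 ?rnorm_ge0 // ler_wpM2r //.
    by rewrite lerDr.
  have sn : (size X + size (f lam :: A))%N = n.+1 by move: sXA; rewrite addSnnS.
  have nA' : neg_word (f lam :: A).
    move=> a; rewrite inE => /orP[/eqP ->|/nA//].
    by exists lam => //; exact: fw.
  apply: (le_trans (IH b Hb van X _ sX sn nA')); rewrite big_cons -/PX -/PA (mulrA PX).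
  rewrite ler_wpM2r ?mulr_ge0 ?rnorm_ge0 // ler_wpM2r //.
  by rewrite lerDl.
apply: (le_trans step); rewrite ler_wpM2l ?mulr_ge0 ?addr_ge0 //.
by rewrite ler_wpM2r // ler_wpM2l.
Qed.

(** Once negative words of some length are killed, the corresponding seminorm is
    dominated by the preceding one; this is what makes finitely many seminorms
    sufficient. *)
Lemma seminorm_step n : exists2 C : R, 0 <= C & forall b : homc, Vc b ->
  vanishes_at n.+1 b -> seminorm n.+1 b <= C * seminorm n b.
Proof.
have [C C0 CP] := straightening_bound n n.+1; exists C => // b Hb van.
apply: seminorm_le => xs sx x1.
have nil : neg_word [::] by [].
have := CP b Hb van xs [::] sx _ nil; rewrite cats0 big_nil mulr1 addn0 => /(_ sx).
move=> /le_trans; apply; rewrite ler_piMr ?mulr_ge0 ?seminorm_ge0 //.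
exact: prod_rnorm_le1.
Qed.

Lemma homc_eq0 (b : homc) : (forall n, seminorm n b = 0) -> b = 0.
Proof.
move=> s0; apply: homc_ext => D; rewrite homc0.
apply: (lspan_min (W := [set D | b D = 0]) _ _ (enveloping_spanned D HU)).
  split=> [|a u v] /=; first by rewrite (lin0 (homc_linear b)).
  by move=> u0 v0; rewrite homc_linear u0 v0 scaler0 addr0.
move=> _ [xs _ <-] /=; apply: rnorm0_eq0; apply/eqP.
rewrite eq_le rnorm_ge0 andbT; apply: (le_trans (seminorm_word b xs)).
by rewrite s0 mul0r.
Qed.

(** Poincaré-Birkhoff-Witt in the form $U(\mathfrak g)=U(\mathfrak n)U(\mathfrak p)$,
    obtained from the estimate of consecutive seminorms. *)
Lemma vanishing_eq0 (b : homc) : Vc b -> (forall m, vanishes_at m b) -> b = 0.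
Proof.
move=> Hb van; apply: homc_eq0; elim=> [|n IH].
  apply/eqP; rewrite eq_le seminorm_ge0 andbT; apply: seminorm_le => [[|//]] _ _.
  by rewrite (van 0%N [::]) // rnorm0.
apply/eqP; rewrite eq_le seminorm_ge0 andbT.
have [C _ CP] := seminorm_step n.
by apply: (le_trans (CP b Hb (van _))); rewrite IH mulr0.
Qed.

(** * Weights of the representation and of the module *)

Context {es : seq dual}.
Definition cartan_rep (t : T) (v : E) : E := rho (iota (vsval t)) v.
Local Notation actE := cartan_rep.
Local Notation wtE := (weight_space actE).
Hypothesis esP : weight_basis (act := actE) es.
Definition gD_act (y : gD) (b : homc) : homc := homc_act (iota y) b.
Local Notation act := gD_act.
Local Notation wtV := (weight_space (fun t : T => act (vsval t))).

Let liota : linear iota. Proof. by case: Hg => _ _ _ []. Qed.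

Lemma actE_linear t : linear (actE t).
Proof. by have [bd _ _ _] := Hrho; have [] := bd _ (cartan_parabolic t). Qed.

Lemma hom_act : lie_action brD act.
Proof.
apply: (lie_action_comp liota); last exact: (homc_lie_action (proj1 HU)).
by case: Hg => _ _ _ [].
Qed.

Lemma act_linear y : linear (act y).
Proof. exact: (act_linr hom_act). Qed.

Lemma rep_linear_at x : p x -> linear (rho x).
Proof. by have [bd _ _ _] := Hrho => px; have [] := bd _ px. Qed.

Lemma hom_p_subspace : is_subspace Vc.
Proof.
split=> [x D px|a u v Hu Hv x D px].
  by rewrite !homc0 (lin0 (rep_linear_at px)) oppr0.
rewrite !homcD !homcZ Hu // Hv // (linD (rep_linear_at px)) (linZ (rep_linear_at px)).
by rewrite opprD scalerN.
Qed.

Lemma hom_p_act x (b : homc) : Vc b -> Vc (homc_act x b).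
Proof.
move=> Hb y D py /=; rewrite mulrA Hb //.
by rewrite (linN (rep_linear_at py)).
Qed.

Fixpoint neg_sums (n : nat) : set dual :=
  if n is n'.+1 then [set lam | exists mu nu, [/\ negative mu, neg_sums n' nu & lam = mu + nu]]
  else [set 0].

Lemma neg_word_weight A : neg_word A -> exists2 ga, neg_sums (size A) ga &
  forall t : T, sigma (iota (vsval t)) * word A =
    word A * sigma (iota (vsval t)) + (ga t : K) *: word A.
Proof.
elim: A => [|a A IH] nA.
  exists 0 => // t; rewrite word_nil mulr1 mul1r zero_lfunE scale0r.
  by rewrite addr0.
have [|ga Hga gaP] := IH.
  by move=> x xA; apply: nA; rewrite inE xA orbT.
have [lam nl Hl] := nA a (mem_head a A).
exists (lam + ga); first by exists lam, ga.
move=> t; rewrite word_cons mulrA sigma_br mulrDl -!mulrA gaP.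
rewrite -/(ad_graded br iota t a) Hl linearZ /= -scalerAl mulrDr -scalerAr.
by rewrite add_lfunE scalerDl addrC -addrA; congr (_ + _); rewrite addrC.
Qed.

(** Move [t] through the word, then use equivariance. *)
Lemma act_at_neg_word (b : homc) A ga t : Vc b ->
  (forall t : T, sigma (iota (vsval t)) * word A =
    word A * sigma (iota (vsval t)) + (ga t : K) *: word A) ->
  act (vsval t) b (word A) = actE t (b (word A)) - (ga t : K) *: b (word A).
Proof.
move=> Hb gaP /=; rewrite gaP (linD (homc_linear b)) (linZ (homc_linear b)).
by rewrite Hb ?opprD ?opprK //; exact: cartan_parabolic.
Qed.

Section AtNegWord.
Context (A : seq g) (ga : dual) (t : T).
Hypothesis gaP : forall t : T, sigma (iota (vsval t)) * word A =
    word A * sigma (iota (vsval t)) + (ga t : K) *: word A.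

Definition shifted_act (e : E) : E := actE t e - (ga t : K) *: e.

Lemma shifted_act_linear : linear shifted_act.
Proof.
move=> a u v; rewrite /shifted_act (linD (actE_linear t)) (linZ (actE_linear t)).
rewrite (scalerDr (ga t : K)) opprD addrACA scalerBr !scalerA.
by rewrite (mulrC a).
Qed.

Lemma prod_shift_at (b : homc) as_ : Vc b ->
  prod_shift (act (vsval t)) as_ b (word A) = prod_shift shifted_act as_ (b (word A)).
Proof.
move=> Hb; elim: as_ => [//|a s IH].
rewrite [prod_shift _ (a :: s) b]/= homcB homcZ IH [RHS]/= -IH.
rewrite /shifted_act -(act_at_neg_word t _ gaP) //.
apply: (prod_shift_stable _ hom_p_subspace) => // w.
exact: hom_p_act.
Qed.

Lemma iter_act_at (b : homc) n : Vc b ->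
  iter n (act (vsval t)) b (word A) = iter n shifted_act (b (word A)).
Proof.
move=> Hb; elim: n => [//|n IH].
rewrite !iterS -IH /shifted_act -(act_at_neg_word t _ gaP) //.
by elim: n {IH} => [//|n IHn]; rewrite iterS; exact: hom_p_act.
Qed.

Lemma shifted_act_eigen mu e : wtE mu e ->
  shifted_act e = ((mu t : K) - ga t) *: e.
Proof. by move=> He; rewrite /shifted_act (He t) scalerBl. Qed.

End AtNegWord.

Lemma poly_root_seq (q : {poly K}) : q != 0 ->
  exists2 s : seq K, uniq s & forall c, q.[c] = 0 -> c \in s.
Proof.
move=> q0; have [r rE] := closed_field_poly_normal q.
exists (undup r); first exact: undup_uniq.
move=> c qc; rewrite mem_undup -root_prod_XsubC.
have : root q c by apply/eqP.
by rewrite rE rootZ ?lead_coef_eq0.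
Qed.

(** An element of the Cartan subalgebra satisfies some polynomial equation on a
    finite-dimensional submodule.  Evaluated at words in negative root
    vectors, the equation is about the diagonalizable action on [E], so the
    polynomial may be taken without multiple roots. *)
Lemma finite_dim_semisimple (F : set homc) (b : homc) (t : T) : F `<=` Vc ->
  finite_dim F -> (forall w, F w -> F (act (vsval t) w)) -> F b ->
  exists2 as_, uniq as_ & prod_shift (act (vsval t)) as_ b = 0.
Proof.
move=> FV [n [s Fs]] Fact Fb.
have Fit i : F (iter i (act (vsval t)) b).
  by elim: i => [//|i IH]; rewrite iterS; exact: Fact.
have [u [i0 ui0] uE] := linear_dependence Fs (fun i : 'I_n.+1 => Fit i).
pose q := \poly_(i < n.+1) u (inord i).
have q0 : q != 0.
  apply: contraNneq ui0 => q0.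
  have := coef_poly n.+1 (fun i => u (inord i)) i0; rewrite -/q q0 coef0 ltn_ord.
  by rewrite inord_val => <-.
have [as_ us asP] := poly_root_seq q0; exists as_ => //.
apply: vanishing_eq0.
  apply: (prod_shift_stable _ hom_p_subspace) => [w|].
    exact: hom_p_act.
  exact: FV.
move=> m A nA _; have [ga _ gaP] := neg_word_weight nA.
have Vb := FV _ Fb.
rewrite (prod_shift_at t gaP) //.
have lop := shifted_act_linear ga t.
have [f fw bE] := wb_decomp esP (b (word A)).
have itf i mu : mu \in es -> iter i (shifted_act ga t) (f mu) =
    ((mu t : K) - ga t) ^+ i *: f mu.
  move=> me; elim: i => [|i IH]; first by rewrite expr0 scale1r.
  by rewrite iterS IH (linZ lop) (shifted_act_eigen ga t (fw _ me)) scalerA exprSr.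
have lit i : linear (iter i (shifted_act ga t)).
  by move=> a v w; elim: i => [//|i IH]; rewrite !iterS IH (linD lop) (linZ lop).
have zero mu : mu \in es -> q.[(mu t : K) - ga t] *: f mu = 0.
  apply: (wb_indep esP (f := fun mu => q.[(mu t : K) - ga t] *: f mu)).
    move=> nu ne t'; rewrite (linZ (actE_linear t')) (fw _ ne) !scalerA.
    by rewrite mulrC.
  have := congr1 (fun c : homc => c (word A)) uE.
  rewrite homc0 homc_sum => e0; rewrite -[RHS]e0.
  under [RHS]eq_bigr do rewrite homcZ (iter_act_at t gaP) // bE (lin_sum (lit _)) scaler_sumr.
  rewrite exchange_big /=; apply: eq_big_seq => mu' me.
  rewrite horner_poly scaler_suml; apply: eq_bigr => i _.
  by rewrite itf // scalerA inord_val.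
rewrite bE (lin_sum (prod_shift_linear lop _)) big_seq big1 // => mu me.
have /eqP := zero mu me; rewrite scaler_eq0 => /orP[/eqP/asP mem|/eqP ->]; last first.
  exact: (lin0 (prod_shift_linear lop _)).
rewrite (prod_shift_eigen lop _ (shifted_act_eigen ga t (fw _ me))).
rewrite (_ : \prod_(_ <- _) _ = 0) ?scale0r //.
apply/eqP; rewrite prodf_seq_eq0; apply/hasP; exists ((mu t : K) - ga t) => //.
by rewrite /= subrr.
Qed.

Lemma act_cartan_comm (t s : T) (b : homc) :
  act (vsval t) (act (vsval s) b) = act (vsval s) (act (vsval t) b).
Proof.
apply/eqP; rewrite -subr_eq0 -(act_br hom_act) (cartan_abelian Hg).
by rewrite (lin0 (act_linl hom_act b)).
Qed.

Lemma finite_dim_weights (F : set homc) (b : homc) : F `<=` Vc ->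
  is_subspace F -> finite_dim F -> (forall y w, F w -> F (act y w)) -> F b ->
  lspan [set w | F w /\ exists lam : dual, wtV lam w] b.
Proof.
move=> FV sF fF Fact Fb.
have bas (t : T) := coord_vbasis (memvf t).
apply: (lspanS _ (simultaneous_decomp (T := fun t : T => act (vsval t))
  (vbasis (fullv : {vspace T})) _ act_cartan_comm sF _ _ Fb)).
- move=> w [Fw ew]; split=> //.
  have [->|w0] := pselect (w = 0); first by exists 0; exact: (proj1 (weight_space_subspace hom_act 0)).
  have lin w' : linear (fun t : T => act (vsval t) w').
    by move=> a t s; rewrite linearP (act_linl hom_act).
  apply: (eigenvector_weight lin w0) => t.
  have /boolp.choice[a aE] i : exists a : K, act (vsval (vbasis (fullv : {vspace T}))`_i) w = a *: w.
    have [ilt|ige] := ltnP i (size (vbasis (fullv : {vspace T}))).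
      by apply: ew; exact: mem_nth.
    by exists 0; rewrite nth_default // (lin0 (lin w)) scale0r.
  exists (\sum_(i < \dim (fullv : {vspace T})) coord (vbasis fullv) i t * a i).
  rewrite {1}(bas t) (lin_sum (lin w)) scaler_suml; apply: eq_bigr => i _.
  by rewrite (linZ (lin w)) aE scalerA.
- by move=> t; exact: act_linear.
- by move=> t w; exact: Fact.
- move=> t w Fw; apply: (finite_dim_semisimple FV fF) => // v; exact: Fact.
Qed.

(** * A bound for the length of negative words *)

Local Notation Vf := (hom_p_finite p rho sigma iota : set homc).
Local Notation height := (fun lam : dual => complex.Re (lam xS : K)).

Lemma heightD lam mu : height (lam + mu) = height lam + height mu.
Proof. by rewrite /= add_lfunE raddfD. Qed.

Lemma negative_gap : exists2 d : R, 0 < d &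
  forall lam, negative lam -> height lam <= - d.
Proof.
have [ws _ wsE] := weight_seq Hg.
suff [d d0 H] : exists2 d : R, 0 < d & forall lam, lam \in ws -> height lam < 0 ->
    height lam <= - d.
  exists d => // lam [[l0 [x Hx x0]] neg]; apply: H.
    by apply/wsE; exists x.
  by move: neg; rewrite ltcE => /andP[].
elim: ws {wsE} => [|mu ws [d d0 H]]; first by exists 1.
have [mneg|mpos] := ltP (height mu) 0.
  exists (Num.min d (- height mu)); first by rewrite lt_min d0 oppr_gt0.
  move=> lam; rewrite inE => /orP[/eqP -> _|lw ln]; rewrite lerNr ge_min.
    by rewrite lexx orbT.
  by rewrite -lerNr H.
exists d => // lam; rewrite inE => /orP[/eqP ->|]; last exact: H.
by rewrite ltNge mpos.
Qed.

Lemma neg_sums_height d n ga : (forall lam, negative lam -> height lam <= - d) ->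
  neg_sums n ga -> height ga <= - (n%:R * d).
Proof.
move=> dP; elim: n ga => [|n IH] ga /=.
  by move=> ->; rewrite zero_lfunE /= mul0r oppr0.
move=> [mu [nu [/dP mud /IH nud ->]]]; rewrite heightD -natr1 mulrDl mul1r opprD addrC.
exact: lerD.
Qed.

(** A crude bound for the absolute value of the height of every weight of [E]. *)
Definition rep_height : R := \sum_(mu <- es) `|height mu|.

Lemma rep_height_ge mu : mu \in es -> - rep_height <= height mu.
Proof.
move=> me; rewrite lerNl /rep_height (big_rem mu me) /=.
apply: (@le_trans _ _ `|height mu|); first by rewrite -normrN ler_norm.
by rewrite lerDl; apply: sumr_ge0.
Qed.

(** The nonzero value has a weight of [E], namely [lam] plus the weight of the word,
    and each letter of the word lowers the height by at least [d]. *)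
Lemma nonzero_value_height d (b : homc) lam A :
  (forall lam, negative lam -> height lam <= - d) -> Vc b -> wtV lam b ->
  neg_word A -> b (word A) <> 0 -> (size A)%:R * d - rep_height <= height lam.
Proof.
move=> dP Hb Hl nA bA; have [ga Hga gaP] := neg_word_weight nA.
have gah := neg_sums_height dP Hga.
have Hw : wtE (lam + ga) (b (word A)).
  move=> t; have := act_at_neg_word t Hb gaP; rewrite (Hl t) homcZ.
  by move/eqP; rewrite eq_sym subr_eq => /eqP ->; rewrite add_lfunE scalerDl.
have := rep_height_ge (wb_mem actE_linear esP Hw bA).
rewrite heightD; move: (height lam) (height ga) gah => r s; lra.
Qed.

Lemma weight_height_lower (b : homc) lam : Vc b -> wtV lam b -> b <> 0 ->
  - rep_height <= height lam.
Proof.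
move=> Hb Hl b0; have [d d0 dP] := negative_gap.
have [A [nA bA]] : exists A, neg_word A /\ b (word A) <> 0.
  apply: contrapT => no; apply: b0; apply: (vanishing_eq0 Hb) => m A nA _.
  by apply: contrapT => bA; apply: no; exists A.
apply: (le_trans _ (nonzero_value_height dP Hb Hl nA bA)).
by rewrite lerDr mulr_ge0 // ltW.
Qed.

(** The weights of a finite-dimensional submodule are permuted by the
    reflections, so their heights are bounded below along the whole orbit of
    $x_\Sigma$; as the orbit sums to zero they are bounded above as well. *)
Lemma weight_height_upper : exists C : R, forall (F : set homc) (b : homc) lam,
  F `<=` Vc -> finite_dim F -> (forall y w, F w -> F (act y w)) ->
  F b -> b <> 0 -> wtV lam b -> height lam <= C.
Proof.
have [ys [xO OP O0]] := weyl_orbit_sum0 Hg xSR.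
exists (\sum_(y <- rem xS ys) rep_height) => F b lam FV fF Fact Fb b0 Hl.
have adm := finite_dim_admissible hom_act fF Fact (h := h).
have brDP : lie_bracket brD by case: Hg => _ _ [].
have refl (al : dual) c (mu : dual) : sl2_coroot (brD := brD) al c -> weights_in (act := act) F mu ->
    weights_in (act := act) F (mu - (mu c : K) *: al).
  by move=> Hc Hm; have [] := reflected_weight brDP hom_act adm Hc Hm.
have low y : y \in ys -> - complex.Re (lam y : K) <= rep_height.
  move=> /OP oy; have Fl : weights_in (act := act) F lam by exists b.
  have [mu [w [Fw Hw w0]] ->] := weyl_orbit_weight refl oy Fl.
  by rewrite lerNl; apply: (weight_height_lower (FV _ Fw)).
have : \sum_(y <- ys) complex.Re (lam y : K) = 0.
  by rewrite -raddf_sum -dual_sum O0 linear0.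
rewrite (big_rem xS xO) /= => /eqP; rewrite addr_eq0 => /eqP ->.
rewrite -sumrN !big_seq; apply: ler_sum => y yr; apply: low.
exact: mem_rem yr.
Qed.

Lemma finite_submodule (b : homc) : Vf b ->
  [/\ submodule_of (act := act) b `<=` Vc, finite_dim (submodule_of (act := act) b) & Vc b].
Proof.
move=> [Hb fb]; split=> //.
apply: (submodule_of_min hom_p_subspace Hb) => y w; exact: hom_p_act.
Qed.

Lemma finite_vanishing : exists N : nat, forall (b : homc) A, Vf b ->
  neg_word A -> (N < size A)%N -> b (word A) = 0.
Proof.
have [C CP] := weight_height_upper; have [d d0 dP] := negative_gap.
exists (Num.bound `|(C + rep_height) / d|) => b A Vb nA NA.
have [FV fF Hb] := finite_submodule Vb.
have sub : is_subspace (submodule_of (act := act) b) by exact: lspan_subspace.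
have stab y w : submodule_of (act := act) b w -> submodule_of (act := act) b (act y w).
  exact: (submodule_of_stable hom_act).
have Fb : submodule_of (act := act) b b by exact: submodule_of_id.
have := finite_dim_weights FV sub fF stab Fb.
apply: (lspan_min (W := [set w : homc | w (word A) = 0])).
  split=> [|a u v]; first exact: homc0.
  rewrite /mkset => u0 v0; rewrite homcD homcZ.
  by rewrite (u0 : u (word A) = 0) (v0 : v (word A) = 0) scaler0 addr0.
move=> w [Fw [lam Hl]] /=; apply: contrapT => wA.
have w0 : w <> 0 by move=> w0; apply: wA; rewrite w0 homc0.
have h1 := nonzero_value_height dP (FV _ Fw) Hl nA wA.
have h2 := CP _ _ _ FV fF stab Fw w0 Hl.
(* The lower bound grows with the length of the word, the upper one does not. *)
have : (size A)%:R <= (C + rep_height) / d.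
  by rewrite ler_pdivlMr //; move: h1 h2; move: (height lam) => r; lra.
apply/negP; rewrite -ltNge; apply: (le_lt_trans (ler_norm _)).
by apply: (lt_trans (archi_boundP (normr_ge0 _))); rewrite ltr_nat.
Qed.

(** * The finite elements as a closed subspace *)

(** The quantification over [ys] makes this set stable under $\mathfrak g_\Delta$. *)
Definition long_vanishing (N : nat) : set homc :=
  [set b | forall ys A, neg_word A -> (N < size A)%N -> foldr act b ys (word A) = 0].

Lemma neg_sums_seq n : exists s : seq dual, forall ga, neg_sums n ga -> ga \in s.
Proof.
have [ws _ wsE] := weight_seq Hg.
elim: n => [|n [s sP]]; first by exists [:: 0] => ga ->; exact: mem_head.
exists [seq mu + nu | mu <- ws, nu <- s] => _ [mu [nu [Hm /sP Hn ->]]].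
apply: allpairs_f => //; apply/wsE.
by case: Hm => -[_ [x Hx x0]] _; exists x.
Qed.

Lemma neg_sums_le_seq N :
  exists s : seq dual, forall n ga, (n <= N)%N -> neg_sums n ga -> ga \in s.
Proof.
elim: N => [|N [s sP]].
  have [s sP] := neg_sums_seq 0; exists s => n ga.
  by rewrite leqn0 => /eqP ->; exact: sP.
have [s' sP'] := neg_sums_seq N.+1; exists (s ++ s') => n ga.
rewrite mem_cat leq_eqVlt => /orP[/eqP -> /sP' ->|nN /(sP _ _ nN) ->//].
by rewrite orbT.
Qed.

Section LongVanishing.
Variable N : nat.
Local Notation M := (Vc `&` long_vanishing N).

Lemma foldr_act_linear ys : linear (fun b => foldr act b ys).
Proof. exact: (word_linear hom_act ys). Qed.

Lemma long_vanishing_subspace : is_subspace M.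
Proof.
apply: subspace_setI; first exact: hom_p_subspace.
split=> [ys A _ _|a u v Hu Hv ys A nA sA].
  by rewrite (lin0 (foldr_act_linear ys)) homc0.
rewrite (linD (foldr_act_linear ys)) (linZ (foldr_act_linear ys)) homcD homcZ.
by rewrite Hu // Hv // scaler0 addr0.
Qed.

Lemma long_vanishing_act y b : M b -> M (act y b).
Proof.
move=> [Hb lb]; split; first exact: hom_p_act.
move=> ys A nA sA; rewrite -(foldr_rcons act b ys y).
exact: lb.
Qed.

Lemma long_vanishing_at b m : M b -> (N < m)%N -> vanishes_at m b.
Proof. by move=> [_ lb] Nm A nA sA; apply: (lb [::]) => //; rewrite sA. Qed.

(** On $M$ every element of the Cartan subalgebra has finitely many
    eigenvalues: only the finitely many words of length at most [N] matter. *)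
Lemma long_vanishing_annihilator (t : T) : exists2 as_ : seq K, uniq as_ &
  forall b, M b -> prod_shift (act (vsval t)) as_ b = 0.
Proof.
have [s sP] := neg_sums_le_seq N.
pose as_ : seq K := [seq (mu t : K) - ga t | mu : dual <- es, ga : dual <- s].
exists (undup as_); first exact: undup_uniq.
move=> b Mb.
have Mp : M (prod_shift (act (vsval t)) (undup as_) b).
  apply: (prod_shift_stable _ long_vanishing_subspace) => // w.
  exact: long_vanishing_act.
apply: (vanishing_eq0 (proj1 Mp)) => m.
have [Nm|mN] := ltnP N m; first exact: long_vanishing_at.
move=> A nA sA; have [ga Hga gaP] := neg_word_weight nA.
rewrite (prod_shift_at t gaP); last by case: Mb.
have gs : ga \in s by apply: (sP (size A)) => //; rewrite sA.
have lop := shifted_act_linear ga t.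
have [f fw ->] := wb_decomp esP (b (word A)).
rewrite (lin_sum (prod_shift_linear lop _)) big_seq big1 // => mu me.
rewrite (prod_shift_eigen lop _ (shifted_act_eigen ga t (fw _ me))).
rewrite (_ : \prod_(_ <- _) _ = 0) ?scale0r //.
apply/eqP; rewrite prodf_seq_eq0; apply/hasP; exists ((mu t : K) - ga t).
  by rewrite mem_undup; apply/allpairsP; exists (mu, ga).
by rewrite /= subrr.
Qed.

Lemma algebraic_of_annihilator (W : lmodType K) (a : gD -> W -> W) y as_ v :
  linear (a y) -> prod_shift (a y) as_ v = 0 -> algebraic_at (act := a) y v (size as_).
Proof.
by move=> la v0; have := prod_shift_lower la as_ v; rewrite v0 subr0.
Qed.

Lemma algebraic_of_nilpotent (W : lmodType K) (a : gD -> W -> W) y n v :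
  iter n (a y) v = 0 -> algebraic_at (act := a) y v n.
Proof. by move=> v0; rewrite /algebraic_at v0; exact: (proj1 (lspan_subspace _)). Qed.

(** Elements of the Cartan subalgebra are diagonalizable and root vectors are
    nilpotent on $M$, so a spanning family acts algebraically. *)
Lemma long_vanishing_finite b : M b -> Vf b.
Proof.
move=> Mb; split; first by case: Mb.
have [ys ysT ysw] := root_vectors_spanning_seq Hg.
apply: (algebraic_finite_dim hom_act (v := b) ysT) => y /ysw[al Hy].
have [a0|a0] := eqVneq al 0.
  rewrite a0 in Hy; have yh := root_space0 Hg Hy.
  have [as_ _ asP] := long_vanishing_annihilator (vsproj h y).
  exists (size as_); apply: algebraic_of_annihilator; first exact: act_linear.
  by have := asP _ Mb; rewrite vsprojK.
have [t at0] := dual_neq0 a0.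
have [as_ us asP] := long_vanishing_annihilator t.
have [n nP] := root_vector_nilpotent hom_act long_vanishing_subspace
  long_vanishing_act us asP (Hy t) at0 Mb.
by exists n; exact: algebraic_of_nilpotent.
Qed.

Lemma finite_long_vanishing : (forall (b : homc) A, Vf b -> neg_word A ->
  (N < size A)%N -> b (word A) = 0) -> Vf `<=` M.
Proof.
move=> van b Vb; have [FV fF Hb] := finite_submodule Vb; split=> // ys A nA sA.
apply: van => //; have Fw : submodule_of (act := act) b (foldr act b ys).
  by apply: lspan_gen; exists ys.
split; first exact: FV.
apply: finite_dimS fF; apply: submodule_of_min; first exact: lspan_subspace.
  exact: Fw.
by move=> y w; exact: (submodule_of_stable hom_act).
Qed.

End LongVanishing.

Lemma finiteE : exists N, Vf = Vc `&` long_vanishing N.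
Proof.
have [N NP] := finite_vanishing; exists N; apply/seteqP; split.
  exact: finite_long_vanishing.
by move=> b; exact: long_vanishing_finite.
Qed.

(** $U(\mathfrak g_\Delta)(x.b)$ is contained in the span of
    $(U(\mathfrak g_\Delta)x).(U(\mathfrak g_\Delta)b)$. *)
Lemma finite_invariant x (b : homc) : Vf b -> Vf (homc_act x b).
Proof.
move=> Vb; have [FV fF Hb] := finite_submodule Vb; split; first exact: hom_p_act.
have gact := graded_action Hg.
have [ws _ wb] := graded_weight_basis Hg.
have [ys ysT ysw] := root_vectors_spanning_seq Hg.
pose X := submodule_of (act := fun y x => br (iota y) x) x.
have fX : finite_dim X.
  apply: (algebraic_finite_dim gact (v := x) ysT) => y /ysw[al Hy].
  have [a0|a0] := eqVneq al 0; last first.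
    have [n nP] := graded_nilpotent Hg x a0 Hy.
    by exists n; exact: (algebraic_of_nilpotent (a := fun y x => br (iota y) x)).
  rewrite a0 in Hy; have yh := root_space0 Hg Hy.
  pose as_ : seq K := [seq (lam (vsproj h y) : K) | lam : dual <- ws].
  exists (size as_).
  apply: (algebraic_of_annihilator (a := fun y x => br (iota y) x)).
    exact: (act_linr gact).
  have := prod_shift_weights lad (t := vsproj h y) (as_ := as_) x wb (fun _ H => H).
  by rewrite /ad_graded vsprojK.
have fXF := finite_dim_bilinear (@homc_act_linearl _ _ _ sigma E)
  (@homc_act_linear _ _ _ sigma E) fX fF.
apply: (finite_dimS _ (finite_dim_span fXF)).
have gP := homc_lie_action (E := E) (proj1 HU).
apply: submodule_of_min; first exact: lspan_subspace.
  apply: lspan_gen; exists x, b; split=> //; exact: submodule_of_id.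
move=> y w; set S := lspan _; have sS : is_subspace S by exact: lspan_subspace.
apply: (lspan_min (W := [set w | S (act y w)])).
  split=> [|a u v] /=; first by rewrite (lin0 (act_linear y)); case: sS.
  by rewrite (linD (act_linear y)) (linZ (act_linear y)); case: sS => _; apply.
move=> _ [x' [b' [Xx' Fb' ->]]] /=.
have -> : act y (homc_act x' b') =
    homc_act (br (iota y) x') b' + homc_act x' (act y b').
  by rewrite (act_br gP) subrK.
apply: subspD => //; apply: lspan_gen.
  exists (br (iota y) x'), b'; split=> //.
  exact: (submodule_of_stable gact).
exists x', (act y b'); split=> //; exact: (submodule_of_stable hom_act).
Qed.

(** Each action puts its letter in front of the argument, at the price of a sign,
    so the letters come out in reverse order. *)
Lemma foldr_act_word b ys D : foldr act b ys D =
  (-1) ^+ size ys *: b (word (rev (map iota ys)) * D).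
Proof.
elim: ys D => [|y ys IH] D; first by rewrite /= word_nil mul1r scale1r.
rewrite /= IH exprS mulN1r scaleNr rev_cons word_rcons.
by rewrite mulrA.
Qed.

Lemma foldr_act_word0 b ys A :
  foldr act b ys (word A) = 0 <-> b (word (rev (map iota ys) ++ A)) = 0.
Proof.
rewrite foldr_act_word -word_cat; split=> [/eqP|->]; last by rewrite scaler0.
by rewrite scaler_eq0 signr_eq0 => /eqP.
Qed.

Lemma closed_word_kernel Z : closed [set b : homc | b (word Z) = 0].
Proof.
move=> b clb; apply: rnorm0_eq0; apply/eqP; rewrite eq_le rnorm_ge0 andbT.
apply/ler_addgt0Pr => e e0; rewrite add0r.
pose P := \prod_(x <- Z) rnorm x + 1.
have P0 : 0 < P by rewrite ltr_pwDr // prod_rnorm_ge0.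
have nb : nbhs b [set c : homc | forall k, (k <= size Z)%N -> seminorm k (c - b) < e / P].
  by exists (size Z), (e / P); split; first exact: divr_gt0.
have [c [cZ /(_ _ (leqnn _)) cb]] := clb _ nb.
have -> : b (word Z) = - (c - b) (word Z).
  by rewrite homcB (cZ : c (word Z) = 0) sub0r opprK.
rewrite rnormN; apply: (le_trans (seminorm_word _ _)).
apply: (@le_trans _ _ (e / P * P)); last by rewrite divfK // gt_eqF.
by apply: ler_pM; rewrite ?seminorm_ge0 ?prod_rnorm_ge0 ?(ltW cb) // lerDl.
Qed.

Lemma closed_long_vanishing N : closed (long_vanishing N).
Proof.
move=> b clb ys A nA sA; apply/foldr_act_word0.
apply: closed_word_kernel => B /clb[c [lc Bc]]; exists c; split=> //.
by apply/foldr_act_word0; exact: lc.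
Qed.

Lemma seminorm_cvg_word (u : nat -> homc) b :
  (forall k (e : R), 0 < e -> exists n0, forall n, (n0 <= n)%N -> seminorm k (u n - b) <= e) ->
  forall Z, rnorm_cvg (fun n => u n (word Z)) (b (word Z)).
Proof.
move=> ub Z e e0; pose P := \prod_(x <- Z) rnorm x + 1.
have P0 : 0 < P by rewrite ltr_pwDr // prod_rnorm_ge0.
have [n0 H] := ub (size Z) (e / 2 / P) ltac:(by rewrite !divr_gt0).
exists n0 => n /H h1; rewrite -homcB.
apply: (le_lt_trans (seminorm_word _ _)).
apply: (@le_lt_trans _ _ (e / 2 / P * P)).
  by apply: ler_pM; rewrite ?seminorm_ge0 ?prod_rnorm_ge0 // lerDl.
by rewrite divfK ?gt_eqF // ltr_pdivrMr // ltr_pMr // ltr1n.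
Qed.

Lemma hom_p_limit (u : nat -> homc) b : (forall n, Vc (u n)) ->
  (forall k (e : R), 0 < e -> exists n0, forall n, (n0 <= n)%N -> seminorm k (u n - b) <= e) ->
  Vc b.
Proof.
move=> Vu ub x D px; have lx := rep_linear_at px.
apply: (lspan_min (W := [set D | b (D * sigma x) = - rho x (b D)]) _ _
   (enveloping_spanned D HU)).
  split=> [|a v w /= Hv Hw].
    by rewrite /= mul0r (lin0 (homc_linear b)) (lin0 lx) oppr0.
  rewrite mulrDl -scalerAl !(homc_linear b) Hv Hw (linD lx) (linZ lx).
  by rewrite opprD scalerN.
move=> _ [Z _ <-] /=; rewrite -word_rcons.
apply: (rnorm_cvg_unique (seminorm_cvg_word ub _)).
have [L L0 LP] := rep_bound.
move=> e e0; have P0 : 0 < L * rnorm x + 1.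
  by rewrite ltr_pwDr // mulr_ge0 ?rnorm_ge0.
have [n0 H] := seminorm_cvg_word ub Z ltac:(exact: (divr_gt0 e0 P0)).
exists n0 => n /H h1; rewrite word_rcons Vu // -opprD rnormN -(linB lx).
apply: (le_lt_trans (LP _ _ px)).
apply: (@le_lt_trans _ _ ((L * rnorm x + 1) * rnorm (u n (word Z) - b (word Z)))).
  by rewrite ler_wpM2r ?rnorm_ge0 // lerDl.
by rewrite mulrC -ltr_pdivlMr.
Qed.

(** * The norm on the finite elements *)

Definition jet_norm (N : nat) (b : homc) : R := \sum_(k < N.+1) seminorm k b.

Lemma jet_norm_ge N k b : (k <= N)%N -> seminorm k b <= jet_norm N b.
Proof.
rewrite -ltnS => kN; rewrite /jet_norm (bigD1 (Ordinal kN)) //= lerDl.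
by apply: sumr_ge0 => i _; exact: seminorm_ge0.
Qed.

Lemma jet_norm_ge0 N b : 0 <= jet_norm N b.
Proof. by apply: sumr_ge0 => i _; exact: seminorm_ge0. Qed.

Lemma jet_norm_lt N b (e : R) :
  (forall k, (k <= N)%N -> seminorm k b < e / N.+1%:R) -> jet_norm N b < e.
Proof.
move=> be; have -> : e = \sum_(k < N.+1) e / N.+1%:R.
  by rewrite sumr_const card_ord -[RHS]mulr_natr divfK // pnatr_eq0.
by apply: ltr_sum => [|i _]; [apply/hasP; exists ord0; rewrite ?mem_index_enum|apply: be; rewrite -ltnS].
Qed.

(** Above degree [N] each seminorm is dominated by the preceding one. *)
Lemma seminorm_jet_bound N n : exists2 C : R, 0 <= C &
  forall b, (Vc `&` long_vanishing N) b -> seminorm n b <= C * jet_norm N b.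
Proof.
elim: n => [|n [C C0 IH]].
  by exists 1 => // b _; rewrite mul1r; exact: jet_norm_ge.
have [nN|Nn] := leqP n.+1 N.
  by exists 1 => // b _; rewrite mul1r; exact: jet_norm_ge.
have [C' C'0 H] := seminorm_step n; exists (C' * C); first exact: mulr_ge0.
move=> b Mb; apply: (le_trans (H b _ _)); first by case: Mb.
  exact: long_vanishing_at Mb _.
by rewrite -mulrA ler_wpM2l // IH.
Qed.

Lemma finite_banach : is_banach_subspace Vf.
Proof.
have [N ->] := finiteE; set M := Vc `&` _.
have sM : is_subspace M by exact: long_vanishing_subspace.
have bound := seminorm_jet_bound N.
exists (jet_norm N); split.
- split=> [b _|b Mb b0|a b _ _|a b _].
  + exact: jet_norm_ge0.
  + apply: homc_eq0 => n; have [C C0 H] := bound n.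
    apply/eqP; rewrite eq_le seminorm_ge0 andbT; apply: (le_trans (H b Mb)).
    by rewrite b0 mulr0.
  + rewrite /jet_norm -big_split /=; apply: ler_sum => k _; exact: seminormD.
  + rewrite -cabsE -rmorphM /jet_norm mulr_sumr.
    by congr (_%:C); apply: eq_bigr => k _; rewrite seminormZ.
- move=> u Mu uC.
  have uC' k (e : R) : 0 < e -> exists n0, forall m n, (n0 <= m)%N -> (n0 <= n)%N ->
      seminorm k (u m - u n) < e.
    move=> e0; have [C C0 H] := bound k; have C1 : 0 < C + 1 by rewrite ltr_pwDr.
    have [n0 H0] := uC (e / (C + 1)) ltac:(exact: divr_gt0).
    exists n0 => m n mn nn; apply: (le_lt_trans (H _ (subspB sM (Mu m) (Mu n)))).
    apply: (@le_lt_trans _ _ ((C + 1) * jet_norm N (u m - u n))).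
      by rewrite ler_wpM2r ?jet_norm_ge0 // lerDl.
    by rewrite mulrC -ltr_pdivlMr // H0.
  have [b ub] := homc_complete (fun D => enveloping_spanned D HU) uC'.
  exists b.
    split; first by apply: (hom_p_limit _ ub) => n; case: (Mu n).
    move=> ys A nA sA; apply/foldr_act_word0.
    apply: (rnorm_cvg_unique (seminorm_cvg_word ub _)) => e e0; exists 0%N => n _.
    have /foldr_act_word0 -> : foldr act (u n) ys (word A) = 0.
      by case: (Mu n) => _; apply.
    by rewrite subrr rnorm0.
  apply/cvgrPdist_lt => e e0.
  have /boolp.choice[m mP] k : exists n0, forall n, (n0 <= n)%N ->
      seminorm k (u n - b) <= e / N.+1%:R / 2.
    by apply: ub; rewrite !divr_gt0 // ltr0n.
  exists (\sum_(k < N.+1) m k)%N => // n /= nn.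
  rewrite sub0r normrN ger0_norm ?jet_norm_ge0 //; apply: jet_norm_lt => k kN.
  have kN' : (k < N.+1)%N by [].
  have en : 0 < e / N.+1%:R by rewrite divr_gt0 // ltr0n.
  apply: (@le_lt_trans _ _ (e / N.+1%:R / 2)).
    by apply: mP; apply: leq_trans nn; rewrite (bigD1 (Ordinal kN')) //= leq_addr.
  by rewrite ltr_pdivrMr // ltr_pMr // ltr1n.
- move=> b Mb A; split.
    move=> [n [e [e0 eA]]].
    have /boolp.choice[C CP] k : exists C : R, 0 <= C /\
        forall b, M b -> seminorm k b <= C * jet_norm N b.
      by have [C C0 H] := bound k; exists C.
    pose D := \sum_(k < n.+1) C k + 1.
    have D0 : 0 < D by rewrite ltr_pwDr // sumr_ge0 // => k _; case: (CP k).
    exists (e / D); first exact: divr_gt0.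
    move=> c Mc cb; apply: eA => // k kn.
    have [Ck0 Ck] := CP k.
    apply: (le_lt_trans (Ck _ (subspB sM Mc Mb))).
    apply: (@le_lt_trans _ _ (D * jet_norm N (c - b))).
      rewrite ler_wpM2r ?jet_norm_ge0 //.
      have kn' : (k < n.+1)%N by [].
      rewrite /D (bigD1 (Ordinal kn')) //= -addrA lerDl addr_ge0 //.
      by apply: sumr_ge0 => i _; case: (CP i).
    by rewrite mulrC -ltr_pdivlMr.
  move=> [e e0 eA]; exists N, (e / N.+1%:R); split; first by rewrite divr_gt0 // ltr0n.
  move=> c cb Mc; apply: eA => //; exact: jet_norm_lt.
Qed.

End ParabolicRepresentation.

Theorem theorem2p12 (R : realType)
    (V : vectType R) (Delta : seq V)
    (gD : vectType R[i]) (brD : gD -> gD -> gD) (h : {vspace gD})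
    (g : completeNormedModType R[i]) (br : g -> g -> g) (iota : gD -> g)
    (Hg : weakly_graded br brD h iota Delta)
    (p : set g) (Hp : parabolic_subalgebra br brD h iota p)
    (E : completeNormedModType R[i]) (rho : g -> E -> E)
    (Hrho : banach_rep br p rho)
    (HE : exists P, weight_decomposition
            (fun (t : subvs_of h) (v : E) => rho (iota (vsval t)) v) P)
    (U : algType R[i]) (sigma : {linear g -> U})
    (HU : enveloping_algebra br sigma) :
  let Vc : set (homc sigma E) := hom_p p rho sigma in
  let Vf : set (homc sigma E) := hom_p_finite p rho sigma iota in
  [/\ is_subspace Vf,
      closed (Vf : set (subspace Vc)),
      forall x b, Vf b -> Vf (homc_act x b),
      is_banach_subspace Vf &
      {within setT `*` Vf,
        continuous (fun z : g * homc sigma E => homc_act z.1 z.2)}].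
Proof.
case: Hp Hrho => xS xSR -> {p} Hrho Vc Vf.
have lE := actE_linear Hg Hrho.
case: HE => P /(weight_basis_of lE)[es _ esP].
have [N VfE] := finiteE Hg xSR Hrho HU esP.
split.
- rewrite /Vf VfE; exact: (long_vanishing_subspace Hg Hrho HU).
- apply/closed_subspaceP; rewrite /Vf VfE; set M := long_vanishing N.
  exists M; first exact: closed_long_vanishing.
  by rewrite setIAC setIid setIC.
- by move=> x b; exact: (finite_invariant Hg Hrho HU).
- exact: (finite_banach Hg xSR Hrho HU esP).
- by apply: continuous_subspaceT; exact: homc_act_continuous.
Qed.
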